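(* For integers $1\le m\le n$, define $F_{m\to n}:\mathcal S^+(m)\to\mathcal S^+(n)$ by $F_{m\to n}=\mathrm{id}_{\mathcal S^+(n)}$ if $m=n$ and $F_{m\to n}=F_n\circ F_{n-1}\circ\cdots\circ F_{m+1}$ if $m<n$; for integers $2\le m\le n$, define $E_{m\to n}:\mathrm{Cor}^+(m)\to\mathrm{Cor}^+(n)$ by $E_{m\to n}=\mathrm{id}_{\mathrm{Cor}^+(n)}$ if $m=n$ and $E_{m\to n}=E_{n-1}\circ E_{n-2}\circ\cdots\circ E_m$ if $m<n$. Then each $F_{m\to n}$ (for the metrics $g^{\mathrm{LE}}$) and each $E_{m\to n}$ (for the metrics $g^{\mathrm{OL}}$) is a totally geodesic isometric embedding. Let $d_n^{\mathrm{LE}}$ denote the geodesic distance of $g^{\mathrm{LE}}$ on $\mathcal S^+(n)$ and $d_n^{\mathrm{OL}}$ the geodesic distance of $g^{\mathrm{OL}}$ on $\mathrm{Cor}^+(n)$. Then for any $X\in\mathcal S^+(m)$, $Y\in\mathcal S^+(n)$ (with $m,n\ge1$) and any $N\ge\max\{m,n\}$, the quantity $$\delta^{\mathrm{LE}}(X,Y):=d_N^{\mathrm{LE}}\bigl(F_{m\to N}(X),F_{n\to N}(Y)\bigr)$$ is independent of $N$. Likewise, for any $C\in\mathrm{Cor}^+(m)$, $D\in\mathrm{Cor}^+(n)$ (with $m,n\ge2$) and any $N\ge\max\{m,n\}$, the quantity $$\delta^{\mathrm{OL}}(C,D):=d_N^{\mathrm{OL}}\bigl(E_{m\to N}(C),E_{n\to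 N}(D)\bigr)$$ is independent of $N$. In particular, if $m\le n$, then $$\delta^{\mathrm{LE}}(X,Y)=d_n^{\mathrm{LE}}\bigl(F_{m\to n}(X),Y\bigr),\qquad\delta^{\mathrm{OL}}(C,D)=d_n^{\mathrm{OL}}\bigl(E_{m\to n}(C),D\bigr).$$ Thus these nested hierarchies of embeddings induce natural distances on the disjoint unions $$\bigsqcup_{n\ge1}\mathcal S^+(n)\qquad\text{and}\qquad\bigsqcup_{n\ge2}\mathrm{Cor}^+(n),$$ thereby providing a geometrically consistent way to compare symmetric positive-definite matrices and full-rank correlation matrices of different sizes.
   Context: $\mathcal S(k)$ = real symmetric $k\times k$ matrices, $\mathcal S^+(k)$ = symmetric positive-definite ones, $\mathrm{Cor}^+(n)$ = full-rank correlation matrices, i.e. matrices in $\mathcal S^+(n)$ with unit diagonal, $\mathrm{Hol}(n)$ = symmetric matrices with zero diagonal, $\mathrm{Diag}(n)$ = diagonal matrices; $\mathrm{off}(A)$ is $A$ with its diagonal set to zero; $\exp,\log$ are the matrix exponential and logarithm; $\langle A,B\rangle=\mathrm{tr}(AB)$ is the Frobenius inner product. Known facts: for each $S\in\mathcal S(n)$ there is a unique $\mathcal D(S)\in\mathrm{Diag}(n)$ with $\exp(S+\mathcal D(S))\in\mathrm{Cor}^+(n)$, and $\mathcal D$ is smooth; $\mathrm{Log}:=\mathrm{off}\circ\log:\mathrm{Cor}^+(n)\to\mathrm{Hol}(n)$ is a diffeomorphism with inverse $S\mapsto\exp(S+\mathcal D(S))$. Metrics: $g^{\mathrm{LE}}=\log^*\langle\cdot,\cdot\rangle$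 on $\mathcal S^+(k)$ and $g^{\mathrm{OL}}=\mathrm{Log}^*\langle\cdot,\cdot\rangle$ on $\mathrm{Cor}^+(n)$. For $n\ge2$, $\psi_{\mathrm{OL}}^{(n)}:\mathcal S(n-1)\to\mathrm{Hol}(n)$ is the linear isometry $\psi_{\mathrm{OL}}^{(n)}(S)=\begin{bmatrix}0&\frac1{\sqrt2}\mathrm{diag}(S)^\top\\\frac1{\sqrt2}\mathrm{diag}(S)&\mathrm{off}(S)\end{bmatrix}$, with $\mathrm{diag}(S)\in\mathbb R^{n-1}$ the column vector of diagonal entries. Set $\Phi_{\mathrm{OL}}^{(n)}:\mathcal S^+(n-1)\to\mathrm{Cor}^+(n)$, $\Phi_{\mathrm{OL}}^{(n)}(X)=\exp\bigl(\mathcal D(\psi_{\mathrm{OL}}^{(n)}(\log X))+\psi_{\mathrm{OL}}^{(n)}(\log X)\bigr)$ (a diffeomorphism); $F_n:\mathcal S^+(n-1)\to\mathcal S^+(n)$, $F_n(X)=\exp(\psi_{\mathrm{OL}}^{(n)}(\log X))$; and $E_n:=\Phi_{\mathrm{OL}}^{(n+1)}\circ F_n\circ(\Phi_{\mathrm{OL}}^{(n)})^{-1}:\mathrm{Cor}^+(n)\to\mathrm{Cor}^+(n+1)$.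
   Formalization: The ''natural distances on the disjoint unions'' are stated as finite pseudo-distances: distinct points such as X and F_{m→n}(X) are at distance 0, so δ=0 is characterized as equality of the images in the common size max(m,n). *)

(* Defs.v *)
(* MathComp-Analysis; R is an arbitrary realType. *)
From HB Require Import structures.
From mathcomp Require Import all_boot all_order all_algebra.
From mathcomp Require Import all_classical all_reals all_analysis.

Set Implicit Arguments.
Unset Strict Implicit.
Unset Printing Implicit Defensive.

Import Order.TTheory GRing.Theory Num.Theory.
Import numFieldNormedType.Exports.

Local Open Scope classical_set_scope.
Local Open Scope ring_scope.

(* Every manifold here is a relatively open subset M of an affine subspace of
   a matrix space, whose direction T is the tangent space at every point of M.
   Derivatives are taken along directions v in T only, so they never depend on
   the values of a function outside of M. *)
Section Smoothness.
Context {R : realType} {V W : normedModType R}.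
Implicit Types (M T : set V) (f : V -> W).

Fixpoint Cn_on (k : nat) M T f : Prop :=
  {within M, continuous f} /\
  match k with
  | 0 => True
  | k'.+1 => forall v, T v ->
      (forall x, M x -> derivable f x v) /\ Cn_on k' M T ('D_v f)
  end.

Definition smooth_on M T f : Prop := forall k, Cn_on k M T f.

End Smoothness.

(* `metric x v w` is only meaningful for x in points and v, w in tangent. *)
Record riemannian (R : realType) (V : normedModType R) := Riemannian {
  points : set V;
  tangent : set V;
  metric : V -> V -> V -> R }.

Section Riemannian.
Context {R : realType}.

Section OneManifold.
Context {V : normedModType R}.
Implicit Types (G : riemannian V) (c : R -> V).

(* Christoffel symbols of the first kind of the Levi-Civita connection in the
   affine coordinates of V: the value at (u, v, w) is g(nabla_u v, w) for the
   constant vector fields u, v, w (Koszul formula). *)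
Definition christoffel G (x u v w : V) : R :=
  2^-1 * ('D_u (fun y => metric G y v w : R^o) x
        + 'D_v (fun y => metric G y u w : R^o) x
        - 'D_w (fun y => metric G y u v : R^o) x).

(* The geodesic equation nabla_(c') c' = 0, tested against all tangent w. *)
Definition geodesic G (I : set R) c : Prop :=
  [/\ smooth_on (V := R^o) I setT c,
      (forall t, I t -> points G (c t)) &
      forall t w, I t -> tangent G w ->
        metric G (c t) (derive1n 2 c t) w
          + christoffel G (c t) (derive1 c t) (derive1 c t) w = 0].

(* C^1 on [a, b]: the derivative on ]a, b[ extends continuously to [a, b]. *)
Definition C1_segment c (a b : R) : Prop :=
  exists2 dc : R -> V, {within `[a, b], continuous dc} &
    forall t, a < t < b -> is_derive (t : R^o) 1 c (dc t).

Definition piecewise_C1 c (a b : R) : Prop :=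
  {within `[a, b], continuous c} /\
  exists s : seq R, [/\ path <%R a s, last a s = b &
    forall i, (i < size s)%N -> C1_segment c (nth a (a :: s) i) (nth a s i)].

Definition curve_length G c (a b : R) : \bar R :=
  (\int[lebesgue_measure]_(t in `[a, b])
     (Num.sqrt (metric G (c t) (derive1 c t) (derive1 c t)))%:E)%E.

Definition geodesic_dist G (x y : V) : \bar R :=
  ereal_inf [set l | exists c : R -> V,
    [/\ piecewise_C1 c 0 1, (forall t, 0 <= t <= 1 -> points G (c t)),
        c 0 = x, c 1 = y & l = curve_length G c 0 1]].

End OneManifold.

Section TwoManifolds.
Context {V W : normedModType R}.
Implicit Types (G : riemannian V) (H : riemannian W) (f : V -> W).

(* Injective immersion which is a homeomorphism onto its image. *)
Definition smooth_embedding G H f : Prop :=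
  [/\ (forall x, points G x -> points H (f x)),
      smooth_on (points G) (tangent G) f,
      (forall x v, points G x -> tangent G v -> 'D_v f x = 0 -> v = 0) &
      exists2 h : W -> V, {within f @` points G, continuous h} &
        forall x, points G x -> h (f x) = x].

Definition isometric G H f : Prop :=
  forall x v w, points G x -> tangent G v -> tangent G w ->
    metric H (f x) ('D_v f x) ('D_w f x) = metric G x v w.

Definition totally_geodesic G H f : Prop :=
  forall (I : set R) (c : R -> V), open I -> is_interval I ->
    geodesic G I c -> geodesic H I (f \o c).

Definition totally_geodesic_isometric_embedding G H f : Prop :=
  [/\ smooth_embedding G H f, isometric G H f & totally_geodesic G H f].

End TwoManifolds.

End Riemannian.

Section Matrices.
Context {R : realType}.

Definition expm n (A : 'M[R]_n) : 'M[R]_n :=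
  limn (series (fun k => k`!%:R^-1 *: A ^+ k)).

Definition Sym n : set 'M[R]_n := [set A | A \is symmetricmx].

Definition SPD n : set 'M[R]_n :=
  [set A | Sym A /\ forall v : 'cV[R]_n, v != 0 -> 0 < (v^T *m A *m v) 0 0].

Definition Cor n : set 'M[R]_n := [set A | SPD A /\ forall i, A i i = 1].

Definition Hol n : set 'M[R]_n := [set A | Sym A /\ forall i, A i i = 0].

Definition off n (A : 'M[R]_n) : 'M[R]_n :=
  \matrix_(i, j) (if i == j then 0 else A i j).

Definition diagcol n (A : 'M[R]_n) : 'cV[R]_n := \col_i A i i.

Definition frobenius n (A B : 'M[R]_n) : R := \tr (A *m B).

(* The inverse of exp : Sym n -> SPD n. *)
Definition logm n : 'M[R]_n -> 'M[R]_n :=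
  'pinv_(fun=> 0) (@Sym n) (@expm n).

(* The unique diagonal D such that exp (S + D) has full rank and is a
   correlation matrix. *)
Definition Dcor n (S : 'M[R]_n) : 'M[R]_n :=
  xget 0 [set D | is_diag_mx D /\ Cor (expm (S + D))].

Definition Log n (C : 'M[R]_n) : 'M[R]_n := off (logm C).

Definition pullback_metric n (phi : 'M[R]_n -> 'M[R]_n) (X A B : 'M[R]_n) : R :=
  frobenius ('D_A phi X) ('D_B phi X).

Definition gLE n : riemannian 'M[R]_n :=
  Riemannian (@SPD n) (@Sym n) (pullback_metric (@logm n)).

(* Cor n is open in the affine space 1 + Hol n. *)
Definition gOL n : riemannian 'M[R]_n :=
  Riemannian (@Cor n) (@Hol n) (pullback_metric (@Log n)).

Definition dLE n : 'M[R]_n -> 'M[R]_n -> \bar R := geodesic_dist (gLE n).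
Definition dOL n : 'M[R]_n -> 'M[R]_n -> \bar R := geodesic_dist (gOL n).

(* In the next definitions, k is the size of the smaller matrix:
   psiOL k, PhiOL k and Fstep k have superscript (or index) n = k + 1. *)
Definition psiOL k (S : 'M[R]_k) : 'M[R]_k.+1 :=
  block_mx (0 : 'M[R]_1) ((Num.sqrt 2)^-1 *: (diagcol S)^T)
           ((Num.sqrt 2)^-1 *: diagcol S) (off S).

Definition PhiOL k (X : 'M[R]_k) : 'M[R]_k.+1 :=
  expm (Dcor (psiOL (logm X)) + psiOL (logm X)).

Definition PhiOLinv k : 'M[R]_k.+1 -> 'M[R]_k :=
  'pinv_(fun=> 0) (@SPD k) (@PhiOL k).

Definition Fstep k (X : 'M[R]_k) : 'M[R]_k.+1 := expm (psiOL (logm X)).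

(* Estep n is E_n : Cor n -> Cor n.+1 for n >= 2 (a dummy value at n = 0). *)
Definition Estep n : 'M[R]_n -> 'M[R]_n.+1 :=
  match n with
  | 0 => fun _ => 0
  | k.+1 => fun C => PhiOL (Fstep (PhiOLinv C))
  end.

(* step (n - 1) o ... o step m for m <= n, the identity for m = n (where
   conform_mx only changes the type), and a dummy value for m > n. *)
Fixpoint tower (step : forall k, 'M[R]_k -> 'M[R]_k.+1) (m n : nat)
    (X : 'M[R]_m) : 'M[R]_n :=
  if m == n then conform_mx 0 X else
  match n with
  | 0 => 0
  | n'.+1 => step n' (tower step n' X)
  end.

Definition Fmap m n : 'M[R]_m -> 'M[R]_n := @tower Fstep m n.
Definition Emap m n : 'M[R]_m -> 'M[R]_n := @tower Estep m n.

Definition deltaLE m n (X : 'M[R]_m) (Y : 'M[R]_n) : \bar R :=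
  dLE (Fmap (maxn m n) X) (Fmap (maxn m n) Y).

Definition deltaOL m n (C : 'M[R]_m) (D : 'M[R]_n) : \bar R :=
  dOL (Emap (maxn m n) C) (Emap (maxn m n) D).

(* A finite distance, except that distinct points x, y may be at distance 0;
   this happens exactly when sim x y. *)
Definition distance_up_to (U : Type) (P : set U) (sim : U -> U -> Prop)
    (d : U -> U -> \bar R) : Prop :=
  [/\ (forall x y, P x -> P y -> 0 <= d x y < +oo)%E,
      (forall x y, P x -> P y -> d x y = d y x),
      (forall x y z, P x -> P y -> P z -> d x z <= d x y + d y z)%E &
      forall x y, P x -> P y -> d x y = 0%E <-> sim x y].

(* Matrices of all sizes. *)
Definition anymx := {n : nat & 'M[R]_n}.

Definition SPDs : set anymx := [set u | (1 <= tag u)%N /\ SPD (tagged u)].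
Definition Cors : set anymx := [set u | (2 <= tag u)%N /\ Cor (tagged u)].

Definition Fsim (u v : anymx) : Prop :=
  Fmap (maxn (tag u) (tag v)) (tagged u) =
  Fmap (maxn (tag u) (tag v)) (tagged v).
Definition Esim (u v : anymx) : Prop :=
  Emap (maxn (tag u) (tag v)) (tagged u) =
  Emap (maxn (tag u) (tag v)) (tagged v).

End Matrices.

(* Main.v *)
(* The maps log and Log identify both families of manifolds isometrically with
   the Euclidean spaces Sym n and Hol n.  Hence geodesics are the curves that are
   affine in these coordinates, the distance of two points is the Frobenius norm
   of the difference of their coordinates, and a map which is a linear isometry
   in coordinates is a totally geodesic isometric embedding that preserves
   distances.  In coordinates F_n is psi_OL : Sym (n - 1) -> Hol n, and E_n is
   the restriction of psi_OL to Hol n, since psi_OL is onto Hol n.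

   That the coordinates are smooth charts rests on the strict monotonicity of exp
   on symmetric matrices (Klein's inequality), which makes exp injective with
   injective derivative and a continuous inverse; D(S) is found by minimizing
   tr exp (S + D) - tr D over diagonal D. *)
Require Import Defs.
From HB Require Import structures.
From mathcomp Require Import all_boot all_order all_algebra.
From mathcomp Require Import all_classical all_reals all_analysis.
From mathcomp Require Import measurable_realfun ring lra.

Set Implicit Arguments.
Unset Strict Implicit.
Unset Printing Implicit Defensive.

Import Order.TTheory GRing.Theory Num.Theory.
Import numFieldNormedType.Exports.

Local Open Scope classical_set_scope.
Local Open Scope ring_scope.

(** In general the manifolds have empty interior in the matrix space, while Fréchet derivatives and
    the chain rule want open sets. Every map is therefore precomposed with a linear projection onto
    the tangent space and studied on an open set of matrices; derivatives along tangent vectors do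
    not notice the extension. Smoothness of [expm] comes from the block matrix [[A, V], [0, A]]: the
    derivative in size n is a block of the exponential in size 2n, so one induction on the order
    runs over all sizes at once. For [logm] and [Dcor], solutions are already at hand from the
    spectral theorem and the minimization, and a quantitative Klein inequality with constant exp(-r)
    makes them continuous; injectivity of the derivative does the rest. For D(S) the point is that a
    diagonal difference of exponents is paired only with the diagonals of the exponentials, which
    are prescribed. Lengths are bounded below through a single component of the curve, so that only
    scalar functions are integrated. *)

Section DifferentialCalculus.
Context {R : realType}.
Implicit Types V W : normedModType R.

(** The epsilon form of the little-o condition, with the candidate derivative given in advance; the
    derivatives of [expm] and of an inverse function are both found this way. *)
Lemma is_diff_eps V W (f L : V -> W) (x : V) : linear L -> continuous L ->
  (forall e, 0 < e -> \forall v \near (0 : V), `|f (x + v) - f x - L v| <= e * `|v|) ->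
  is_diff x f L.
Proof.
move=> linL cL h.
pose LM := GRing.isLinear.Build _ _ _ _ _ linL.
pose LL : {linear V -> W} := HB.pack L LM.
have E : f \o shift x = cst (f x) + (LL : V -> W) +o_ 0 id.
  apply/eqaddoP => e e0; near=> v.
  have -> : (f \o shift x - (cst (f x) + (LL : V -> W))) v = f (x + v) - f x - L v.
    by rewrite /= !fctE /= opprD addrA [v + x]addrC.
  by near: v; exact: h.
have dE : 'd f x = LL :> (V -> W) by exact: diff_unique.
by apply: DiffDef => //; apply/diff_locallyP; rewrite dE; split.
Unshelve. all: by end_near. Qed.

Lemma diff_eps V W (f : V -> W) (x : V) : differentiable f x ->
  forall e, 0 < e -> \forall v \near (0 : V), `|f (x + v) - f x - 'd f x v| <= e * `|v|.
Proof.
move=> /diff_locally /eqaddoP h e e0; near=> v.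
have : `|(f \o shift x - (cst (f x) + 'd f x)) v| <= e * `|v| by near: v; exact: h.
by rewrite /= !fctE /= opprD addrA [v + x]addrC.
Unshelve. all: by end_near. Qed.

Lemma scale_bilinear W : bilinear_for
    (GRing.Scale.Law.clone _ _ *:%R _) (GRing.Scale.Law.clone _ _ *:%R _)
    (@GRing.scale R W).
Proof.
by split=> [u'|u] a x y /=; rewrite ?scalerDl ?scalerDr !scalerA // mulrC.
Qed.
HB.instance Definition _ W := bilinear_isBilinear.Build R R W W _ _
  (@GRing.scale R W) (scale_bilinear W).

Lemma is_diff_scale V W (r : V -> R) (g : V -> W) x :
  differentiable r x -> differentiable g x ->
  is_diff x (fun y => r y *: g y)
    (fun v => r x *: 'd g x v + 'd r x v *: g x).
Proof.
move=> dr dg.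
have cs : continuous (fun p : R * W => p.1 *: p.2).
  by move=> p; apply: cvgZ; [exact: cvg_fst|exact: cvg_snd].
have dB := differentiable_bilin (f := @GRing.scale R W) (r x, g x) cs.
have dp : differentiable (fun y => (r y, g y)) x by exact: differentiable_pair.
have E : (fun y => r y *: g y) = (fun p : R * W => p.1 *: p.2) \o (fun y => (r y, g y)).
  by [].
apply: DiffDef; first by rewrite E; exact: differentiable_comp.
rewrite E diff_comp // (diff_bilin (f := @GRing.scale R W)) //.
by rewrite diff_pair.
Qed.
End DifferentialCalculus.

(** * Smooth functions on open sets *)

Section SmDefinition.
Context {R : realType} {V W : normedModType R}.

(** Unlike [Cn_on], every level asks for Fréchet differentiability, which the chain rule uses.
    Higher differentials are replaced by iterated directional derivatives along constant vectors. *)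
Fixpoint Sm k (U : set V) (f : V -> W) : Prop :=
  match k with
  | 0 => forall x, U x -> {for x, continuous f}
  | k'.+1 => (forall x, U x -> differentiable f x) /\
      forall v, Sm k' U ('D_v f)
  end.
End SmDefinition.

Section SmoothOnOpen.
Context {R : realType}.
Implicit Types V W : normedModType R.

Lemma Sm_continuous V W k (U : set V) (f : V -> W) x :
  Sm k U f -> U x -> {for x, continuous f}.
Proof.
case: k => [|k] /=; first exact.
by move=> [df _] Ux; exact/differentiable_continuous/df.
Qed.

Lemma Sm_differentiable V W k (U : set V) (f : V -> W) x :
  Sm k.+1 U f -> U x -> differentiable f x.
Proof. by case=> df _; exact: df. Qed.

Lemma SmW V W k (U : set V) (f : V -> W) : Sm k.+1 U f -> Sm k U f.
Proof.
elim: k f => [|k IH] f; first by move=> Sf x Ux; exact: Sm_continuous Sf Ux.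
by case=> df Df; split=> // v; exact/IH/Df.
Qed.

Lemma Sm_eq V W k (U : set V) (f g : V -> W) : open U ->
  (forall x, U x -> f x = g x) -> Sm k U f -> Sm k U g.
Proof.
move=> oU; elim: k f g => [|k IH] f g fg /=.
  move=> cf x Ux; rewrite /prop_for /continuous_at -fg //.
  apply: cvg_trans (cf x Ux); apply: near_eq_cvg.
  by have := open_nbhs_nbhs (conj oU Ux); apply: filterS => y /fg.
have nfg x : U x -> \near x, f x = g x.
  by move=> Ux; have := open_nbhs_nbhs (conj oU Ux); apply: filterS => y /fg.
case=> df Df; split=> [x Ux|v]; last first.
  by apply: IH (Df v) => x Ux; exact/near_eq_derive/nfg.
suff [] : is_diff x g ('d f x : V -> W) by [].
apply: is_diff_eps => //.
- by move=> a u w; rewrite linearP.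
- exact/diff_continuous/df.
move=> e e0.
have h1 : \forall v \near (0 : V), f (x + v) = g (x + v).
  have : \forall y \near x, f y = g y by exact: nfg.
  rewrite (near_shift 0) subr0; apply: filterS => y /=.
  by rewrite addrC.
near=> v; rewrite -(near h1 v) // -(fg x) //.
by near: v; exact/diff_eps/e0/df.
Unshelve. all: by end_near. Qed.

Lemma Sm_cst V W k (U : set V) (w : W) : Sm k U (fun=> w).
Proof.
elim: k w => [|k IH] w /=; first by move=> x _; exact: cvg_cst.
split=> [x _|v]; first exact: differentiable_cst.
rewrite (_ : 'D_v (fun=> w) = fun=> 0) //.
by apply/funext => x; exact: derive_cst.
Qed.

Lemma Sm_lin_comp V W W' k (U : set V) (f : V -> W) (L : {linear W -> W'}) :
  open U -> continuous L -> Sm k U f -> Sm k U (L \o f).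
Proof.
move=> oU cL; elim: k f => [|k IH] f /=.
  by move=> cf x Ux; apply: continuous_comp; [exact: cf|exact: cL].
case=> df Df; split=> [x Ux|v].
  by apply: differentiable_comp; [exact: df|exact: linear_differentiable].
apply: (@Sm_eq _ _ _ _ (L \o 'D_v f)) => //; last exact/IH/Df.
move=> x Ux; have dL := linear_differentiable (f x) cL.
rewrite [RHS]deriveE; last by apply: differentiable_comp => //; exact: df.
by rewrite diff_comp ?diff_lin //=; [rewrite deriveE //|]; exact: df.
Qed.

Lemma Sm_lin V W k (U : set V) (L : {linear V -> W}) :
  continuous L -> Sm k U L.
Proof.
case: k => [|k] /= cL; first by move=> x _; exact: cL.
split=> [x _|v]; first exact: linear_differentiable.
rewrite (_ : 'D_v L = fun=> L v); first exact: Sm_cst.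
apply/funext => x; have dL := linear_differentiable x cL.
by rewrite deriveE // diff_lin.
Qed.

Lemma Sm_id V k (U : set V) : Sm k U (@id V).
Proof. by apply: (@Sm_lin _ _ _ _ idfun) => x. Qed.

Lemma Sm_add V W k (U : set V) (f g : V -> W) : open U ->
  Sm k U f -> Sm k U g -> Sm k U (fun x => f x + g x).
Proof.
move=> oU; elim: k f g => [|k IH] f g /=.
  by move=> cf cg x Ux; apply: cvgD; [exact: cf|exact: cg].
move=> [df Df] [dg Dg]; split=> [x Ux|v].
  by apply: differentiableD; [exact: df|exact: dg].
apply: (@Sm_eq _ _ _ _ (fun x => 'D_v f x + 'D_v g x)) => //; last exact: IH.
by move=> x Ux; rewrite -deriveD //; apply: diff_derivable; [exact: df|exact: dg].
Qed.

Lemma Sm_scale V W k (U : set V) (r : V -> R) (g : V -> W) : open U ->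
  Sm k U r -> Sm k U g -> Sm k U (fun x => r x *: g x).
Proof.
move=> oU; elim: k r g => [|k IH] r g.
  by move=> cf cg x Ux; apply: cvgZ; [exact: cf|exact: cg].
move=> Sr Sg; have [dr Dr] := Sr; have [dg Dg] := Sg.
split=> [x Ux|v].
  by have [] := is_diff_scale (dr x Ux) (dg x Ux).
apply: (@Sm_eq _ _ _ _ (fun x => r x *: 'D_v g x + 'D_v r x *: g x)) => //.
  move=> x Ux; have [drx dgx] := (dr x Ux, dg x Ux).
  by have [d' e'] := is_diff_scale drx dgx; rewrite [RHS]deriveE // e' !deriveE.
apply: Sm_add => //; apply: IH; [exact: SmW Sr|exact: Dg|exact: Dr|exact: SmW Sg].
Qed.

Lemma Sm_mul V k (U : set V) (f g : V -> R) : open U ->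
  Sm k U f -> Sm k U g -> Sm k U (fun x => f x * g x).
Proof. exact: (@Sm_scale V R^o). Qed.

Lemma Sm_sum V W k (U : set V) (I : Type) (s : seq I) (P : pred I)
    (f : I -> V -> W) : open U ->
  (forall i, Sm k U (f i)) -> Sm k U (fun x => \sum_(i <- s | P i) f i x).
Proof.
move=> oU Sf; elim: s => [|i s IH].
  by rewrite (_ : (fun x => _) = fun=> 0); [exact: Sm_cst|apply/funext => x; rewrite big_nil].
rewrite (_ : (fun x => _) = fun x => (if P i then f i x else 0) + \sum_(i <- s | P i) f i x).
  by apply: Sm_add => //; case: (P i) => //; exact: Sm_cst.
by apply/funext => x; rewrite big_cons; case: ifP => // _; rewrite add0r.
Qed.

Lemma Sm_prod V k (U : set V) (I : Type) (s : seq I) (P : pred I)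
    (f : I -> V -> R) : open U ->
  (forall i, Sm k U (f i)) -> Sm k U (fun x => \prod_(i <- s | P i) f i x).
Proof.
move=> oU Sf; elim: s => [|i s IH].
  by rewrite (_ : (fun x => _) = fun=> 1); [exact: Sm_cst|apply/funext => x; rewrite big_nil].
rewrite (_ : (fun x => _) = fun x => (if P i then f i x else 1) * \prod_(i <- s | P i) f i x).
  by apply: Sm_mul => //; case: (P i) => //; exact: Sm_cst.
by apply/funext => x; rewrite big_cons; case: ifP => // _; rewrite mul1r.
Qed.

(** The derivative of 1/f is -f'/f^2, in which 1/f itself reappears one order lower, so the
    induction closes. *)
Lemma Sm_inv V k (U : set V) (f : V -> R) : open U ->
  (forall x, U x -> f x != 0) -> Sm k U f -> Sm k U (fun x => (f x)^-1).
Proof.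
move=> oU f0; elim: k => [|k IH].
  by move=> cf x Ux; apply: cvgV; [exact: f0|exact: cf].
move=> Sf; have [df Df] := Sf; split=> [x Ux|v].
  by apply: differentiableV; [exact: df|exact: f0].
apply: (@Sm_eq _ _ _ _ (fun x => - 1 * ((f x)^-1 * (f x)^-1) * 'D_v f x)) => //.
  move=> x Ux; rewrite [RHS]deriveV; [|exact: f0|exact/diff_derivable/df].
  by rewrite mulN1r -expr2 exprVn.
have Sfk := IH (SmW Sf).
apply: Sm_mul; [by []| |exact: Df].
by apply: Sm_mul; [by []|exact: Sm_cst|exact: Sm_mul].
Qed.

(** * Calculus of matrix-valued functions and of functions of a matrix *)

Section Matrices.
Variables (m n : nat).
Implicit Types (L : 'M[R]_(m, n)).

Lemma mx_linear_continuous W (L : {linear 'M[R]_(m, n) -> W}) : continuous L.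
Proof.
have -> : (L : _ -> _) = fun A => \sum_i \sum_j A i j *: L (delta_mx i j).
  apply/funext => A; rewrite {1}(matrix_sum_delta A) linear_sum; apply: eq_bigr => i _.
  by rewrite linear_sum; apply: eq_bigr => j _; rewrite linearZ.
move=> A.
(* A linear map is a finite combination of coordinates; [Sm 0] serves here, and often below, as a
   calculus of continuity. *)
suff : Sm 0 setT (fun A : 'M[R]_(m, n) => \sum_i \sum_j A i j *: L (delta_mx i j)) by exact.
do 2![apply: Sm_sum => [|?]; first exact: openT].
by apply: Sm_scale; [exact: openT|move=> B _; exact: coord_continuous|exact: Sm_cst].
Qed.

Lemma Sm_mxlin W k (U : set 'M[R]_(m, n)) (L : {linear 'M[R]_(m, n) -> W}) :
  Sm k U L.
Proof. exact/Sm_lin/mx_linear_continuous. Qed.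

Lemma Sm_mxlin_comp V W k (U : set V) (f : V -> 'M[R]_(m, n))
    (L : {linear 'M[R]_(m, n) -> W}) :
  open U -> Sm k U f -> Sm k U (L \o f).
Proof. by move=> oU; apply: Sm_lin_comp => //; exact: mx_linear_continuous. Qed.

Definition coord (i : 'I_m) (j : 'I_n) (A : 'M[R]_(m, n)) : R := A i j.
Lemma coord_linear i j : linear (coord i j : _ -> R^o).
Proof. by move=> a A B; rewrite /coord !mxE. Qed.
HB.instance Definition _ i j := GRing.isLinear.Build R 'M[R]_(m, n) R^o _
  (coord i j) (coord_linear i j).

Lemma Sm_coord V k (U : set V) (f : V -> 'M[R]_(m, n)) i j :
  open U -> Sm k U f -> Sm k U (fun x => f x i j).
Proof. exact: (@Sm_mxlin_comp _ R^o _ _ _ (coord i j)). Qed.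

Lemma Sm_mx V k (U : set V) (f : V -> 'M[R]_(m, n)) : open U ->
  (forall i j, Sm k U (fun x => f x i j)) -> Sm k U f.
Proof.
move=> oU Sf.
rewrite (_ : f = fun x => \sum_i \sum_j f x i j *: delta_mx i j).
  by do 2![apply: Sm_sum => // ?]; apply: Sm_scale => //; exact: Sm_cst.
by apply/funext => x; exact: matrix_sum_delta.
Qed.

(** Trades a moving direction for moving coefficients in front of derivatives along fixed
    directions, the only ones that [Sm] speaks of. *)
Lemma derive_sum_delta W (g : 'M[R]_(m, n) -> W) (x v : 'M[R]_(m, n)) :
  differentiable g x ->
  'D_v g x = \sum_i \sum_j v i j *: 'D_(delta_mx i j) g x.
Proof.
move=> dg; rewrite deriveE // {1}(matrix_sum_delta v) linear_sum.
apply: eq_bigr => i _; rewrite linear_sum; apply: eq_bigr => j _.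
by rewrite linearZ deriveE.
Qed.

(** The intermediate space is a matrix space because the derivative of g along the moving vector
    ['D_v f x] has to be expanded in a basis before the induction hypothesis applies. *)
Lemma Sm_comp V W k (U : set V) (U' : set 'M[R]_(m, n))
    (f : V -> 'M[R]_(m, n)) (g : 'M[R]_(m, n) -> W) : open U ->
  (forall x, U x -> U' (f x)) ->
  Sm k U f -> Sm k U' g -> Sm k U (g \o f).
Proof.
move=> oU fU; elim: k g => [|k IH] g.
  by move=> cf cg x Ux; apply: continuous_comp; [exact: cf|exact/cg/fU].
move=> Sf Sg; have [df Df] := Sf; have [dg Dg] := Sg.
have dgf x : U x -> differentiable (g \o f) x.
  by move=> Ux; apply: differentiable_comp; [exact: df|exact/dg/fU].
split=> // v.
apply: (@Sm_eq _ _ _ _ (fun x =>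
  \sum_i \sum_j ('D_v f x) i j *: 'D_(delta_mx i j) g (f x))) => //.
  move=> x Ux; have dgfx := dgf x Ux; have [dfx dgx] := (df x Ux, dg _ (fU x Ux)).
  by rewrite [RHS]deriveE // diff_comp //= -!deriveE // -derive_sum_delta.
do 2![apply: Sm_sum => // ?]; apply: Sm_scale => //; first exact: Sm_coord (Df v).
exact: (IH _ (SmW Sf) (Dg _)).
Qed.

End Matrices.

Lemma Sm_mulmx V k (U : set V) m n p (f : V -> 'M[R]_(m, n))
    (g : V -> 'M[R]_(n, p)) : open U ->
  Sm k U f -> Sm k U g -> Sm k U (fun x => f x *m g x).
Proof.
move=> oU Sf Sg; apply: Sm_mx => // i j.
rewrite (_ : (fun x => _) = fun x => \sum_l f x i l * g x l j).
  by apply: Sm_sum => // l; apply: Sm_mul => //; exact: Sm_coord.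
by apply/funext => x; rewrite mxE.
Qed.

Lemma Sm_det V k (U : set V) n (f : V -> 'M[R]_n) : open U ->
  Sm k U f -> Sm k U (fun x => \det (f x)).
Proof.
move=> oU Sf; rewrite /determinant.
apply: Sm_sum => // s; apply: Sm_mul => //; first exact: Sm_cst.
by apply: Sm_prod => // i; exact: Sm_coord.
Qed.

Lemma Sm_invmx V k (U : set V) n (f : V -> 'M[R]_n) : open U ->
  (forall x, U x -> f x \in unitmx) ->
  Sm k U f -> Sm k U (fun x => invmx (f x)).
Proof.
move=> oU fu Sf.
apply: (@Sm_eq _ _ _ _ (fun x => (\det (f x))^-1 *: \adj (f x))) => //.
  by move=> x Ux; rewrite /invmx fu.
apply: Sm_scale => //.
  by apply: Sm_inv => //; [move=> x /fu; rewrite unitmxE unitfE|exact: Sm_det].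
apply: Sm_mx => // i j.
rewrite (_ : (fun x => _) = fun x => cofactor (f x) j i).
  rewrite /cofactor; apply: Sm_mul => //; first exact: Sm_cst.
  apply: Sm_det => //; apply: Sm_mx => // a b.
  rewrite (_ : (fun x => _) = fun x => f x (lift j a) (lift i b)); first exact: Sm_coord.
  by apply/funext => x; rewrite !mxE.
by apply/funext => x; rewrite mxE.
Qed.

End SmoothOnOpen.

(** * Derivatives along lines and smooth extensions off a manifold *)

Section LinesAndExtensions.
Context {R : realType}.
Implicit Types V W : normedModType R.

(** A directional derivative sees only the values on one line. This is how functions that agree on a
    manifold without interior share their tangential derivatives. *)
Lemma line_derive V W (f g : V -> W) (a v : V) :
  f a = g a -> (\forall h \near (0 : R), f (h *: v + a) = g (h *: v + a)) ->
  (derivable f a v -> derivable g a v) /\ 'D_v f a = 'D_v g a.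
Proof.
move=> fga fg.
have E : \forall h \near (0 : R)^',
    h^-1 *: (f (h *: v + a) - f a) = h^-1 *: (g (h *: v + a) - g a).
  by apply: nbhs_dnbhs; apply: filterS fg => h ->; rewrite fga.
have E' : \forall h \near (0 : R)^',
    h^-1 *: (g (h *: v + a) - g a) = h^-1 *: (f (h *: v + a) - f a).
  by apply: filterS E.
split=> [/cvg_ex[/= l fl]|].
  by apply/cvg_ex; exists l; exact: cvg_trans (near_eq_cvg E) fl.
by rewrite /derive; congr (lim _); rewrite eqEsubset; split; exact: near_eq_cvg.
Qed.

Definition rel_open V (M T : set V) :=
  forall x v, M x -> T v -> \forall h \near (0 : R), M (h *: v + x).

(** Here [g] is a smooth extension of [f] beyond [M]; the iterated tangential derivatives of both
    agree on [M], so smoothness is inherited. *)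
Lemma Sm_Cn_on V W k (M T U : set V) (f g : V -> W) : rel_open M T ->
  M `<=` U -> (forall x, M x -> f x = g x) -> Sm k U g -> Cn_on k M T f.
Proof.
move=> oM MU; elim: k f g => [|k IH] f g fg Sg.
  split=> //; apply: (@subspace_eq_continuous _ _ _ g).
    by move=> x; rewrite inE => Mx; exact/esym/fg.
  apply: continuous_in_subspaceT => x; rewrite inE => Mx.
  exact: (Sm_continuous Sg (MU _ Mx)).
have line x v : M x -> T v ->
    (derivable g x v -> derivable f x v) /\ 'D_v f x = 'D_v g x.
  move=> Mx Tv.
  have oxv : \forall h \near (0 : R), f (h *: v + x) = g (h *: v + x).
    by apply: filterS (oM x v Mx Tv) => h /fg.
  have [h1 h2] := line_derive (fg x Mx) oxv.
  split=> //; apply: (line_derive _ _).1; rewrite ?fg //.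
  by apply: filterS oxv => h ->.
split.
  by have := IH _ g fg (SmW Sg); case: (k) => [|?] [].
move=> v Tv; split=> [x Mx|].
  apply: (line x v Mx Tv).1; apply: diff_derivable.
  exact: (Sm_differentiable Sg (MU _ Mx)).
by apply: (IH _ ('D_v g)); [move=> x Mx; exact: (line x v Mx Tv).2|exact: Sg.2].
Qed.

Lemma is_derive_line V W (f : V -> W) (x u : V) (s : R) :
  differentiable f (x + s *: u) ->
  is_derive s 1 (fun s : R => f (x + s *: u)) ('D_u f (x + s *: u)).
Proof.
move=> df.
have [dl dlE] : is_diff s (fun s : R => x + s *: u) ( *:%R^~ u).
  have [d1 d2] := is_diffD (is_diff_cst x s) (is_diff_scalel s u).
  by split=> //; rewrite d2; apply/funext => t /=; rewrite !fctE add0r.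
have dc : differentiable (f \o (fun s : R => x + s *: u)) s.
  exact: differentiable_comp.
apply: DeriveDef; first exact: diff_derivable.
by rewrite [LHS]deriveE // diff_comp //= dlE scale1r deriveE.
Qed.

Lemma derive_comp V W W' (f : V -> W) (g : W -> W') (x v : V) :
  differentiable f x -> differentiable g (f x) ->
  'D_v (g \o f) x = 'D_('D_v f x) g (f x).
Proof.
move=> df dg; have dgf : differentiable (g \o f) x by exact: differentiable_comp.
by rewrite [LHS]deriveE // diff_comp //= -!deriveE.
Qed.

Lemma derive_lin V W (L : {linear V -> W}) (x v : V) :
  continuous L -> 'D_v L x = L v.
Proof.
by move=> cL; have dL := linear_differentiable x cL; rewrite deriveE // diff_lin.
Qed.

Lemma derive_lin_comp V W W' (L : {linear W -> W'}) (f : V -> W) (x v : V) :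
  continuous L -> differentiable f x -> 'D_v (L \o f) x = L ('D_v f x).
Proof.
move=> cL df; have dL := linear_differentiable (f x) cL.
have dLf : differentiable (L \o f) x by exact: differentiable_comp.
by rewrite [LHS]deriveE // diff_comp // diff_lin //= deriveE.
Qed.

End LinesAndExtensions.

(** * Symmetry of second derivatives *)

Section Schwarz.
Context {R : realType}.
Implicit Types V : normedModType R.

(** Two mean value theorems: first along u for the difference of f on two parallel sides of the
    parallelogram, then along v for ['D_u f]. *)
Lemma second_difference V (U : set V) (f : V -> R) (x u v : V) (h : R) :
  Sm 2 U f -> 0 < h ->
  (forall s t, 0 <= s <= h -> 0 <= t <= h -> U (x + s *: u + t *: v)) ->
  exists s t, [/\ 0 <= s <= h, 0 <= t <= h &
    f (x + h *: u + h *: v) - f (x + h *: u) - f (x + h *: v) + f x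
    = h * h * 'D_v ('D_u f) (x + s *: u + t *: v)].
Proof.
move=> Sf h0 Uh.
have hh : 0 <= h <= h by rewrite ltW //=.
have h00 : (0 : R) <= 0 <= h by rewrite lexx ltW.
have itv s : s \in `[0, h]%R -> 0 <= s <= h by rewrite in_itv.
have itvo s : s \in `]0, h[%R -> 0 <= s <= h.
  by rewrite in_itv /= => /andP[/ltW -> /ltW ->].
pose g s := f (x + h *: v + s *: u) - f (x + s *: u).
pose dg s := 'D_u f (x + h *: v + s *: u) - 'D_u f (x + s *: u).
have dg_ s : 0 <= s <= h -> is_derive s 1 g (dg s).
  move=> sh; apply: is_deriveB; apply: is_derive_line.
    by apply: (Sm_differentiable Sf); rewrite addrAC; exact: Uh.
  by apply: (Sm_differentiable Sf); have := Uh s 0 sh h00; rewrite scale0r addr0.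
have [|s] := @MVT_segment R g dg 0 h (ltW h0) (fun s si => dg_ s (itvo s si)).
  apply: continuous_in_subspaceT => s; rewrite inE => /itv sh.
  apply: differentiable_continuous; apply/derivable1_diffP.
  by have [] := dg_ s sh.
rewrite subr0 => /itv sh gE.
have Su : Sm 1 U ('D_u f) := Sf.2 u.
pose k t := 'D_u f (x + s *: u + t *: v).
have dk t : 0 <= t <= h -> is_derive t 1 k ('D_v ('D_u f) (x + s *: u + t *: v)).
  by move=> th; exact: (is_derive_line (Sm_differentiable Su (Uh _ _ sh th))).
have [|t] := @MVT_segment R k _ 0 h (ltW h0) (fun s si => dk s (itvo s si)).
  apply: continuous_in_subspaceT => t; rewrite inE => /itv th.
  apply: differentiable_continuous; apply/derivable1_diffP.
  by have [] := dk t th.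
rewrite subr0 => /itv th kE.
exists s, t; split => //.
have -> : h * h * 'D_v ('D_u f) (x + s *: u + t *: v) = (k h - k 0) * h.
  by rewrite kE mulrC mulrA.
have -> : k h - k 0 = dg s.
  by rewrite /k /dg scale0r addr0 addrAC.
rewrite -gE /g scale0r !addr0 -![x + h *: v + _]addrAC.
by rewrite opprB addrA [in RHS]addrAC.
Qed.

Let dist_half (a b c e : R) : `|a - c| < e / 2 -> `|b - c| < e / 2 -> `|a - b| <= e.
Proof.
move=> ac bc; apply: le_trans (ler_distD c _ _) _; rewrite (splitr e).
by apply: lerD; apply: ltW; rewrite // distrC.
Qed.

(** The second difference is symmetric in u and v, so the two mixed derivatives take the same value,
    each at some point of a small parallelogram; continuity at x closes the gap. *)
Lemma Schwarz_real V (U : set V) (f : V -> R) (x u v : V) :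
  open U -> U x -> Sm 2 U f -> 'D_u ('D_v f) x = 'D_v ('D_u f) x.
Proof.
move=> oU Ux Sf; apply/eqP; rewrite -subr_eq0 -normr_le0.
apply/ler_addgt0Pr => _/posnumP[e]; rewrite add0r.
have c1 : {for x, continuous ('D_u ('D_v f))}.
  exact: ((Sf.2 v).2 u x Ux).
have c2 : {for x, continuous ('D_v ('D_u f))}.
  exact: ((Sf.2 u).2 v x Ux).
have e2 : 0 < e%:num / 2 by [].
have n1 : \forall y \near x, `|'D_u ('D_v f) x - 'D_u ('D_v f) y| < e%:num / 2.
  by move/cvgrPdist_lt : c1 => /(_ _ e2).
have n2 : \forall y \near x, `|'D_v ('D_u f) x - 'D_v ('D_u f) y| < e%:num / 2.
  by move/cvgrPdist_lt : c2 => /(_ _ e2).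
have n3 : \forall y \near x, U y by exact: open_nbhs_nbhs.
have /nbhs_ballP[d /= d0 dP] : \forall y \near x,
  [/\ U y, `|'D_u ('D_v f) x - 'D_u ('D_v f) y| < e%:num / 2 &
   `|'D_v ('D_u f) x - 'D_v ('D_u f) y| < e%:num / 2].
  by move: n3 n1 n2; apply: filterS3.
(* The parallelogram with factor h stays in the ball of radius d; the summand 1 avoids a zero
   denominator when u = v = 0. *)
have [h h0 hd] : exists2 h : R, 0 < h & h * (`|u| + `|v|) < d.
  have K0 : 0 < `|u| + `|v| + 1 by apply: ltr_wpDl; [exact: addr_ge0|exact: ltr01].
  exists (d / (`|u| + `|v| + 1)); first exact: divr_gt0.
  by rewrite mulrAC ltr_pdivrMr // ltr_pM2l // ltrDl ltr01.
have inb s t : 0 <= s <= h -> 0 <= t <= h -> ball x d (x + s *: u + t *: v).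
  move=> /andP[s0 sh] /andP[t0 th].
  rewrite -ball_normE /ball_ /= -addrA opprD addrA subrr sub0r normrN.
  apply: le_lt_trans (ler_normD _ _) _; rewrite !normrZ !ger0_norm //.
  apply: le_lt_trans hd; rewrite mulrDr.
  by apply: lerD; apply: ler_wpM2r.
have Uh s t : 0 <= s <= h -> 0 <= t <= h -> U (x + s *: u + t *: v).
  by move=> sh th; have [] := dP _ (inb s t sh th).
have Uh' s t : 0 <= s <= h -> 0 <= t <= h -> U (x + s *: v + t *: u).
  by move=> sh th; rewrite addrAC; exact: Uh.
have [s [t [sh th E1]]] := second_difference Sf h0 Uh.
have [s' [t' [sh' th' E2]]] := second_difference Sf h0 Uh'.
have E : 'D_v ('D_u f) (x + s *: u + t *: v) = 'D_u ('D_v f) (x + s' *: v + t' *: u).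
  have h_neq0 := lt0r_neq0 h0; have hh : h * h != 0 by exact: mulf_neq0.
  apply: (mulfI hh); apply: etrans (esym E1) _; apply: etrans _ E2.
  congr (_ + _); rewrite [in RHS]addrAC; congr (f _ - _ - _); exact: addrAC.
have [_ _ b1] := dP _ (inb s t sh th).
have [_ b2 _] := dP _ (inb t' s' th' sh').
have sw : x + t' *: u + s' *: v = x + s' *: v + t' *: u by exact: addrAC.
rewrite sw in b2; rewrite E in b1; exact: dist_half b2 b1.
Qed.

Lemma Schwarz V m n (U : set V) (f : V -> 'M[R]_(m, n)) (x u v : V) :
  open U -> U x -> Sm 2 U f -> 'D_u ('D_v f) x = 'D_v ('D_u f) x.
Proof.
move=> oU Ux Sf; apply/matrixP => i j.
have cc : continuous (coord i j : 'M[R]_(m, n) -> R^o) by exact: coord_continuous.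
have D a b : ('D_a ('D_b f) x) i j = 'D_a ('D_b (fun y => f y i j)) x.
  have -> : ('D_a ('D_b f) x) i j = 'D_a (coord i j \o 'D_b f) x.
    have Sb : Sm 1 U ('D_b f) := Sf.2 b.
    by have db := Sm_differentiable Sb Ux; rewrite (derive_lin_comp _ _ db).
  apply: near_eq_derive; have := open_nbhs_nbhs (conj oU Ux).
  apply: filterS => y Uy; have dy := Sm_differentiable Sf Uy.
  exact: esym (derive_lin_comp _ cc dy).
have Sij : Sm 2 U (fun y => f y i j) by exact: Sm_coord.
exact: etrans (D u v) (etrans (Schwarz_real _ _ oU Ux Sij) (esym (D v u))).
Qed.

End Schwarz.

(* A continuous solution h of G (h y) = iota y is smooth as soon as the
   derivative of G is injective along h: the inverse function theorem without
   its existence part. *)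
Section SmoothInverse.
(** Solves an estimate of d in which d also occurs on the right: a coefficient at most 1/2 there can
    be absorbed on the left. *)
Let absorb_half (F : realFieldType) (a b d k l w : F) : 0 <= w -> d <= a + b ->
  a <= l * (w + d) -> l * (w + d) <= 2^-1 * (w + d) -> b <= k * w ->
  d <= 2 * (k + 1) * w.
Proof. by move=> *; lra. Qed.

Let absorb_sum (F : realFieldType) (d k w : F) :
  d <= 2 * (k + 1) * w -> w + d <= (3 + 2 * k) * w.
Proof. by move=> *; lra. Qed.

Context {R : realType} {V : normedModType R} {p q : nat}.
Variables (W : set V) (G : 'M[R]_(p, q) -> 'M[R]_(p, q)).
Variables (iota h : V -> 'M[R]_(p, q)).
Hypothesis openW : open W.
Hypothesis smG : forall k, Sm k setT G.
Hypothesis smiota : forall k, Sm k W iota.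
Hypothesis contH : forall y, W y -> {for y, continuous h}.
Hypothesis GhE : forall y, W y -> G (h y) = iota y.
Hypothesis injG : forall y v, W y -> 'D_v G (h y) = 0 -> v = 0.

Let dG x : differentiable G x.
Proof. exact: (Sm_differentiable (smG 1)). Qed.

Let J x : 'M[R]_(p * q) := lin_mx ('d G x).

Let J_unit y : W y -> J (h y) \in unitmx.
Proof.
move=> Wy; rewrite -row_free_unit; apply: inj_row_free => v.
rewrite -[v]vec_mxK mul_vec_lin => /(congr1 vec_mx); rewrite mxvecK linear0 => e.
have -> : vec_mx v = 0 by apply: (injG Wy); rewrite deriveE //; exact: dG.
by rewrite linear0.
Qed.

Let Lam y : {linear 'M[R]_(p, q) -> 'M[R]_(p, q)} :=
  (vec_mx \o mulmxr (invmx (J (h y))) \o mxvec)%FUN.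

Let LamK y v : W y -> Lam y ('d G (h y) v) = v.
Proof.
move=> Wy; rewrite /Lam /= -mul_vec_lin -/(J (h y)) mulmxK ?mxvecK //.
exact: J_unit.
Qed.

(** Linearizing both sides of G (h y) = iota y equates ['d G (h y) D] with ['d iota y v] up to
    errors eta |D| and eta |v|, where D is the increment of h. Continuity of h makes D small enough
    for the linearization of G, and absorption then bounds |D| by a multiple of |v|. *)
Let is_diff_inverse y : W y -> is_diff y h (Lam y \o 'd iota y).
Proof.
move=> Wy.
have di : differentiable iota y by exact: (Sm_differentiable (smiota 1)).
have [c c0 cP] := linear_lipschitz (@mx_linear_continuous _ _ _ _ (Lam y)).
have [c2 c20 c2P] := linear_lipschitz (diff_continuous di).
apply: is_diff_eps.
- exact: (linearP (Lam y \o 'd iota y : {linear _ -> _})).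
- move=> u; apply: continuous_comp; first exact: diff_continuous.
  exact: mx_linear_continuous.
move=> e e0.
(* The bound 1/2 permits the absorption; the last one brings the final error c eta (|v| + |D|) below
   e |v|, as |v| + |D| <= (3 + 2 c c2) |v|. *)
have [eta [eta0 eta1 eta2]] : exists eta, [/\ 0 < eta, c * eta <= 2^-1 &
    c * eta * (3 + 2 * (c * c2)) <= e].
  have K0 : 0 < 3 + 2 * (c * c2) by rewrite addr_gt0 // mulr_gt0 // mulr_gt0.
  have K1 : 0 < e / (3 + 2 * (c * c2)) by rewrite divr_gt0.
  exists (c^-1 * Num.min 2^-1 (e / (3 + 2 * (c * c2)))); split.
  - by rewrite mulr_gt0 ?invr_gt0 // lt_min K1 invr_gt0 ltr0n.
  - by rewrite mulVKf ?gt_eqF // ge_min lexx.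
  - by rewrite mulVKf ?gt_eqF // -ler_pdivlMr // ge_min lexx orbT.
have nW : \forall v \near (0 : V), W (y + v).
  have : \forall z \near y, W z by exact: open_nbhs_nbhs.
  by rewrite (near_shift 0) subr0; apply: filterS => v /=; rewrite addrC.
have ni := diff_eps di eta0.
have cD : (fun v => h (y + v) - h y) @ (0 : V) --> (0 : 'M[R]_(p, q)).
  have c1 : (fun v => h (y + v)) @ (0 : V) --> h y.
    have : (fun v => h (y + v)) @ (0 : V) --> h (y + 0).
      apply: (@continuous_comp _ _ _ (fun v => y + v) h).
        by apply: cvgD; [exact: cvg_cst|exact: cvg_id].
      by rewrite addr0; exact: contH.
    by rewrite addr0.
  by rewrite -(subrr (h y)); apply: cvgB => //; exact: cvg_cst.
have nG : \forall v \near (0 : V), let D := h (y + v) - h y in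
    `|G (h y + D) - G (h y) - 'd G (h y) D| <= eta * `|D|.
  exact: (cD _ (diff_eps (@dG (h y)) eta0)).
near=> v.
have Wv : W (y + v) by near: v.
have iv : `|iota (y + v) - iota y - 'd iota y v| <= eta * `|v| by near: v.
pose D := h (y + v) - h y.
have Gv : `|G (h y + D) - G (h y) - 'd G (h y) D| <= eta * `|D|.
  by rewrite /D; near: v.
have hD : h y + D = h (y + v) by rewrite /D addrC subrK.
rewrite hD !GhE // in Gv.
rewrite -/D.
have E : D - Lam y ('d iota y v) = Lam y ((iota (y + v) - iota y - 'd iota y v)
     - (iota (y + v) - iota y - 'd G (h y) D)).
  move: (iota (y + v) - _) => a.
  have -> : a - 'd iota y v - (a - 'd G (h y) D) = 'd G (h y) D - 'd iota y v.
    by rewrite opprB addrC addrA subrK.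
  by have -> := raddfB (Lam y) ('d G (h y) D) ('d iota y v); congr (_ - _); exact/esym/LamK.
have B1 : `|D - Lam y ('d iota y v)| <= c * eta * (`|v| + `|D|).
  rewrite E; apply: le_trans (cP _) _; rewrite -mulrA ler_pM2l //.
  by apply: le_trans (ler_normB _ _) _; rewrite mulrDr; exact: lerD.
have B2 : `|D| <= 2 * (c * c2 + 1) * `|v|.
  have t1 : `|D| <= `|D - Lam y ('d iota y v)| + `|Lam y ('d iota y v)|.
    by rewrite -{1}(subrK (Lam y ('d iota y v)) D) ler_normD.
  have t2 : `|Lam y ('d iota y v)| <= c * c2 * `|v|.
    by apply: le_trans (cP _) _; rewrite -mulrA ler_pM2l.
  have t3 : c * eta * (`|v| + `|D|) <= 2^-1 * (`|v| + `|D|).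
    by apply: ler_wpM2r => //; exact: addr_ge0.
  exact: absorb_half (normr_ge0 v) t1 B1 t3 t2.
apply: le_trans B1 _.
have ce : 0 <= c * eta by rewrite mulr_ge0 ?ltW.
apply: (@le_trans _ _ (c * eta * (3 + 2 * (c * c2)) * `|v|)).
  rewrite -[leRHS]mulrA; apply: ler_wpM2l => //.
  exact: absorb_sum.
by apply: ler_wpM2r.
Unshelve. all: by end_near. Qed.

(** The derivative of h is the inverse Jacobian of G at h y applied to ['D_v iota y]; it involves h
    only undifferentiated, so regularity of order k gives order k + 1. *)
Lemma Sm_inverse k : Sm k W h.
Proof.
elim: k => [|k IH]; first exact: contH.
split=> [y Wy|v]; first by have [] := is_diff_inverse Wy.
apply: (@Sm_eq _ _ _ _ _ (fun y =>
   vec_mx (mxvec ('D_v iota y) *m invmx (J (h y))))) => //.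
  move=> y Wy; have [dh dhE] := is_diff_inverse Wy.
  have di : differentiable iota y by exact: (Sm_differentiable (smiota 1)).
  by rewrite [RHS]deriveE // dhE /= deriveE.
apply: (@Sm_mxlin_comp _ _ _ _ _ _ _ (fun y => mxvec ('D_v iota y) *m invmx (J (h y))) vec_mx) => //.
apply: Sm_mulmx => //.
  exact: (@Sm_mxlin_comp _ _ _ _ _ _ _ ('D_v iota) mxvec openW ((smiota k.+1).2 v)).
apply: Sm_invmx => //.
apply: Sm_mx => // a b.
have e : (fun y => J (h y) a b) =
    (fun y => mxvec ('D_(vec_mx (delta_mx 0 a)) G (h y)) 0 b).
  by apply/funext => y; rewrite /J /lin_mx /lin1_mx mxE /= deriveE.
rewrite e; apply: Sm_coord => //.
apply: (@Sm_mxlin_comp _ _ _ _ _ _ _ (fun y => 'D_(vec_mx (delta_mx 0 a)) G (h y)) mxvec) => //.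
exact: (@Sm_comp _ _ _ _ _ k W setT h ('D_(vec_mx (delta_mx 0 a)) G) openW (fun _ _ => I) IH ((smG k.+1).2 _)).
Qed.

End SmoothInverse.

(** * The matrix exponential *)

HB.instance Definition _ (R : realType) m n := Complete.on 'M[R]_(m, n).

Section MatrixNorm.
Context {R : realType}.

Lemma mx_norm_coord m n (A : 'M[R]_(m, n)) i j : `|A i j| <= `|A|.
Proof. by rewrite [leRHS]mx_normrE; exact: (le_bigmax _ (fun ij => `|A ij.1 ij.2|) (i, j)). Qed.

Lemma mx_norm_le m n (A : 'M[R]_(m, n)) (c : R) : 0 <= c ->
  (forall i j, `|A i j| <= c) -> `|A| <= c.
Proof.
by move=> c0 h; rewrite [leLHS]mx_normrE; apply: bigmax_le => // -[i j] _; exact: h.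
Qed.

Lemma mx_norm_mul m n p (A : 'M[R]_(m, n)) (B : 'M[R]_(n, p)) :
  `|A *m B| <= n%:R * `|A| * `|B|.
Proof.
apply: mx_norm_le => [|i j]; first by rewrite !mulr_ge0.
rewrite mxE; apply: le_trans (ler_norm_sum _ _ _) _.
apply: (@le_trans _ _ (\sum_(k < n) `|A| * `|B|)); last first.
  by rewrite sumr_const card_ord -[leLHS]mulr_natl mulrA.
by apply: ler_sum => k _; rewrite normrM; apply: ler_pM => //; exact: mx_norm_coord.
Qed.

Lemma mx_norm_exp n (A : 'M[R]_n) k : `|A ^+ k| <= (n%:R * `|A|) ^+ k.
Proof.
elim: k => [|k IH].
  rewrite !expr0; apply: mx_norm_le => // i j; rewrite mxE.
  by case: (i == j); rewrite ?normr1 ?normr0.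
rewrite !exprS; apply: le_trans (mx_norm_mul _ _) _.
by apply: ler_wpM2l => //; exact: mulr_ge0.
Qed.

End MatrixNorm.

Section Exponential.
Context {R : realType}.

Let cvgn_unique (W : normedModType R) (u : nat -> W) (a b : W) :
  u @ \oo --> a -> u @ \oo --> b -> a = b.
Proof. by move=> ua ub; have := @cvg_unique W; move=> /(_ (@norm_hausdorff _ W) _ _ _ _ ua ub). Qed.

Let cvgn_norm_le (W : normedModType R) (u : nat -> W) (a : W) (c : R) :
  u @ \oo --> a -> (forall N, `|u N| <= c) -> `|a| <= c.
Proof.
move=> ua uc; have F := @eventually_filter.
have cn : (fun N => `|u N|) @ \oo --> `|a| by exact: cvg_norm.
rewrite -(cvg_lim (@norm_hausdorff _ R) cn); apply: limr_le; last by near=> N.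
by apply/cvg_ex; exists `|a|.
Unshelve. all: by end_near. Qed.

Let term n (A : 'M[R]_n) k : 'M[R]_n := k`!%:R^-1 *: A ^+ k.

Let norm_term_le n (A B : 'M[R]_n) (r c : R) k :
  `|B| <= c * r ^+ k -> `|(k`!%:R^-1 : R) *: B| <= c * exp_coeff r k.
Proof.
move=> h; rewrite normrZ /exp_coeff /= mulrC mulrA ger0_norm ?invr_ge0 //.
by apply: ler_wpM2r; rewrite ?invr_ge0.
Qed.

Lemma expm_cvg n (A : 'M[R]_n) :
  series (fun k => k`!%:R^-1 *: A ^+ k) @ \oo --> expm A.
Proof.
suff : cvgn (series (term A)) by [].
apply: normed_cvg.
apply: series_le_cvg (@is_cvg_series_exp_coeff R (n%:R * `|A|)) => k //=.
  by rewrite /exp_coeff /= divr_ge0 // exprn_ge0 // mulr_ge0.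
by rewrite -[leRHS]mul1r; apply: norm_term_le => //; rewrite mul1r; exact: mx_norm_exp.
Qed.

Lemma expm_lin_cvg n (W : normedModType R) (L : {linear 'M[R]_n -> W}) (A : 'M[R]_n) :
  series (fun k => k`!%:R^-1 *: L (A ^+ k)) @ \oo --> L (expm A).
Proof.
have -> : series (fun k => k`!%:R^-1 *: L (A ^+ k)) = L \o series (term A).
  apply/funext => k; rewrite /series /= linear_sum; apply: eq_bigr => i _.
  by rewrite linearZ.
by apply: continuous_cvg; [exact: mx_linear_continuous|exact: expm_cvg].
Qed.

(** For maps that respect powers, such as a conjugation: they pass through the exponential
    series. *)
Lemma expm_lin_eq n p (L : {linear 'M[R]_n -> 'M[R]_p}) (A : 'M[R]_n) (B : 'M[R]_p) :
  (forall k, L (A ^+ k) = B ^+ k) -> L (expm A) = expm B.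
Proof.
move=> h; apply: (cvgn_unique (@expm_lin_cvg _ _ L A)).
have -> : (fun k => k`!%:R^-1 *: L (A ^+ k)) = (fun k => k`!%:R^-1 *: B ^+ k).
  by apply/funext => k; rewrite h.
exact: expm_cvg.
Qed.

Lemma ursubmx_linear n : linear (@ursubmx R n n n n).
Proof. by move=> a A B; apply/matrixP => i j; rewrite !mxE. Qed.
HB.instance Definition _ n := GRing.isLinear.Build R 'M[R]_(n + n) 'M[R]_n _
  (@ursubmx R n n n n) (@ursubmx_linear n).

(** The derivative of the k-th power in direction V without commutativity, that is the sum of A^i V
    A^(k-1-i). *)
Fixpoint dpow n (A V : 'M[R]_n) k : 'M[R]_n :=
  if k is k'.+1 then A *m dpow A V k' + V *m A ^+ k' else 0.

Lemma expr_block n (A V : 'M[R]_n) k :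
  (block_mx A V 0 A : 'M[R]_(n + n)) ^+ k = block_mx (A ^+ k) (dpow A V k) 0 (A ^+ k).
Proof.
elim: k => [|k IH]; first by rewrite !expr0 /= -scalar_mx_block.
rewrite exprS IH -[_ * _]/(_ *m _) mulmx_block !mulmx0 !mul0mx !addr0 !add0r.
by rewrite !exprS.
Qed.

(* The upper right block of exp [[A, V], [0, A]] is the derivative of exp at A in
   the direction V. *)
Definition dexpm n (A V : 'M[R]_n) : 'M[R]_n :=
  ursubmx (expm (block_mx A V 0 A : 'M[R]_(n + n))).

Let dexpm_cvg n (A V : 'M[R]_n) :
  series (fun k => k`!%:R^-1 *: dpow A V k) @ \oo --> dexpm A V.
Proof.
have := @expm_lin_cvg _ _ (ursubmx : {linear 'M[R]_(n + n) -> 'M[R]_n}) (block_mx A V 0 A : 'M[R]_(n + n)).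
by under eq_fun do rewrite expr_block /= block_mxKur.
Qed.

Let dpow_linear n (A : 'M[R]_n) k : linear (fun V => dpow A V k).
Proof.
move=> a U V; elim: k => [|k IH] /=; first by rewrite scaler0 addr0.
by rewrite IH mulmxDr mulmxDl -scalemxAr -scalemxAl scalerDr addrACA.
Qed.

Lemma dexpm_linear n (A : 'M[R]_n) : linear (dexpm A).
Proof.
move=> a U V; apply: (cvgn_unique (@dexpm_cvg n A _)).
have -> : series (fun k => k`!%:R^-1 *: dpow A (a *: U + V) k) =
  (fun N => a *: series (fun k => k`!%:R^-1 *: dpow A U k) N
            + series (fun k => k`!%:R^-1 *: dpow A V k) N).
  apply/funext => N; rewrite /series /= scaler_sumr -big_split; apply: eq_bigr => i _ /=.
  by rewrite dpow_linear scalerDr !scalerA mulrC.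
by apply: cvgD; [apply: cvgZl_tmp|]; exact: dexpm_cvg.
Qed.
HB.instance Definition _ n A := GRing.isLinear.Build R 'M[R]_n 'M[R]_n _
  (@dexpm n A) (@dexpm_linear n A).

(** The two bounds are proved together because the second-order remainder of the next power is A
    times the present remainder plus V times the present first difference. The assumption 1 <= r
    lets r^k be replaced by r^(k+1). *)
Let rem_bound n (A V : 'M[R]_n) (r : R) k : 1 <= r ->
  n%:R * (`|A| + `|V|) <= r ->
  `|(A + V) ^+ k - A ^+ k| <= k%:R * (n%:R * `|V|) * r ^+ k /\
  `|(A + V) ^+ k - A ^+ k - dpow A V k| <= (k * k)%:R * (n%:R * `|V|) ^+ 2 * r ^+ k.
Proof.
move=> r1 hr; have r0 : 0 <= r by apply: le_trans r1.
have Ar : n%:R * `|A| <= r.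
  by apply: le_trans hr; apply: ler_wpM2l => //; rewrite lerDl.
have AVr : n%:R * `|A + V| <= r.
  by apply: le_trans hr; apply: ler_wpM2l => //; exact: ler_normD.
have pA j : `|A ^+ j| <= r ^+ j.
  apply: le_trans (mx_norm_exp _ _) _; apply: lerXn2r => //.
  by rewrite nnegrE; exact: mulr_ge0.
have v0 : 0 <= n%:R * `|V| by exact: mulr_ge0.
elim: k => [|k [IH1 IH2]].
  by rewrite !expr0 /= !subrr normr0 !mul0r.
have e1 : (A + V) ^+ k.+1 - A ^+ k.+1
    = (A + V) *m ((A + V) ^+ k - A ^+ k) + V *m A ^+ k.
  by rewrite !exprS -![_ * _ ^+ _]/(_ *m _) mulmxBr [X in _ - X + _]mulmxDl opprD addrA subrK.
have e2 : (A + V) ^+ k.+1 - A ^+ k.+1 - dpow A V k.+1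
    = A *m ((A + V) ^+ k - A ^+ k - dpow A V k) + V *m ((A + V) ^+ k - A ^+ k).
  rewrite e1 /= mulmxDl [in RHS]mulmxBr opprD addrACA subrr addr0.
  by rewrite addrAC.
have rk0 : 0 <= r ^+ k by exact: exprn_ge0.
split.
  rewrite e1; apply: le_trans (ler_normD _ _) _.
  apply: (@le_trans _ _ (r * (k%:R * (n%:R * `|V|) * r ^+ k) + n%:R * `|V| * r ^+ k)).
    apply: lerD; apply: le_trans (mx_norm_mul _ _) _.
      by apply: ler_pM => //; exact: mulr_ge0.
    exact: ler_wpM2l.
  rewrite exprS -natr1; move: (n%:R * `|V|) v0 (r ^+ k) rk0 (k%:R : R).
  move=> v v0 s s0 l; have : v * s <= r * (v * s) by apply: ler_peMl => //; exact: mulr_ge0.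
  by move=> h; lra.
rewrite e2; apply: le_trans (ler_normD _ _) _.
apply: (@le_trans _ _ (r * ((k * k)%:R * (n%:R * `|V|) ^+ 2 * r ^+ k)
   + n%:R * `|V| * (k%:R * (n%:R * `|V|) * r ^+ k))).
  apply: lerD; apply: le_trans (mx_norm_mul _ _) _.
    by apply: ler_pM => //; exact: mulr_ge0.
  exact: ler_wpM2l.
rewrite [r ^+ k.+1]exprS mulnS mulSn !natrD natrM -natr1.
have k0 : 0 <= (k%:R : R) by [].
move: (n%:R * `|V|) v0 (r ^+ k) rk0 (k%:R : R) k0 => v v0 s s0 l l0.
have h0 : 0 <= v ^+ 2 * s by rewrite mulr_ge0 // exprn_ge0.
have h1 : v ^+ 2 * s <= r * (v ^+ 2 * s) by exact: ler_peMl.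
have h2 : l * (v ^+ 2 * s) <= l * (r * (v ^+ 2 * s)) by exact: ler_wpM2l.
have h3 : 0 <= l * (r * (v ^+ 2 * s)) by rewrite !mulr_ge0.
have h4 : 0 <= r * (v ^+ 2 * s) by rewrite mulr_ge0.
by rewrite expr2 in h0 h1 h2 h3 h4 *; lra.
Qed.

Lemma is_diff_expm n (A : 'M[R]_n) : is_diff A (@expm R n) (dexpm A).
Proof.
apply: is_diff_eps.
- exact: dexpm_linear.
- exact: (@mx_linear_continuous _ _ _ _ (dexpm A)).
move=> e e0.
pose r : R := n%:R * (`|A| + 1) + 1.
have r1 : 1 <= r by rewrite lerDr mulr_ge0 // addr_ge0.
(* The factor k^2 of the remainder bound is at most 4^k, which turns r^k into (4 r)^k and sums to
   exp(4 r). *)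
pose C : R := n%:R ^+ 2 * expR (4 * r).
have C0 : 0 <= C by rewrite mulr_ge0 ?exprn_ge0 // expR_ge0.
have bound V : `|V| <= 1 -> `|expm (A + V) - expm A - dexpm A V| <= C * `|V| ^+ 2.
  move=> V1.
  have hr : n%:R * (`|A| + `|V|) <= r.
    by rewrite /r ler_wpDr // ler_wpM2l // lerD2l.
  have cv : (fun N => series (term (A + V)) N - series (term A) N
      - series (fun k => k`!%:R^-1 *: dpow A V k) N) @ \oo
      --> expm (A + V) - expm A - dexpm A V.
    by apply: cvgB; [apply: cvgB; exact: expm_cvg|exact: dexpm_cvg].
  apply: (cvgn_norm_le cv) => N.
  rewrite /series /= -!sumrB; apply: le_trans (ler_norm_sum _ _ _) _.
  apply: (@le_trans _ _ (\sum_(0 <= k < N) (n%:R * `|V|) ^+ 2 * exp_coeff (4 * r) k)).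
    apply: ler_sum => k _; rewrite -!scalerBr; apply: (norm_term_le A).
    have [_ h] := rem_bound k r1 hr; apply: le_trans h _.
    have v0 : 0 <= (n%:R * `|V|) ^+ 2 by rewrite exprn_ge0 // mulr_ge0.
    move: ((n%:R * `|V|) ^+ 2) v0 => v v0.
    rewrite exprMn mulrA [_ * v]mulrC; apply: ler_wpM2r.
      by apply: exprn_ge0; apply: le_trans r1.
    apply: ler_wpM2l => //.
    rewrite -natrX ler_nat -[4%N]/(2 * 2)%N expnMn leq_mul //; exact/ltnW/ltn_expl.
  rewrite -mulr_sumr exprMn /C mulrAC; apply: ler_wpM2r; first exact: exprn_ge0.
  apply: ler_wpM2l; first exact: exprn_ge0.
  apply: nondecreasing_cvgn_le; last exact: is_cvg_series_exp_coeff.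
  apply: nondecreasing_series => k _ _; rewrite /exp_coeff /= divr_ge0 // exprn_ge0 //.
  by rewrite mulr_ge0 //; apply: le_trans r1.
have C1 : 0 < C + 1 by apply: ltr_wpDl; [exact: C0|exact: ltr01].
have eC : 0 < e / (C + 1) by exact: divr_gt0.
have n1 : \forall V \near (0 : 'M[R]_n), `|V| <= 1 by exact: nbhs0_le.
have n2 : \forall V \near (0 : 'M[R]_n), `|V| <= e / (C + 1) by exact: nbhs0_le.
apply: filterS2 n1 n2 => V V1 Ve.
apply: le_trans (bound V V1) _; rewrite expr2 mulrA; apply: ler_wpM2r => //.
apply: (@le_trans _ _ ((C + 1) * `|V|)); first by apply: ler_wpM2r => //; rewrite lerDl.
by rewrite mulrC -ler_pdivlMr.
Qed.

Lemma derive_expm n (A V : 'M[R]_n) : 'D_V (@expm R n) A = dexpm A V.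
Proof. by have [d dE] := is_diff_expm A; rewrite deriveE // dE. Qed.

(** The size n stays quantified in the induction: the derivative in size n is a block of [expm] in
    size n + n at an affine function of A, and the hypothesis is used in that size. *)
Lemma Sm_expm k n : Sm k setT (@expm R n).
Proof.
elim: k n => [|k IH] n.
  move=> A _; apply: differentiable_continuous; exact: (@ex_diff _ _ _ _ _ _ _ (is_diff_expm A)).
split=> [A _|V]; first exact: (@ex_diff _ _ _ _ _ _ _ (is_diff_expm A)).
rewrite (_ : 'D_V (@expm R n) = @ursubmx R n n n n \o (fun A => expm (block_mx A V 0 A : 'M[R]_(n + n)))); last first.
  by apply/funext => A; exact: derive_expm.
apply: Sm_mxlin_comp; first exact: openT.
apply: (@Sm_comp _ _ _ _ _ _ setT setT (fun A => block_mx A V 0 A : 'M[R]_(n + n)) (@expm R (n + n))) => //; first exact: openT.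
apply: Sm_mx => [|i j]; first exact: openT.
rewrite /block_mx.
case: (split_ordP i) => i' ->; case: (split_ordP j) => j' ->.
- by rewrite (_ : (fun _ => _) = coord i' j'); [exact: (Sm_coord i' j' openT (@Sm_id _ _ k setT))|apply/funext => A; rewrite block_mxEul].
- rewrite (_ : (fun _ => _) = fun=> V i' j'); first exact: Sm_cst.
  by apply/funext => A; rewrite block_mxEur.
- rewrite (_ : (fun _ => _) = fun=> 0); first exact: Sm_cst.
  by apply/funext => A; rewrite block_mxEdl mxE.
- by rewrite (_ : (fun _ => _) = coord i' j'); [exact: (Sm_coord i' j' openT (@Sm_id _ _ k setT))|apply/funext => A; rewrite block_mxEdr].
Qed.

Lemma Sm_expm_comp (V : normedModType R) k n (U : set V) (f : V -> 'M[R]_n) :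
  open U -> Sm k U f -> Sm k U (fun x => expm (f x)).
Proof. by move=> oU Sf; exact: (Sm_comp oU (fun _ _ => I) Sf (@Sm_expm k n)). Qed.

End Exponential.

(** * Symmetric matrices and monotonicity of exp *)

Section EntrywiseInnerProduct.
Context {R : realType}.

(** Equals tr(A B^T), hence an inner product on all rectangular matrices, and agrees with
    [frobenius] when B is symmetric. The norm of the matrix space is the maximum norm, so the
    Euclidean [nrm] is kept apart. *)
Definition ip m n (A B : 'M[R]_(m, n)) : R := \sum_i \sum_j A i j * B i j.
Definition nrm m n (A : 'M[R]_(m, n)) : R := Num.sqrt (ip A A).

Section Theory.
Variables m n : nat.
Implicit Types A B C : 'M[R]_(m, n).

Lemma ipC A B : ip A B = ip B A.
Proof. by do 2![apply: eq_bigr => ? _]; rewrite mulrC. Qed.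

Lemma ip_linearl B : linear ((@ip m n)^~ B : _ -> R^o).
Proof.
move=> a A C; rewrite /ip scaler_sumr -big_split; apply: eq_bigr => i _ /=.
rewrite scaler_sumr -big_split; apply: eq_bigr => j _ /=.
by rewrite !mxE mulrDl -mulrA.
Qed.

Lemma ipDl A B C : ip (A + B) C = ip A C + ip B C.
Proof. by have := ip_linearl C 1 A B; rewrite !scale1r. Qed.

Lemma ipZl a A B : ip (a *: A) B = a * ip A B.
Proof.
have := ip_linearl B a A 0; rewrite addr0 => ->.
suff -> : ip 0 B = 0 by rewrite addr0.
by apply: big1 => i _; apply: big1 => j _; rewrite mxE mul0r.
Qed.

Lemma ipNl A B : ip (- A) B = - ip A B.
Proof. by rewrite -scaleN1r ipZl mulN1r. Qed.

Lemma ip0l B : ip 0 B = 0.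
Proof. by rewrite -(subrr B) ipDl ipNl subrr. Qed.

Lemma ipBl A B C : ip (A - B) C = ip A C - ip B C.
Proof. by rewrite ipDl ipNl. Qed.

Lemma ipDr A B C : ip A (B + C) = ip A B + ip A C.
Proof. by rewrite ipC ipDl ![ip _ A]ipC. Qed.

Lemma ipZr a A B : ip A (a *: B) = a * ip A B.
Proof. by rewrite ipC ipZl ipC. Qed.

Lemma ipBr A B C : ip A (B - C) = ip A B - ip A C.
Proof. by rewrite ipC ipBl ![ip _ A]ipC. Qed.

Lemma ip_ge0 A : 0 <= ip A A.
Proof. by do 2![apply: sumr_ge0 => ? _]; rewrite -expr2 sqr_ge0. Qed.

Lemma ip_eq0 A : ip A A = 0 -> A = 0.
Proof.
move=> /eqP; rewrite psumr_eq0 => [/allP h|i _]; last first.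
  by apply: sumr_ge0 => j _; rewrite -expr2 sqr_ge0.
apply/matrixP => i j; have := h i (mem_index_enum i) => /=.
rewrite psumr_eq0 => [/allP/(_ j (mem_index_enum j))|k _]; last first.
  by rewrite -expr2 sqr_ge0.
by rewrite /= -expr2 sqrf_eq0 mxE => /eqP.
Qed.

Lemma nrm_ge0 A : 0 <= nrm A. Proof. exact: sqrtr_ge0. Qed.

Lemma nrm_sqr A : nrm A ^+ 2 = ip A A.
Proof. by rewrite sqr_sqrtr ?ip_ge0. Qed.

Lemma nrm_eq0 A : nrm A = 0 -> A = 0.
Proof. by move=> h; apply: ip_eq0; rewrite -nrm_sqr h expr0n. Qed.

Lemma nrm0 : nrm (0 : 'M[R]_(m, n)) = 0.
Proof. by rewrite /nrm ip0l sqrtr0. Qed.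

Lemma nrmZ a A : nrm (a *: A) = `|a| * nrm A.
Proof. by rewrite /nrm ipZl ipZr mulrA -expr2 sqrtrM ?sqr_ge0 // sqrtr_sqr. Qed.

Lemma nrmN A : nrm (- A) = nrm A.
Proof. by rewrite -scaleN1r nrmZ normrN1 mul1r. Qed.

Lemma nrmBC A B : nrm (A - B) = nrm (B - A).
Proof. by rewrite -nrmN opprB. Qed.

Lemma CauchySchwarz A B : ip A B <= nrm A * nrm B.
Proof.
apply: le_trans (ler_norm _) _; rewrite -(@ler_pXn2r _ 2) ?nnegrE ?mulr_ge0 ?nrm_ge0 //.
rewrite exprMn !nrm_sqr real_normK ?num_real //.
have := ip_ge0 (ip B B *: A - ip A B *: B).
rewrite ipBl !ipBr !ipZl !ipZr [ip B A]ipC.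
have [|] := eqVneq (ip B B) 0.
  by move=> /ip_eq0 -> _; rewrite [ip A 0]ipC !ip0l expr0n /= mulr0.
move=> b0 h; have bp : 0 < ip B B by rewrite lt_neqAle eq_sym b0 ip_ge0.
rewrite -(ler_pM2l bp) -subr_ge0; apply: le_trans h _.
by rewrite le_eqVlt; apply/orP; left; apply/eqP; ring.
Qed.

Lemma nrm_triangle A B : nrm (A + B) <= nrm A + nrm B.
Proof.
rewrite -(@ler_pXn2r _ 2) ?nnegrE ?addr_ge0 ?nrm_ge0 //.
rewrite sqrrD !nrm_sqr ipDl !ipDr [ip B A]ipC addrA lerD2r -addrA lerD2l.
by rewrite -mulr2n lerMn2r /= CauchySchwarz.
Qed.

Lemma nrm_dist A B C : nrm (A - C) <= nrm (A - B) + nrm (B - C).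
Proof. by rewrite -[X in nrm X](subrKA B) nrm_triangle. Qed.

Lemma mx_norm_nrm A : `|A| <= nrm A.
Proof.
apply: mx_norm_le => [|i j]; first exact: nrm_ge0.
rewrite -(@ler_pXn2r _ 2) ?nnegrE ?nrm_ge0 // nrm_sqr real_normK ?num_real //.
rewrite /ip (bigD1 i) //= (bigD1 j) //= -expr2 -addrA lerDl addr_ge0 //.
  by apply: sumr_ge0 => k _; rewrite -expr2 sqr_ge0.
by do 2![apply: sumr_ge0 => ? _]; rewrite -expr2 sqr_ge0.
Qed.

Lemma nrm_le_sum A : nrm A <= \sum_i \sum_j `|A i j|.
Proof.
have s0 : 0 <= \sum_i \sum_j `|A i j| by do 2![apply: sumr_ge0 => ? _].
rewrite -(@ler_pXn2r _ 2) ?nnegrE ?nrm_ge0 // nrm_sqr expr2 mulr_suml.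
apply: ler_sum => i _; rewrite mulr_suml; apply: ler_sum => j _.
apply: le_trans (ler_norm _) _; rewrite normrM; apply: ler_wpM2l => //.
rewrite (bigD1 i) //= (bigD1 j) //= -addrA lerDl addr_ge0 //.
  by apply: sumr_ge0.
by do 2![apply: sumr_ge0 => ? _].
Qed.

Lemma nrm_le A : nrm A <= (m * n)%:R * `|A|.
Proof.
apply: le_trans (nrm_le_sum _) _.
apply: (@le_trans _ _ (\sum_(i < m) \sum_(j < n) `|A|)).
  by do 2![apply: ler_sum => ? _]; exact: mx_norm_coord.
by rewrite !sumr_const !card_ord -mulrnA mulr_natl mulnC.
Qed.

End Theory.

Lemma Sm_ip (V : normedModType R) m n k (U : set V) (f g : V -> 'M[R]_(m, n)) :
  open U -> Sm k U f -> Sm k U g -> Sm k U (fun x => ip (f x) (g x)).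
Proof.
move=> oU Sf Sg; rewrite /ip; do 2![apply: Sm_sum => // ?].
by apply: Sm_mul => //; exact: Sm_coord.
Qed.

Lemma nrm_continuous m n : continuous (@nrm m n).
Proof.
move=> A; apply: continuous_comp; last exact: sqrt_continuous.
by apply: (Sm_ip openT (@Sm_id _ _ 0 setT) (@Sm_id _ _ 0 setT)).
Qed.

Lemma trace_ip m n (A : 'M[R]_(m, n)) (B : 'M[R]_(n, m)) : \tr (A *m B) = ip A B^T.
Proof.
rewrite /mxtrace /ip; apply: eq_bigr => i _; rewrite mxE; apply: eq_bigr => j _.
by rewrite mxE.
Qed.

End EntrywiseInnerProduct.

(** * The spectral theorem for real symmetric matrices *)

Section SymmetricMatrices.
Context {R : realType}.

Lemma SymP n (A : 'M[R]_n) : Sym A <-> A^T = A.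
Proof.
rewrite /Sym /=; split=> [/is_hermitianmxP|AT].
  by rewrite expr0 scale1r map_mx_id // => <-.
by apply/is_hermitianmxP; rewrite expr0 scale1r map_mx_id // AT.
Qed.

Lemma SymE n (A : 'M[R]_n) i j : Sym A -> A i j = A j i.
Proof. by move=> /SymP AT; rewrite -{1}AT mxE. Qed.

Lemma frobeniusE n (A B : 'M[R]_n) : Sym B -> frobenius A B = ip A B.
Proof. by move=> /SymP BT; rewrite /frobenius trace_ip BT. Qed.

Lemma SymD n (A B : 'M[R]_n) : Sym A -> Sym B -> Sym (A + B).
Proof. by move=> /SymP AT /SymP BT; apply/SymP; rewrite linearD /= AT BT. Qed.

Lemma SymZ n a (A : 'M[R]_n) : Sym A -> Sym (a *: A).
Proof. by move=> /SymP AT; apply/SymP; rewrite linearZ /= AT. Qed.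

Lemma SymB n (A B : 'M[R]_n) : Sym A -> Sym B -> Sym (A - B).
Proof. by move=> sA sB; rewrite -scaleN1r; apply: SymD => //; exact: SymZ. Qed.

Lemma Sym_diag n (d : 'rV[R]_n) : Sym (diag_mx d).
Proof. by apply/SymP; exact: tr_diag_mx. Qed.

(** A maximizer v of the quadratic form on the unit sphere: B = f(v) - A is positive semidefinite
    and its form vanishes at v, which forces v B = 0. *)
Lemma rayleigh n (A : 'M[R]_n.+1) : Sym A ->
  exists v mu, ip v v = 1 /\ v *m A = mu *: (v : 'rV_n.+1).
Proof.
move=> sA.
pose S := [set v : 'rV[R]_n.+1 | nrm v = 1].
have S0 : S !=set0.
  exists (delta_mx 0 0); rewrite /S /= /nrm.
  suff -> : ip (delta_mx 0 0 : 'rV[R]_n.+1) (delta_mx 0 0) = 1 by rewrite sqrtr1.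
  rewrite /ip big_ord_recl big_ord0 addr0 (bigD1 0) //= big1 ?addr0; last first.
    by move=> j /negPf j0; rewrite !mxE j0 andbF mul0r.
  by rewrite !mxE eqxx mul1r.
have cS : compact S.
  apply: bounded_closed_compact.
    exists 1; split => // x x1 v /= v1; apply: le_trans (mx_norm_nrm v) _.
    by rewrite v1 ltW.
  have -> : S = (@nrm R 1 n.+1) @^-1` [set 1] by [].
  by apply: closed_comp => [v _|]; [exact: nrm_continuous|exact: closed_eq].
pose f (v : 'rV[R]_n.+1) : R := ip (v *m A) v.
have cf : continuous f.
  have S0f : Sm 0 setT f.
    apply: Sm_ip; [exact: openT| |exact: Sm_id].
    by apply: Sm_mulmx; [exact: openT|exact: Sm_id|exact: Sm_cst].
  by move=> v; exact: (S0f v I).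
have [v vS vmax] : exists2 c, c \in S & forall t, t \in S -> f t <= f c.
  by apply: EVT_max_rV => //; exact: continuous_subspaceT.
have v1 : ip v v = 1.
  by move: vS; rewrite inE /S /= => h; rewrite -nrm_sqr h expr1n.
pose B := f v *: 1%:M - A.
have BT : B^T = B by rewrite /B linearB /= linearZ /= trmx1 (SymP A).1.
have selfadj (x y : 'rV[R]_n.+1) : ip (x *m B) y = ip x (y *m B).
  have e (u w : 'rV[R]_n.+1) : ip u w = (u *m w^T) 0 0.
    by rewrite -trace_mx11 trace_ip trmxK.
  by rewrite !e trmx_mul BT mulmxA.
have Bpos (x : 'rV[R]_n.+1) : 0 <= ip (x *m B) x.
  rewrite /B mulmxBr -scalemxAr mulmx1 ipBl ipZl subr_ge0.
  have [x0|x0] := eqVneq (nrm x) 0.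
    by rewrite (nrm_eq0 x0) mul0mx !ip0l mulr0.
  pose u := (nrm x)^-1 *: x.
  have uS : u \in S.
    rewrite inE /S /= nrmZ ger0_norm ?invr_ge0 ?nrm_ge0 //.
    by rewrite mulVf.
  have xu : x = nrm x *: u by rewrite /u scalerA mulfV // scale1r.
  rewrite {1 2}xu -scalemxAl ipZl ipZr -nrm_sqr expr2 mulrA mulrC.
  rewrite -expr2; apply: ler_wpM2r; first exact: sqr_ge0.
  exact: vmax.
have Bv : ip (v *m B) v = 0.
  by rewrite /B mulmxBr -scalemxAr mulmx1 ipBl ipZl v1 mulr1 subrr.
pose w := v *m B.
(* Otherwise w = v B is nonzero, and at v - s w the form of B has the value s (s r - 2 <w, w>),
   negative for the s below; the 1 in r + 1 avoids a division by zero. *)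
have q0 : ip w w = 0.
  apply/eqP; rewrite eq_le ip_ge0 andbT leNgt; apply/negP => q0.
  have r0 := Bpos w; set r := ip (w *m B) w in r0.
  have rp : 0 < r + 1 by rewrite ltr_wpDl.
  pose s := ip w w / (r + 1).
  have sp : 0 < s by rewrite divr_gt0.
  have := Bpos (v - s *: w).
  rewrite mulmxBl -scalemxAl ipBl !ipBr !ipZl !ipZr Bv -/w.
  have -> : ip (w *m B) v = ip w w by rewrite selfadj.
  rewrite -/r; have -> : 0 - s * ip w w - (s * ip w w - s * (s * r)) =
     s * (s * r - ip w w *+ 2) by ring.
  rewrite pmulr_rge0 // subr_ge0 leNgt => /negP; apply.
  apply: (@le_lt_trans _ _ (ip w w)).
    by rewrite /s mulrAC ler_pdivrMr // ler_wpM2l ?ip_ge0 // lerDl.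
  by rewrite mulr2n ltrDl.
exists v, (f v); split => //.
have := ip_eq0 q0; rewrite /w /B mulmxBr -scalemxAr mulmx1 => /eqP.
by rewrite subr_eq0 => /eqP <-.
Qed.

(** The reflection in the hyperplane orthogonal to v - e exchanges v and the first basis vector e;
    for v = e the identity serves. *)
Lemma householder n (v : 'rV[R]_n.+1) : ip v v = 1 ->
  exists H : 'M[R]_n.+1, [/\ H^T = H, H *m H = 1%:M & delta_mx 0 0 *m H = v].
Proof.
move=> v1; pose e := (delta_mx 0 0 : 'rV[R]_n.+1).
have [ve|ve] := eqVneq v e.
  by exists 1%:M; split; rewrite ?trmx1 ?mulmx1.
pose w := v - e.
have ww0 : ip w w != 0.
  by apply/eqP => /ip_eq0 /eqP; rewrite subr_eq0; apply/negP.
have [c cE] : exists c, c * ip w w = 2 by exists (2 / ip w w); rewrite divfK.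
have dotE (x y : 'rV[R]_n.+1) : x *m y^T = (ip x y)%:M.
  by rewrite [LHS]mx11_scalar -trace_mx11 trace_ip trmxK.
have ee : ip e e = 1.
  rewrite /ip big_ord_recl big_ord0 addr0 (bigD1 0) //= big1 ?addr0; last first.
    by move=> j /negPf j0; rewrite !mxE j0 andbF mul0r.
  by rewrite !mxE eqxx mul1r.
have wwE : ip w w = 2 - ip e v *+ 2.
  by rewrite /w ipBl !ipBr v1 ee [ip v e]ipC; ring.
have ewE : ip e w = ip e v - 1 by rewrite /w ipBr ee.
exists (1%:M - c *: (w^T *m w)); split.
- by rewrite linearB /= linearZ /= trmx1 trmx_mul trmxK.
- rewrite mulmxBr mulmx1 mulmxBl mul1mx -scalemxAl -scalemxAr.
  have -> : w^T *m w *m (w^T *m w) = ip w w *: (w^T *m w).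
    by rewrite mulmxA -(mulmxA w^T) dotE mul_mx_scalar scalemxAl.
  rewrite !scalerA -[c * c * ip w w]mulrA.
  by rewrite cE [c * 2]mulrC -scalerA scaler_nat mulr2n opprB addrK subrK.
- rewrite mulmxBr mulmx1 -scalemxAr mulmxA dotE mul_scalar_mx scalerA.
  have -> : c * ip e w = -1.
    by apply: (mulIf ww0); rewrite mulrAC cE ewE wwE; ring.
  by rewrite scaleN1r opprK /w addrC subrK.
Qed.

Definition spectral_decomposition n (A Q : 'M[R]_n) (d : 'rV[R]_n) :=
  Q *m Q^T = 1%:M /\ A = Q^T *m diag_mx d *m Q.

(** Deflation: after a reflection that sends a unit eigenvector to the first basis vector, symmetry
    clears the rest of the first row and column and leaves a smaller symmetric block. *)
Theorem spectral n (A : 'M[R]_n) : Sym A -> exists Q d, spectral_decomposition A Q d.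
Proof.
elim: n A => [|n IH] A sA.
  by exists 1%:M, 0; split; apply/matrixP => -[].
have [v [mu [v1 vA]]] := rayleigh sA.
have [H [HT HH eH]] := householder v1.
have [B BdE] : exists B : 'M[R]_(1 + n), B = H *m A *m H by eexists.
have BT : B^T = B by rewrite BdE !trmx_mul HT ((SymP A).1 sA) // mulmxA.
have eB : (delta_mx 0 0 : 'rV[R]_n.+1) *m B = mu *: delta_mx 0 0.
  by rewrite BdE !mulmxA eH vA -scalemxAl -eH -mulmxA HH mulmx1.
have row0 j : B 0 j = mu * (j == 0)%:R.
  by have := congr1 (fun M : 'rV_n.+1 => M 0 j) eB; rewrite -rowE !mxE eqxx.
have l0 : lshift n (0 : 'I_1) = (0 : 'I_n.+1) by exact/val_inj.
have r0 (j : 'I_n) : (rshift 1 j == (0 : 'I_n.+1)) = false by [].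
have BE : B = block_mx mu%:M 0 0 (drsubmx B).
  rewrite -{1}(submxK B); congr block_mx; apply/matrixP => i j.
  - by rewrite [i]ord1 [j]ord1 !mxE l0 row0 eqxx mulr1 mulr1n.
  - by rewrite [i]ord1 !mxE l0 row0 r0 mulr0.
  - by rewrite [j]ord1 !mxE l0 -BT mxE row0 r0 mulr0.
have sB' : Sym (drsubmx B).
  apply/SymP; have := congr1 (@drsubmx R 1 n 1 n) BT.
  by rewrite trmx_drsub.
have [Q [d [QQ dE]]] := IH _ sB'.
pose X : 'M[R]_(1 + n) := block_mx 1%:M 0 0 Q.
have XT : X^T = block_mx 1%:M 0 0 Q^T by rewrite /X tr_block_mx !trmx0 trmx1.
have XX : X *m X^T = 1%:M.
  by rewrite XT mulmx_block !mulmx0 !mul0mx mulmx1 !addr0 !add0r QQ -scalar_mx_block.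
have XD : X^T *m diag_mx (row_mx mu%:M d) *m X = B.
  rewrite XT BE diag_mx_row !mulmx_block !mulmx0 !mul0mx !mulmx1 !mul1mx !addr0 !add0r -dE.
  rewrite !mul0mx; congr block_mx.
  by apply/matrixP => i j; rewrite !mxE !ord1.
exists (X *m H), (row_mx mu%:M d : 'rV[R]_(1 + n)); split.
  by rewrite trmx_mul HT -mulmxA (mulmxA H H) HH mul1mx XX.
have -> : A = H *m B *m H by rewrite BdE !mulmxA HH mul1mx -mulmxA HH mulmx1.
by rewrite -XD trmx_mul HT !mulmxA.
Qed.

End SymmetricMatrices.

(** * Functional calculus, Klein's inequality and monotonicity of exp *)

Section SymmetricExponential.
Context {R : realType}.

(** Functional calculus relative to a chosen decomposition, so that independence of the choice never
    has to be proved. *)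
Definition spec_fun n (f : R -> R) (Q : 'M[R]_n) (d : 'rV[R]_n) : 'M[R]_n :=
  Q^T *m diag_mx (map_mx f d) *m Q.

Lemma spec_funE n (A Q : 'M[R]_n) d :
  spectral_decomposition A Q d -> A = spec_fun id Q d.
Proof. by case=> _ ->; rewrite /spec_fun map_mx_id. Qed.

Lemma spec_fun1 n (Q : 'M[R]_n) d : Q *m Q^T = 1%:M -> spec_fun (fun=> 1) Q d = 1%:M.
Proof.
move=> QQ; rewrite /spec_fun; have -> : diag_mx (map_mx (fun=> 1) d) = 1%:M :> 'M[R]_n.
  by apply/matrixP => i j; rewrite !mxE.
by rewrite mulmx1; exact: mulmx1C.
Qed.

Lemma spec_fun_mul n f g (Q : 'M[R]_n) d : Q *m Q^T = 1%:M ->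
  spec_fun f Q d *m spec_fun g Q d = spec_fun (fun x => f x * g x) Q d.
Proof.
move=> QQ; rewrite /spec_fun !mulmxA -(mulmxA _ Q Q^T) QQ mulmx1; congr (_ *m _).
rewrite -mulmxA; congr (_ *m _); rewrite mulmx_diag; congr diag_mx.
by apply/rowP => i; rewrite !mxE.
Qed.

Lemma Sym_spec_fun n f (Q : 'M[R]_n) d : Sym (spec_fun f Q d).
Proof. by apply/SymP; rewrite /spec_fun !trmx_mul trmxK tr_diag_mx mulmxA. Qed.

Lemma spec_fun_quad n f (Q : 'M[R]_n) d (v : 'cV[R]_n) :
  (v^T *m spec_fun f Q d *m v) 0 0 = \sum_i f (d 0 i) * (Q *m v) i 0 ^+ 2.
Proof.
have -> : v^T *m spec_fun f Q d *m v = (Q *m v)^T *m (diag_mx (map_mx f d) *m (Q *m v)).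
  by rewrite /spec_fun trmx_mul !mulmxA.
rewrite mxE; apply: eq_bigr => i _; rewrite mul_diag_mx !mxE.
by rewrite expr2 mulrCA.
Qed.

Lemma ip_spec n (f g : R -> R) (Q P : 'M[R]_n) (a b : 'rV[R]_n) :
  ip (spec_fun f Q a) (spec_fun g P b) =
  \sum_i \sum_j (Q *m P^T) i j ^+ 2 * (f (a 0 i) * g (b 0 j)).
Proof.
have /SymP sg := Sym_spec_fun g P b; rewrite -{1}sg -trace_ip.
have -> : \tr (spec_fun f Q a *m spec_fun g P b) =
    \tr (diag_mx (map_mx f a) *m (Q *m P^T) *m diag_mx (map_mx g b) *m (Q *m P^T)^T).
  by rewrite /spec_fun -!mulmxA mxtrace_mulC trmx_mul trmxK -!mulmxA.
apply: eq_bigr => i _; rewrite mxE; apply: eq_bigr => j _.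
by rewrite mul_mx_diag mul_diag_mx !mxE; ring.
Qed.

Lemma expm_diag n (d : 'rV[R]_n) : expm (diag_mx d) = diag_mx (map_mx expR d).
Proof.
have dX k : diag_mx d ^+ k = diag_mx (map_mx (fun x => x ^+ k) d).
  elim: k => [|k IH]; first by apply/matrixP => i j; rewrite expr0 !mxE expr0.
  rewrite exprS IH -[_ * _]/(_ *m _) mulmx_diag; congr diag_mx.
  by apply/rowP => i; rewrite !mxE exprS.
apply/matrixP => i j.
have H := @expm_lin_cvg _ _ _ (coord i j : {linear 'M[R]_n -> R^o}) (diag_mx d).
have -> : expm (diag_mx d) i j =
    limn (series (fun k => (k`!%:R^-1 : R) * (diag_mx d ^+ k) i j)).
  exact: esym (cvg_lim (@norm_hausdorff _ R) H).
rewrite !mxE; have [->|ij] := eqVneq i j.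
  rewrite mulr1n /expR.
  have -> // : (fun k => (k`!%:R^-1 : R) * (diag_mx d ^+ k) j j) = exp_coeff (d 0 j).
  by apply/funext => k; rewrite dX !mxE eqxx mulr1n /exp_coeff /= mulrC.
rewrite mulr0n.
rewrite (_ : series _ = fun=> 0); first exact: lim_cst.
apply/funext => N; rewrite /series /= big1 // => k _.
by rewrite dX !mxE (negPf ij) mulr0n mulr0.
Qed.

Lemma expm_spec n (A Q : 'M[R]_n) d :
  spectral_decomposition A Q d -> expm A = spec_fun expR Q d.
Proof.
case=> QQ ->; rewrite /spec_fun -expm_diag.
have QQ' : Q^T *m Q = 1%:M by exact: mulmx1C.
pose L : {linear 'M[R]_n -> 'M[R]_n} := (mulmxr Q \o mulmx Q^T)%FUN.
have := @expm_lin_eq _ _ _ L (diag_mx d) (Q^T *m diag_mx d *m Q).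
rewrite /L /= => -> // k; elim: k => [|k IH]; first by rewrite !expr0 mulmx1.
by rewrite !exprS -IH -![_ * _]/(_ *m _) !mulmxA -(mulmxA _ Q Q^T) QQ mulmx1.
Qed.

Lemma Sym_expm n (A : 'M[R]_n) : Sym A -> Sym (expm A).
Proof. by move=> /spectral[Q [d /expm_spec ->]]; exact: Sym_spec_fun. Qed.

(* Klein's inequality: all the traces below expand over the same nonnegative
   weights (Q P^T)_ij ^ 2, which reduces them to scalar inequalities. *)
Lemma klein n (A B Q P : 'M[R]_n) a b (phi : R -> R -> R)
    (s : seq (R * (R -> R) * (R -> R))) :
  spectral_decomposition A Q a -> spectral_decomposition B P b ->
  (forall x y, phi x y = \sum_(t <- s) t.1.1 * (t.1.2 x * t.2 y)) ->
  \sum_(t <- s) t.1.1 * ip (spec_fun t.1.2 Q a) (spec_fun t.2 P b) =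
  \sum_i \sum_j (Q *m P^T) i j ^+ 2 * phi (a 0 i) (b 0 j).
Proof.
move=> _ _ phiE.
under eq_bigr do rewrite ip_spec mulr_sumr.
rewrite exchange_big; apply: eq_bigr => i _ /=.
under eq_bigr do rewrite mulr_sumr.
rewrite exchange_big; apply: eq_bigr => j _ /=.
rewrite phiE mulr_sumr; apply: eq_bigr => t _; ring.
Qed.

Lemma spectral_bound n (A Q : 'M[R]_n) d i :
  spectral_decomposition A Q d -> `|d 0 i| <= nrm A.
Proof.
move=> sA; rewrite -(@ler_pXn2r _ 2) ?nnegrE ?nrm_ge0 // nrm_sqr real_normK ?num_real //.
have QQ := sA.1; rewrite (spec_funE sA) ip_spec QQ.
rewrite (eq_bigr (fun i => d 0 i ^+ 2)) => [|j _]; last first.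
  rewrite (bigD1 j) //= big1 ?addr0 => [|k kj]; last first.
    by rewrite mxE eq_sym (negPf kj) expr0n mul0r.
  by rewrite mxE eqxx expr1n mul1r expr2.
by rewrite (bigD1 i) //= lerDl sumr_ge0 // => j _; exact: sqr_ge0.
Qed.

Let scalar_tangent (x y : R) : 0 <= expR y - expR x - expR x * (y - x).
Proof.
have -> : expR y = expR x * expR (y - x) by rewrite -expRD addrC subrK.
have -> : expR x * expR (y - x) - expR x - expR x * (y - x) =
  expR x * (expR (y - x) - (1 + (y - x))) by ring.
by rewrite mulr_ge0 ?expR_ge0 // subr_ge0 expR_ge1Dx.
Qed.

Let scalar_mono (r x y : R) : - r <= x -> - r <= y ->
  expR (- r) * (y - x) ^+ 2 <= (expR y - expR x) * (y - x).
Proof.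
wlog xy : x y / x <= y.
  move=> H rx ry; have [|/ltW yx] := leP x y; first by move=> xy; exact: H.
  have -> : (y - x) ^+ 2 = (x - y) ^+ 2 by ring.
  have -> : (expR y - expR x) * (y - x) = (expR x - expR y) * (x - y) by ring.
  exact: H.
move=> rx ry; rewrite expr2 mulrA; apply: ler_wpM2r; first by rewrite subr_ge0.
apply: (@le_trans _ _ (expR x * (y - x))).
  by apply: ler_wpM2r; rewrite ?subr_ge0 // ler_expR.
by rewrite -subr_ge0.
Qed.

Let klein_ge0 n (A B Q P : 'M[R]_n) a b (phi : R -> R -> R)
    (s : seq (R * (R -> R) * (R -> R))) :
  spectral_decomposition A Q a -> spectral_decomposition B P b ->
  (forall x y, phi x y = \sum_(t <- s) t.1.1 * (t.1.2 x * t.2 y)) ->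
  (forall i j, 0 <= phi (a 0 i) (b 0 j)) ->
  0 <= \sum_(t <- s) t.1.1 * ip (spec_fun t.1.2 Q a) (spec_fun t.2 P b).
Proof.
move=> sA sB phiE p0; rewrite (klein sA sB phiE).
by do 2![apply: sumr_ge0 => ? _]; rewrite mulr_ge0 ?sqr_ge0.
Qed.

Let ip1 n (A : 'M[R]_n) : ip 1%:M A = \tr A.
Proof. by rewrite -[A]trmxK -trace_ip mul1mx mxtrace_tr trmxK. Qed.

Let ip1M n (A B : 'M[R]_n) : Sym B -> ip 1%:M (A *m B) = ip A B.
Proof. by move=> /SymP BT; rewrite ip1 trace_ip BT. Qed.

(** Klein's inequality for the convex function exp: tr exp lies above its tangent at A, whose
    gradient is exp A. It lets the minimization behind [Dcor] proceed without differentiating a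
    trace. *)
Lemma expm_tangent n (A B : 'M[R]_n) : Sym A -> Sym B ->
  \tr (expm A) + ip (expm A) (B - A) <= \tr (expm B).
Proof.
move=> SA SB; have [Q [a sA]] := spectral SA; have [P [b sB]] := spectral SB.
(* A triple (c, f, g) stands for the summand c f(x) g(y); together they expand e^y - e^x - e^x (y -
   x). *)
pose s : seq (R * (R -> R) * (R -> R)) :=
  [:: (1, fun=> 1, expR); (-1, expR, fun=> 1); (-1, expR, id);
      (1, fun x => expR x * x, fun=> 1)].
have /= := @klein_ge0 _ A B Q P a b (fun x y => expR y - expR x - expR x * (y - x)) s sA sB.
rewrite /s !big_cons big_nil /= !spec_fun1 ?sA.1 ?sB.1 // -spec_fun_mul ?sA.1 //.
rewrite -(spec_funE sA) -(spec_funE sB) -(expm_spec sA) -(expm_spec sB).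
rewrite ![ip _ 1%:M]ipC ip1M // !ip1 => h.
rewrite -subr_ge0; apply: le_trans (h _ _) _.
- by move=> x y; rewrite !big_cons big_nil /=; ring.
- by move=> i j; exact: scalar_tangent.
by rewrite ipBr le_eqVlt; apply/orP; left; apply/eqP; ring.
Qed.

(** The bound r on the norms confines all eigenvalues to [-r, r], where exp has slope at least
    exp(-r); Klein's expansion carries this scalar inequality over to matrices. *)
Lemma expm_strong_mono n (A B : 'M[R]_n) r : Sym A -> Sym B ->
  nrm A <= r -> nrm B <= r ->
  expR (- r) * ip (B - A) (B - A) <= ip (expm B - expm A) (B - A).
Proof.
move=> SA SB Ar Br; have [Q [a sA]] := spectral SA; have [P [b sB]] := spectral SB.
pose m := expR (- r).
(* The first four terms expand (e^y - e^x) (y - x), the last three subtract m (y - x)^2. *)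
pose s : seq (R * (R -> R) * (R -> R)) :=
  [:: (1, fun=> 1, fun y => expR y * y); (-1, id, expR); (-1, expR, id);
      (1, fun x => expR x * x, fun=> 1);
      (- m, fun=> 1, fun y => y * y); (m *+ 2, id, id); (- m, fun x => x * x, fun=> 1)].
have /= := @klein_ge0 _ A B Q P a b
  (fun x y => (expR y - expR x) * (y - x) - m * (y - x) ^+ 2) s sA sB.
rewrite /s !big_cons big_nil /= !spec_fun1 ?sA.1 ?sB.1 //.
rewrite -!(spec_fun_mul _ _ _ sA.1) -!(spec_fun_mul _ _ _ sB.1).
rewrite -(spec_funE sA) -(spec_funE sB) -(expm_spec sA) -(expm_spec sB).
rewrite ![ip _ 1%:M]ipC !ip1M // => h.
rewrite -subr_ge0; apply: le_trans (h _ _) _.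
- by move=> x y; rewrite !big_cons big_nil /=; ring.
- have low x : `|x| <= r -> - r <= x by rewrite ler_norml => /andP[].
  move=> i j; rewrite subr_ge0; apply: scalar_mono; apply: low.
    by exact: le_trans (spectral_bound _ sA) Ar.
  by exact: le_trans (spectral_bound _ sB) Br.
rewrite !ipBr !ipBl [ip B A]ipC [ip A (expm B)]ipC -/m le_eqVlt; apply/orP; left; apply/eqP; ring.
Qed.

Lemma expm_mono n (A B : 'M[R]_n) : Sym A -> Sym B ->
  0 <= ip (expm B - expm A) (B - A).
Proof.
move=> SA SB; have := @expm_strong_mono _ A B (nrm A + nrm B) SA SB.
rewrite lerDl lerDr !nrm_ge0 => /(_ isT isT); apply: le_trans.
by rewrite mulr_ge0 ?expR_ge0 ?ip_ge0.
Qed.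

(** Asks only that the differences be orthogonal, not that the exponentials agree: for the
    uniqueness of [Dcor] one difference is diagonal and the other has zero diagonal. *)
Lemma expm_inj_ip n (A B : 'M[R]_n) : Sym A -> Sym B ->
  ip (expm B - expm A) (B - A) = 0 -> A = B.
Proof.
move=> SA SB h; have := @expm_strong_mono _ A B (nrm A + nrm B) SA SB.
rewrite lerDl lerDr !nrm_ge0 => /(_ isT isT); rewrite h pmulr_rle0 ?expR_gt0 // => le0.
have /eqP : ip (B - A) (B - A) = 0 by apply/eqP; rewrite eq_le le0 ip_ge0.
by move=> /eqP /ip_eq0 /eqP; rewrite subr_eq0 => /eqP.
Qed.

Lemma expm_inj n (A B : 'M[R]_n) : Sym A -> Sym B -> expm A = expm B -> A = B.
Proof.
move=> SA SB AB; apply: expm_inj_ip => //.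
by rewrite AB subrr ip0l.
Qed.

(* Far away from A, monotonicity along the segment from A reduces the bound to
   the point at distance 1. *)
Lemma expm_coercive n (A B : 'M[R]_n) r : Sym A -> nrm A <= r -> Sym B ->
  expR (- (r + 1)) * Num.min 1 (nrm (B - A)) * nrm (B - A) <=
    ip (expm B - expm A) (B - A).
Proof.
move=> SA Ar; move: B.
have near_bound B : Sym B -> nrm (B - A) <= 1 ->
    expR (- (r + 1)) * ip (B - A) (B - A) <= ip (expm B - expm A) (B - A).
  move=> SB BA; apply: expm_strong_mono => //; first by rewrite ler_wpDr.
  by rewrite -{1}(subrK A B) addrC; apply: le_trans (nrm_triangle _ _) _; exact: lerD.
move=> B SB; have [BA|/ltW BA] := leP (nrm (B - A)) 1.
  by rewrite -mulrA -expr2 nrm_sqr; exact: near_bound.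
rewrite mulr1; set t := nrm (B - A) in BA *.
have t0 : 0 < t by apply: lt_le_trans BA.
pose B' := A + t^-1 *: (B - A).
have SB' : Sym B' by apply: SymD => //; apply/SymZ/SymB.
have B'A : B' - A = t^-1 *: (B - A) by rewrite /B' addrC addKr.
have n1 : nrm (B' - A) = 1.
  have t_neq0 := lt0r_neq0 t0; rewrite B'A nrmZ ger0_norm ?invr_ge0 ?ltW // -/t.
  exact: mulVf.
have h1 : expR (- (r + 1)) <= ip (expm B' - expm A) (B' - A).
  by have := near_bound B' SB'; rewrite n1 lexx -nrm_sqr n1 expr1n mulr1; apply.
have BB' : B - B' = (1 - t^-1) *: (B - A).
  by rewrite /B' opprD addrA scalerBl scale1r.
have h2 : 0 <= ip (expm B - expm B') (B - A).
  have [t1|t1] := eqVneq t 1.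
    have -> : B' = B by rewrite /B' t1 invr1 scale1r addrC subrK.
    by rewrite subrr ip0l.
  have := expm_mono SB' SB; rewrite BB' ipZr pmulr_rge0 // subr_gt0 invf_lt1 //.
  by rewrite lt_neqAle eq_sym t1.
have -> : ip (expm B - expm A) (B - A) =
    ip (expm B - expm B') (B - A) + t * ip (expm B' - expm A) (B' - A).
  have t_neq0 := lt0r_neq0 t0; rewrite B'A ipZr mulrA (mulfV t_neq0) mul1r -ipDl.
  by congr (ip _ _); rewrite addrA subrK.
by rewrite mulrC -[leLHS]add0r; apply: lerD => //; apply: ler_wpM2l => //; exact: ltW.
Qed.

(** The difference quotient of exp at A along V, paired with V, stays above m (nrm V)^2 by
    coercivity, and so does its limit. *)
Lemma dexpm_gt0 n (A V : 'M[R]_n) : Sym A -> Sym V -> ip (dexpm A V) V = 0 -> V = 0.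
Proof.
move=> SA SV h0; apply: nrm_eq0; apply/eqP/negPn/negP => V0.
have Vp : 0 < nrm V by rewrite lt_neqAle eq_sym V0 nrm_ge0.
have m0 := expR_gt0 (- (nrm A + 1)); set m := expR _ in m0.
have mP B := @expm_coercive _ A B (nrm A) SA (lexx _).
have [dA dAE] := is_diff_expm A.
have cv : (fun t : R => t^-1 *: (expm (t *: V + A) - expm A)) @ (0 : R)^' --> dexpm A V.
  by have := diff_derivable (v := V) dA; rewrite /derivable -derive_expm.
have ci : continuous (fun X : 'M[R]_n => ip X V).
  by move=> X; apply: (Sm_ip openT (@Sm_id _ _ 0 setT) (@Sm_cst _ _ _ 0 setT V)).
have {}cv : (fun t : R => ip (t^-1 *: (expm (t *: V + A) - expm A)) V) @ (0 : R)^' --> (0 : R).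
  have : (fun X : 'M[R]_n => ip X V) \o
      (fun t : R => t^-1 *: (expm (t *: V + A) - expm A)) @ (0 : R)^' --> ip (dexpm A V) V.
    by apply: continuous_cvg; [exact: ci|exact: cv].
  by rewrite h0.
suff : m * nrm V ^+ 2 <= 0 by rewrite leNgt mulr_gt0 // exprn_gt0.
rewrite -(cvg_lim (@norm_hausdorff _ R) cv).
apply: limr_ge; first by apply/cvg_ex; exists 0.
have i0 : 0 < (nrm V)^-1 by rewrite invr_gt0.
(* For such t the increment t V has norm at most 1, so the minimum in the coercivity bound is that
   norm and the bound is quadratic in t. *)
have n0 : \forall t \near (0 : R), `|t| <= (nrm V)^-1 by exact: nbhs0_le.
have n1 : \forall t \near (0 : R)^', `|t| <= (nrm V)^-1 by exact: nbhs_dnbhs.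
have n2 : \forall t \near (0 : R)^', t != 0 by exact: nbhs_dnbhs_neq.
apply: filterS2 n1 n2 => t tV t0.
have := mP (t *: V + A) (SymD (SymZ t SV) SA); rewrite addrK nrmZ ipZr ipZl.
rewrite min_r; last by rewrite -ler_pdivlMr // mul1r.
have t2 : 0 < t * t by rewrite -expr2 lt_neqAle eq_sym sqrf_eq0 t0 sqr_ge0.
have -> : m * (`|t| * nrm V) * (`|t| * nrm V) = t * t * (m * nrm V ^+ 2).
  by rewrite -expr2 -(real_normK (num_real t)); ring.
move=> h; rewrite -(ler_pM2l t2); apply: le_trans h _.
by rewrite mulrA mulfK.
Qed.

End SymmetricExponential.

(** * The logarithmic coordinates *)

Section Projections.
Context {R : realType}.

Definition symp n (A : 'M[R]_n) : 'M[R]_n := 2^-1 *: (A + A^T).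
Definition dg n (A : 'M[R]_n) : 'M[R]_n := A - off A.

Lemma symp_linear n : linear (@symp n).
Proof.
move=> a A B; apply/matrixP => i j; rewrite !mxE; ring.
Qed.
HB.instance Definition _ n := GRing.isLinear.Build R 'M[R]_n 'M[R]_n _
  (@symp n) (@symp_linear n).

Lemma off_linear n : linear (@off R n).
Proof.
by move=> a A B; apply/matrixP => i j; rewrite !mxE; case: eqP => // _; rewrite mulr0 addr0.
Qed.
HB.instance Definition _ n := GRing.isLinear.Build R 'M[R]_n 'M[R]_n _
  (@off R n) (@off_linear n).

Lemma dg_linear n : linear (@dg n).
Proof. by move=> a A B; rewrite /dg linearP scalerBr opprD addrACA. Qed.
HB.instance Definition _ n := GRing.isLinear.Build R 'M[R]_n 'M[R]_n _
  (@dg n) (@dg_linear n).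

Definition hol n (A : 'M[R]_n) : 'M[R]_n := off (symp A).

Lemma hol_linear n : linear (@hol n).
Proof. by move=> a A B; rewrite /hol !linearP. Qed.
HB.instance Definition _ n := GRing.isLinear.Build R 'M[R]_n 'M[R]_n _
  (@hol n) (@hol_linear n).

Lemma Sym_symp n (A : 'M[R]_n) : Sym (symp A).
Proof. by apply/SymP; rewrite /symp linearZ /= linearD /= trmxK addrC. Qed.

Lemma symp_id n (A : 'M[R]_n) : Sym A -> symp A = A.
Proof.
move=> /SymP AT; rewrite /symp AT -[A + A]mulr2n -[A *+ 2]scaler_nat scalerA.
by rewrite mulVf ?scale1r // pnatr_eq0.
Qed.

Lemma Sym_off n (A : 'M[R]_n) : Sym A -> Sym (off A).
Proof.
by move=> SA; apply/SymP/matrixP => i j; rewrite !mxE eq_sym (SymE j i SA).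
Qed.

Lemma Hol_hol n (A : 'M[R]_n) : Hol (hol A).
Proof.
by split=> [|i]; [exact/Sym_off/Sym_symp|rewrite !mxE eqxx].
Qed.

Lemma off_hollow n (A : 'M[R]_n) : (forall i, A i i = 0) -> off A = A.
Proof. by move=> A0; apply/matrixP => i j; rewrite !mxE; case: eqP => // ->. Qed.

Lemma hol_id n (A : 'M[R]_n) : Hol A -> hol A = A.
Proof. by case=> SA A0; rewrite /hol /= symp_id // off_hollow. Qed.

Lemma off_diag n (D : 'M[R]_n) : is_diag_mx D -> off D = 0.
Proof.
move=> /is_diag_mxP h; apply/matrixP => i j; rewrite !mxE.
by case: (eqVneq i j) => // ij; exact: h.
Qed.

Lemma dgE n (A : 'M[R]_n) i j : dg A i j = A i i *+ (i == j).
Proof. by rewrite !mxE; case: eqP => [->|_]; rewrite ?subr0 // subrr. Qed.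

Lemma dg_is_diag n (A : 'M[R]_n) : is_diag_mx (dg A).
Proof. by apply/is_diag_mxP => i j ij; rewrite dgE -val_eqE (negPf ij). Qed.

Lemma Sym_is_diag n (D : 'M[R]_n) : is_diag_mx D -> Sym D.
Proof. by move=> /diag_mxP[d ->]; exact: Sym_diag. Qed.

End Projections.

(** * Positive definite matrices and smoothness of the logarithm *)

Section PositiveDefinite.
Context {R : realType}.

Lemma SPD_expm n (A : 'M[R]_n) : Sym A -> SPD (expm A).
Proof.
move=> SA; split; first exact: Sym_expm.
have [Q [d sA]] := spectral SA; rewrite (expm_spec sA) => v v0.
rewrite spec_fun_quad.
have Qv0 : Q *m v != 0.
  apply: contra v0 => /eqP h; rewrite -[v]mul1mx -(mulmx1C sA.1) -mulmxA h.
  by rewrite mulmx0.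
rewrite lt_neqAle sumr_ge0 ?andbT => [|i _]; last by rewrite mulr_ge0 ?expR_ge0 ?sqr_ge0.
rewrite eq_sym; apply: contra Qv0; rewrite psumr_eq0 => [/allP h|i _]; last first.
  by rewrite mulr_ge0 ?expR_ge0 ?sqr_ge0.
apply/eqP/matrixP => i j; rewrite ord1 [RHS]mxE.
have := h i (mem_index_enum i); rewrite /= mulf_eq0 sqrf_eq0 gt_eqF ?expR_gt0 //=.
by move/eqP.
Qed.

Lemma SPD_eigenvalues n (P Q : 'M[R]_n) d :
  SPD P -> spectral_decomposition P Q d -> forall i, 0 < d 0 i.
Proof.
case=> _ pos sP i; have QQ := sP.1.
pose v : 'cV[R]_n := Q^T *m delta_mx i 0.
have Qv : Q *m v = delta_mx i 0 by rewrite mulmxA QQ mul1mx.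
have v0 : v != 0.
  apply/eqP => h; have := congr1 (fun M : 'cV[R]_n => M i 0) Qv.
  by rewrite h mulmx0 !mxE !eqxx => /eqP; rewrite eq_sym oner_eq0.
have := pos v v0; rewrite (spec_funE sP) spec_fun_quad Qv (bigD1 i) //= big1.
  by rewrite !mxE !eqxx expr1n mulr1 addr0.
by move=> j ji; rewrite mxE (negPf ji) expr0n mulr0.
Qed.

Lemma SPD_expm_surj n (P : 'M[R]_n) : SPD P -> exists2 A, Sym A & expm A = P.
Proof.
move=> sP; have [Q [d sd]] := spectral sP.1; have d0 := SPD_eigenvalues sP sd.
pose l : 'rV[R]_n := map_mx (@ln R) d.
have sl : spectral_decomposition (spec_fun id Q l) Q l.
  by split; [exact: sd.1|rewrite /spec_fun map_mx_id].
exists (spec_fun id Q l); first exact: Sym_spec_fun.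
rewrite (expm_spec sl) sd.2 /spec_fun; congr (_ *m diag_mx _ *m _).
by apply/rowP => i; rewrite !mxE lnK // posrE.
Qed.

Lemma SPD_coercive n (P : 'M[R]_n) : SPD P ->
  exists2 m : R, 0 < m & forall v : 'cV[R]_n, m * ip v v <= (v^T *m P *m v) 0 0.
Proof.
move=> sP; have [Q [d sd]] := spectral sP.1; have d0 := SPD_eigenvalues sP sd.
(* The smallest eigenvalue, capped by 1 so that the constant is positive for n = 0 too. *)
exists (\big[Num.min/1]_i d 0 i).
  by elim/big_rec: _ => [|i x _ x0]; rewrite ?ltr01 // lt_min d0.
move=> v; rewrite (spec_funE sd) spec_fun_quad.
have -> : ip v v = \sum_i (Q *m v) i 0 ^+ 2.
  have : (v^T *m spec_fun (fun=> 1) Q d *m v) 0 0 = \sum_i 1 * (Q *m v) i 0 ^+ 2.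
    exact: spec_fun_quad.
  rewrite spec_fun1 ?sd.1 // mulmx1 -trace_mx11 trace_ip.
  under eq_bigr do rewrite mul1r.
  move=> <-; rewrite /ip exchange_big.
  by apply: eq_bigr => i _; apply: eq_bigr => j _; rewrite !mxE.
rewrite mulr_sumr; apply: ler_sum => i _; apply: ler_wpM2r; first exact: sqr_ge0.
exact: bigmin_le.
Qed.

Lemma quad_bound n (E : 'M[R]_n) (v : 'cV[R]_n) :
  `|(v^T *m E *m v) 0 0| <= n%:R * `|E| * ip v v.
Proof.
have -> : (v^T *m E *m v) 0 0 = \sum_i \sum_j v j 0 * E j i * v i 0.
  rewrite mxE; apply: eq_bigr => i _; rewrite mxE mulr_suml.
  by apply: eq_bigr => j _; rewrite mxE.
have -> : n%:R * `|E| * ip v v =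
    \sum_(i < n) \sum_(j < n) `|E| * (2^-1 * (v j 0 ^+ 2 + v i 0 ^+ 2)).
  have ipE : ip v v = \sum_i v i 0 ^+ 2.
    by apply: eq_bigr => i _; rewrite big_ord_recl big_ord0 addr0 expr2.
  under eq_bigr do rewrite -mulr_sumr -mulr_sumr big_split /= -ipE sumr_const card_ord.
  rewrite -mulr_sumr -mulr_sumr big_split /= sumr_const card_ord.
  under [X in _ = _ * (_ * (_ + X))]eq_bigr do rewrite -mulr_natr.
  rewrite -mulr_suml -ipE -mulr_natr.
  by field.
apply: le_trans (ler_norm_sum _ _ _) _; apply: ler_sum => i _.
apply: le_trans (ler_norm_sum _ _ _) _; apply: ler_sum => j _.
rewrite !normrM mulrAC [leLHS]mulrC.
apply: ler_pM; [by []|by rewrite mulr_ge0|exact: mx_norm_coord|].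
rewrite -(real_normK (num_real (v j 0))) -(real_normK (num_real (v i 0))).
have := sqr_ge0 (`|v j 0| - `|v i 0|).
by move: `|_| `|_| => x y; rewrite sqrrB; lra.
Qed.

(** The shape covers both [symp] with c = 0 and [hol] with c = 1. The set is open among all matrices
    because a perturbation of the form by at most half its coercivity constant keeps it positive. *)
Lemma open_SPD n (f : {linear 'M[R]_n -> 'M[R]_n}) (c : 'M[R]_n) :
  (forall A, Sym (f A + c)) -> open [set A : 'M[R]_n | SPD (f A + c)].
Proof.
move=> Sf; rewrite openE => A0 /= sP.
have [m m0 mP] := SPD_coercive sP.
have K0 : 0 < (n%:R + 1 : R) by rewrite ltr_wpDl.
have nf : \forall A \near A0, `|f A0 - f A| <= m / 2 / (n%:R + 1).
  have e0 : 0 < m / 2 / (n%:R + 1) by rewrite !divr_gt0.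
  by have /cvgrPdist_le := @mx_linear_continuous _ _ _ _ f A0; apply.
apply: filterS nf => A hA; split; first exact: Sf.
move=> v v0; have v2 : 0 < ip v v.
  rewrite lt_neqAle ip_ge0 andbT eq_sym; apply: contra v0 => /eqP /ip_eq0 ->.
  exact: eqxx.
have -> : f A + c = (f A0 + c) - (f A0 - f A) by rewrite opprB [RHS]addrC addrA subrK.
rewrite mulmxBr mulmxBl mxE [X in _ + X]mxE subr_gt0.
apply: lt_le_trans (mP v); apply: le_lt_trans (ler_norm _) _.
apply: le_lt_trans (quad_bound _ _) _; rewrite ltr_pM2r //.
apply: (@le_lt_trans _ _ (m / 2)); last by rewrite ltr_pdivrMr // ltr_pMr // ltr1n.
apply: (@le_trans _ _ ((n%:R + 1) * `|f A0 - f A|)).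
  by apply: ler_wpM2r => //; rewrite lerDl.
by rewrite mulrC -ler_pdivlMr.
Qed.

Lemma expm_injS n : {in @Sym R n &, injective (@expm R n)}.
Proof. by move=> A B; rewrite !inE => SA SB; exact: expm_inj. Qed.

Lemma expmK n (A : 'M[R]_n) : Sym A -> logm (expm A) = A.
Proof. by move=> SA; apply: (pinvKV _ (@expm_injS n)); rewrite inE. Qed.

Lemma Sym_logm n (P : 'M[R]_n) : SPD P -> Sym (logm P).
Proof. by move=> /SPD_expm_surj[A SA <-]; rewrite expmK. Qed.

Lemma logmK n (P : 'M[R]_n) : SPD P -> expm (logm P) = P.
Proof. by move=> /SPD_expm_surj[A SA <-]; rewrite expmK. Qed.

Definition USPD n : set 'M[R]_n := [set A | SPD (symp A)].

Lemma open_USPD n : open (@USPD n).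
Proof.
have -> : @USPD n = [set A | SPD (symp A + 0)].
  by apply/seteqP; split => A; rewrite /USPD /= addr0.
by apply: open_SPD => A; rewrite addr0; exact: Sym_symp.
Qed.

(** Coercivity of exp read backwards: if D is the difference of the logarithms of P' and P, then m
    min(1, |D|) |D| is at most |P' - P| |D|. *)
Lemma logm_continuous n (A : 'M[R]_n) : USPD A -> {for A, continuous (@logm R n \o @symp R n)}.
Proof.
move=> UA; have SL := Sym_logm UA.
have m0 := expR_gt0 (- (nrm (logm (symp A)) + 1)); set m := expR _ in m0.
have mP B := @expm_coercive _ _ _ B _ SL (lexx _).
suff : (@logm R n \o @symp R n) @ A --> logm (symp A) by [].
have FA : Filter (nbhs A) := nbhs_filter A.
apply/cvgrPdist_le => e e0.
(* e1 < 1 excludes the value 1 of the minimum, so that the bound falls on the norm of D. *)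
have [e1 [e10 e1e e11]] : exists e1, [/\ 0 < e1, e1 <= e & e1 < 1].
  have h2 : (2^-1 : R) < 1 by rewrite invf_lt1 // ltr1n.
  exists (Num.min e 2^-1); split; first by rewrite lt_min e0 invr_gt0 ltr0n.
    by rewrite ge_min lexx.
  by rewrite gt_min h2 orbT.
have nU : \forall B \near A, USPD B by exact: open_nbhs_nbhs (conj (@open_USPD n) UA).
have K0 : 0 < ((n * n)%:R + 1 : R) by rewrite ltr_wpDl.
have nS : \forall B \near A, `|symp A - symp B| <= m * e1 / ((n * n)%:R + 1).
  have d0 : 0 < m * e1 / ((n * n)%:R + 1) by rewrite !divr_gt0 // mulr_gt0.
  by have /cvgrPdist_le := @mx_linear_continuous _ _ _ _ (@symp R n) A; apply.
apply: filterS2 nU nS => B UB hB /=.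
have SLB := Sym_logm UB.
have := mP _ SLB; rewrite !logmK //; set D := logm (symp B) - logm (symp A) => h.
have D1 : m * Num.min 1 (nrm D) <= nrm (symp B - symp A).
  have [D0|D0] := eqVneq (nrm D) 0.
    by rewrite D0 min_r // mulr0 nrm_ge0.
  have Dp : 0 < nrm D by rewrite lt_neqAle eq_sym D0 nrm_ge0.
  by rewrite -(ler_pM2r Dp); apply: le_trans h _; exact: CauchySchwarz.
have D2 : nrm (symp B - symp A) <= m * e1.
  rewrite nrmBC; apply: le_trans (nrm_le _) _.
  apply: (@le_trans _ _ (((n * n)%:R + 1) * `|symp A - symp B|)).
    by apply: ler_wpM2r => //; rewrite lerDl.
  by rewrite mulrC -ler_pdivlMr.
have := le_trans D1 D2; rewrite ler_pM2l // ge_min leNgt e11 /= => De.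
rewrite distrC; apply: le_trans (mx_norm_nrm _) _; exact: le_trans De e1e.
Qed.

(* Equal to exp on symmetric matrices, but with derivatives that are injective
   on the whole matrix space. *)
Let Gexp n (A : 'M[R]_n) : 'M[R]_n := expm (symp A) + (A - symp A).

Let Sm_Gexp k n : Sm k setT (@Gexp n).
Proof.
apply: Sm_add; first exact: openT.
  by apply: Sm_expm_comp; [exact: openT|exact: Sm_mxlin].
have -> : (fun A : 'M[R]_n => A - symp A) = (idfun \- @symp R n).
  by [].
exact: Sm_mxlin.
Qed.

Let derive_Gexp n (A V : 'M[R]_n) : 'D_V (@Gexp n) A = dexpm (symp A) (symp V) + (V - symp V).
Proof.
have dS := @linear_differentiable _ _ _ (@symp R n) A (@mx_linear_continuous _ _ _ _ _).
have dE := @ex_diff _ _ _ _ _ _ _ (is_diff_expm (symp A)).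
have dc : differentiable (@expm R n \o @symp R n) A by exact: differentiable_comp.
have cl : continuous (idfun \- @symp R n : 'M[R]_n -> 'M[R]_n).
  exact: mx_linear_continuous.
have dl := @linear_differentiable _ _ _ (idfun \- @symp R n : {linear _ -> _}) A cl.
have e1 : 'D_V (@Gexp n) A = 'D_V (@expm R n \o @symp R n) A + 'D_V (idfun \- @symp R n) A.
  by apply: deriveD; exact: diff_derivable.
have e2 := derive_comp V dS dE; have e3 := derive_lin A V (@mx_linear_continuous _ _ _ _ (@symp R n)).
have e4 := @derive_lin _ _ _ (idfun \- @symp R n : {linear _ -> _}) A V cl.
rewrite e1 e2 e3; congr (_ + _); last exact: e4.
exact: derive_expm.
Qed.

Lemma Sm_logm k n : Sm k (@USPD n) (@logm R n \o @symp R n).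
Proof.
apply: (@Sm_inverse _ _ n n (@USPD n) (@Gexp n) (@symp R n)).
- exact: open_USPD.
- by move=> j; exact: Sm_Gexp.
- by move=> j; exact: Sm_mxlin.
- exact: logm_continuous.
- move=> A UA; rewrite /Gexp /= symp_id; last exact: Sym_logm.
  by rewrite subrr addr0 logmK.
- move=> A V UA; rewrite derive_Gexp /= symp_id; last exact: Sym_logm.
  move=> h.
  have : ip (dexpm (logm (symp A)) (symp V)) (symp V) + ip (V - symp V) (symp V) = 0.
    by rewrite -ipDl h ip0l.
  (* Symmetric and antisymmetric matrices are orthogonal, so pairing with the symmetric part of V
     isolates the derivative of exp. *)
  have -> : ip (V - symp V) (symp V) = 0.
    have -> : V - symp V = 2^-1 *: (V - V^T).
      by apply/matrixP => i j; rewrite !mxE; field.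
    rewrite ipZl /symp ipZr ipBl !ipDr.
    have -> : ip V^T V^T = ip V V.
      rewrite {1}/ip exchange_big; by do 2![apply: eq_bigr => ? _]; rewrite !mxE.
    by rewrite [ip V^T V]ipC; ring.
  rewrite addr0 => /(dexpm_gt0 (Sym_logm UA) (Sym_symp V)) V0.
  by move: h; rewrite V0 linear0 add0r subr0.
Qed.

End PositiveDefinite.

(** * Existence, uniqueness and smoothness of D(S) *)

Section CorrelationScaling.
Context {R : realType}.

Lemma Cor_expm_diag n (X : 'M[R]_n) : Sym X ->
  (forall i, expm X i i = 1) -> Cor (expm X).
Proof. by move=> SX h; split=> //; exact: SPD_expm. Qed.

(** Values at s and -s that are close to a nonzero x share its sign, contrary to the last two
    inequalities. *)
Let opposite_signs (x y z s : R) : 0 < s -> `|x - y| < `|x| -> `|x - z| < `|x| ->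
  0 <= s * y -> 0 <= - s * z -> False.
Proof.
move=> s0 + + sy sz; rewrite !ltr_norml => /andP[xy _] /andP[_ xz].
have y0 : 0 <= y by rewrite -(pmulr_rge0 _ s0).
have z0 : z <= 0 by rewrite -oppr_ge0 -(pmulr_rge0 _ s0) mulrN -mulNr.
have [x0|x0] := leP 0 x.
  by rewrite (ger0_norm x0) in xz; lra.
by rewrite (ltr0_norm x0) in xy; lra.
Qed.

Section Existence.
Variables (n : nat) (S : 'M[R]_n).
Hypothesis HS : Hol S.

(* The critical points of f are the d such that exp (S + diag d) has unit
   diagonal. *)
Let f (d : 'rV[R]_n) : R := \tr (expm (S + diag_mx d)) - \sum_i d 0 i.

Let SymSd (d : 'rV[R]_n) : Sym (S + diag_mx d).
Proof. by apply: SymD; [exact: HS.1|exact: Sym_diag]. Qed.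

(** The tangent inequality at diag d bounds tr exp (S + diag d) below by tr exp (diag d), the hollow
    S being orthogonal to diagonal matrices; then e^x - x >= |x| entrywise. *)
Let f_lower (d : 'rV[R]_n) : \sum_i `|d 0 i| <= f d.
Proof.
have := expm_tangent (Sym_diag d) (SymSd d).
rewrite addrK; have -> : ip (expm (diag_mx d)) S = 0.
  rewrite expm_diag /ip; apply: big1 => i _; apply: big1 => j _.
  by rewrite !mxE; case: (eqVneq i j) => [->|_]; rewrite ?HS.2 ?mulr0 // mulr0n mul0r.
rewrite addr0 /f lerBrDr => h; apply: le_trans h.
rewrite expm_diag -big_split /mxtrace; apply: ler_sum => i _ /=.
rewrite !mxE eqxx mulr1n.
have [d0|d0] := leP 0 (d 0 i); last by rewrite ltr0_norm // addNr expR_ge0.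
rewrite ger0_norm //.
(* For x >= 0: e^x = (e^(x/2))^2 >= (1 + x/2)^2 >= 2 x. *)
have e2 : expR (d 0 i) = expR (d 0 i / 2) ^+ 2.
  by rewrite expr2 -expRD -splitr.
have h1 := @expR_ge1Dx _ (d 0 i / 2).
rewrite e2; move: (expR _) h1 => E h1.
have h2 : (1 + d 0 i / 2) ^+ 2 <= E ^+ 2.
  by rewrite lerXn2r // nnegrE ?(le_trans _ h1) // addr_ge0 // divr_ge0.
apply: le_trans h2; have := sqr_ge0 (d 0 i / 2 - 1); rewrite sqrrB sqrrD; lra.
Qed.

Let f_continuous : continuous f.
Proof.
have Sf : Sm 0 setT f.
  apply: Sm_add; first exact: openT.
    rewrite /mxtrace; apply: Sm_sum => [|i]; first exact: openT.
    apply: Sm_coord; first exact: openT.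
    apply: Sm_expm_comp; first exact: openT.
    apply: Sm_add; [exact: openT|exact: Sm_cst|exact: Sm_mxlin].
  rewrite (_ : (fun d : 'rV[R]_n => - \sum_i d 0 i) = fun d => \sum_i (-1) * d 0 i).
    apply: Sm_sum => [|i]; first exact: openT.
    apply: Sm_mul; [exact: openT|exact: Sm_cst|].
    by apply: Sm_coord; [exact: openT|exact: Sm_id].
  by apply/funext => d; rewrite -mulr_sumr mulN1r.
by move=> d; exact: (Sf d I).
Qed.

Lemma Dcor_exists : exists D : 'M[R]_n, is_diag_mx D /\ Cor (expm (S + D)).
Proof.
(* Outside this ball f exceeds f 0 by [f_lower], so a minimizer over the ball is global. *)
pose K := [set d : 'rV[R]_n | `|d| <= f 0].
have f00 : 0 <= f 0 by apply: le_trans (f_lower 0); exact: sumr_ge0.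
have cK : compact K.
  apply: bounded_closed_compact.
    exists (f 0); split; first exact: num_real.
    by move=> x fx d; rewrite /K /= => /le_trans; apply; exact: ltW.
  have -> : K = (fun d : 'rV[R]_n => `|d|) @^-1` [set x | x <= f 0] by [].
  by apply: closed_comp => [d _|]; [exact: norm_continuous|exact: closed_le].
have K0 : K 0 by rewrite /K /= normr0.
have [d dK dmin] : exists2 c, c \in K & forall t, t \in K -> f c <= f t.
  by apply: EVT_min_rV => //; [exists 0|exact: continuous_subspaceT].
have {}dmin t : f d <= f t.
  have [tK|tK] := pselect (K t); first by apply: dmin; rewrite inE.
  apply: (@le_trans _ _ (f 0)); first by apply: dmin; rewrite inE.
  move/negP: tK; rewrite /K /= -ltNge => /ltW /le_trans; apply; apply: le_trans (f_lower t).
  apply: mx_norm_le => [|i j]; first exact: sumr_ge0.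
  by rewrite ord1 (bigD1 j) //= lerDl sumr_ge0.
exists (diag_mx d); split; first by apply/diag_mxP; exists d.
apply: Cor_expm_diag => // i.
pose g (t : R) := expm (S + diag_mx d + t *: diag_mx (delta_mx 0 i)) i i - 1.
(* The tangent inequality at the displaced point gives f (d + t e_i) <= f d + t g t, so minimality
   of d yields this sign; continuity of g then forces g 0 = 0. The function f itself is never
   differentiated. *)
have tg t : 0 <= t * g t.
  have E : S + diag_mx (d + t *: delta_mx 0 i) = S + diag_mx d + t *: diag_mx (delta_mx 0 i).
    by rewrite linearD linearZ /= addrA.
  have := expm_tangent (SymSd (d + t *: delta_mx 0 i)) (SymSd d).
  have := dmin (d + t *: delta_mx 0 i); rewrite /f E.
  have -> : S + diag_mx d - (S + diag_mx d + t *: diag_mx (delta_mx 0 i)) =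
      - (t *: diag_mx (delta_mx 0 i)) by rewrite opprD addrA subrr add0r.
  set B := expm (_ + _ *: _) => h1 h2.
  have s1 : \sum_j (d + t *: delta_mx 0 i) 0 j = \sum_j d 0 j + t.
    under eq_bigr do rewrite !mxE eqxx /=.
    rewrite big_split; congr (_ + _); rewrite (bigD1 i) //= eqxx mulr1 big1 ?addr0 //.
    by move=> j /negPf ->; rewrite mulr0.
  have s2 : ip B (- (t *: diag_mx (delta_mx 0 i))) = - t * B i i.
    rewrite ipC -scaleNr ipZl; congr (_ * _).
    rewrite /ip (bigD1 i) //= (bigD1 i) //= !mxE !eqxx mulr1n mul1r.
    rewrite [X in _ + X + _]big1 => [|j /negPf ji]; last first.
      by rewrite !mxE [i == j]eq_sym ji mulr0n mul0r.
    rewrite [X in _ + X]big1 ?addr0 // => k /negPf ki; apply: big1 => j _.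
    by rewrite !mxE ki /= mul0rn mul0r.
  rewrite s1 in h1; rewrite s2 in h2.
  by rewrite /g -/B; lra.
have gc : {for 0, continuous g}.
  have Sg : Sm 0 (setT : set R) g.
    apply: Sm_add; [exact: openT| |exact: Sm_cst].
    apply: Sm_coord; first exact: openT.
    apply: Sm_expm_comp; first exact: openT.
    apply: Sm_add; [exact: openT|exact: Sm_cst|].
    by apply: Sm_scale; [exact: openT|exact: Sm_id|exact: Sm_cst].
  exact: (Sg 0 I).
have g0 : g 0 = 0.
  apply/eqP; rewrite -normr_eq0; apply/negPn/negP => gn0.
  have e0 : 0 < `|g 0| by rewrite lt_neqAle eq_sym gn0 normr_ge0.
  move/cvgrPdist_lt: gc => /(_ _ e0) /nbhs_ballP[r /= r0 rP].
  have near0 t : `|t| < r -> `|g 0 - g t| < `|g 0|.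
    by move=> tr; apply: rP; rewrite /ball /= sub0r normrN.
  have r2 : 0 < r / 2 by rewrite divr_gt0.
  have rr : r / 2 < r by rewrite ltr_pdivrMr // ltr_pMr // ltr1n.
  have h1 := near0 (r / 2); have h2 := near0 (- (r / 2)).
  rewrite gtr0_norm // in h1; rewrite normrN gtr0_norm // in h2.
  exact: (opposite_signs r2 (h1 rr) (h2 rr) (tg _) (tg _)).
by have := g0; rewrite /g scale0r addr0 => /eqP; rewrite subr_eq0 => /eqP.
Qed.

End Existence.

Lemma DcorP n (S : 'M[R]_n) : Hol S ->
  is_diag_mx (Dcor S) /\ Cor (expm (S + Dcor S)).
Proof.
move=> HS; have [D hD] := Dcor_exists HS.
exact: (@xgetPex _ 0 [set D | is_diag_mx D /\ Cor (expm (S + D))] (ex_intro _ D hD)).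
Qed.

Lemma Sym_Dcor n (S : 'M[R]_n) : Hol S -> Sym (S + Dcor S).
Proof. by move=> HS; apply: SymD; [exact: HS.1|exact: Sym_is_diag (DcorP HS).1]. Qed.

Lemma ip_diag n (A D : 'M[R]_n) : is_diag_mx D -> (forall i, A i i = 0) -> ip A D = 0.
Proof.
move=> /is_diag_mxP dD A0; apply: big1 => i _; apply: big1 => j _.
by case: (eqVneq i j) => [->|ij]; rewrite ?A0 ?mul0r // dD ?mulr0.
Qed.

(** Only diagonals matter when pairing with a diagonal D, so Y may be exchanged for any X with the
    same diagonal. *)
Lemma ip_diag_sub n (X Y Z D : 'M[R]_n) : is_diag_mx D ->
  (forall i, X i i = Y i i) -> ip (Y - Z) D = ip (dg (X - Z)) D.
Proof.
move=> dD XY; apply/eqP; rewrite -subr_eq0 -ipBl; apply/eqP; apply: ip_diag => // i.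
have sub_ii (A B : 'M[R]_n) : (A - B) i i = A i i - B i i by rewrite !mxE.
by rewrite sub_ii dgE eqxx mulr1n !sub_ii XY subrr.
Qed.

Lemma is_diagB n (D E : 'M[R]_n) : is_diag_mx D -> is_diag_mx E -> is_diag_mx (D - E).
Proof.
move=> /diag_mxP[d ->] /diag_mxP[e ->]; apply/diag_mxP; exists (d - e).
by rewrite linearB.
Qed.

(** The exponentials of two solutions have the same unit diagonal, so their difference is orthogonal
    to the diagonal difference of the exponents. *)
Lemma Dcor_unique n (S D : 'M[R]_n) : Hol S ->
  is_diag_mx D -> Cor (expm (S + D)) -> Dcor S = D.
Proof.
move=> HS dD cD; have [dE cE] := DcorP HS.
apply: (addrI S); apply: expm_inj_ip; first exact: Sym_Dcor.
  by apply: SymD; [exact: HS.1|exact: Sym_is_diag].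
rewrite opprD addrACA subrr add0r; apply: ip_diag; first exact: is_diagB.
by move=> i; rewrite mxE [X in _ + X]mxE cD.2 cE.2 subrr.
Qed.

Definition ExpOL n (S : 'M[R]_n) : 'M[R]_n := expm (S + Dcor S).

Lemma Cor_ExpOL n (S : 'M[R]_n) : Hol S -> Cor (ExpOL S).
Proof. by move=> HS; exact: (DcorP HS).2. Qed.

Lemma Hol_Log n (C : 'M[R]_n) : Cor C -> Hol (Log C).
Proof.
move=> cC; split; first exact/Sym_off/Sym_logm/cC.1.
by move=> i; rewrite !mxE eqxx.
Qed.

Lemma ExpOLK n (S : 'M[R]_n) : Hol S -> Log (ExpOL S) = S.
Proof.
move=> HS; rewrite /Log /ExpOL expmK; last exact: Sym_Dcor.
by rewrite linearD /= (off_diag (DcorP HS).1) addr0 off_hollow // => i; exact: HS.2.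
Qed.

(** The diagonal part of [logm C] solves the problem that defines [Dcor (Log C)], hence equals it by
    uniqueness. *)
Lemma LogK n (C : 'M[R]_n) : Cor C -> ExpOL (Log C) = C.
Proof.
move=> cC; rewrite /ExpOL.
have E : Log C + dg (logm C) = logm C by rewrite /dg /Log addrC subrK.
have -> : Dcor (Log C) = dg (logm C).
  apply: Dcor_unique; [exact: Hol_Log|exact: dg_is_diag|].
  by rewrite E logmK //; exact: cC.1.
by rewrite E logmK //; exact: cC.1.
Qed.

(** Write D(B) for [Dcor (hol B)]. The exponents hol B + D(B) and hol B + D(A) differ by a diagonal
    matrix, so coercivity involves only the diagonals of their exponentials. As exp (hol B + D(B))
    has the same diagonal as exp (hol A + D(A)), it can be exchanged for the latter; what remains
    contains no D(B) and tends to 0. *)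
Lemma Dcor_continuous n (A : 'M[R]_n) :
  {for A, continuous (fun B => Dcor (hol B))}.
Proof.
have HA := Hol_hol A; have [dA cA] := DcorP HA; have SA := Sym_Dcor HA.
suff : (fun B => Dcor (hol B)) @ A --> Dcor (hol A) by [].
have FA : Filter (nbhs A) := nbhs_filter A.
pose r := nrm (hol A + Dcor (hol A)) + 1.
have m0 := expR_gt0 (- (r + 1)); set m := expR _ in m0.
apply/cvgrPdist_le => e e0.
have [e1 [e10 e1e e11]] : exists e1, [/\ 0 < e1, e1 <= e & e1 < 1].
  have h2 : (2^-1 : R) < 1 by rewrite invf_lt1 // ltr1n.
  exists (Num.min e 2^-1); split; first by rewrite lt_min e0 invr_gt0 ltr0n.
    by rewrite ge_min lexx.
  by rewrite gt_min h2 orbT.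
have [q qE] : exists q, forall B,
    q B = expm (hol A + Dcor (hol A)) - expm (hol B + Dcor (hol A)).
  by eexists => B; reflexivity.
have Sq : Sm 0 setT (fun B => nrm (dg (q B))).
  move=> B _; apply: continuous_comp; last exact: nrm_continuous.
  suff : Sm 0 setT (fun B => dg (q B)) by apply.
  apply: (@Sm_mxlin_comp _ _ _ _ _ _ _ q (@dg R n)); first exact: openT.
  have -> : q = fun B => expm (hol A + Dcor (hol A)) +
      (\- idfun : {linear _ -> _}) (expm (hol B + Dcor (hol A))).
    by apply/funext => X; rewrite qE.
  apply: Sm_add; [exact: openT|exact: Sm_cst|].
  apply: (@Sm_mxlin_comp _ _ _ _ _ _ _ (fun B => expm (hol B + Dcor (hol A)))); first exact: openT.
  apply: Sm_expm_comp; first exact: openT.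
  by apply: Sm_add; [exact: openT|exact: Sm_mxlin|exact: Sm_cst].
have n1 : \forall B \near A, nrm (dg (q B)) <= m * e1.
  have cq : (fun B => nrm (dg (q B))) @ A --> (0 : R).
    have qA : nrm (dg (q A)) = 0.
      have -> : q A = 0 by rewrite qE subrr.
      by rewrite linear0 nrm0.
    by rewrite -qA; exact: (Sq A I).
  have me1 : 0 < m * e1 by exact: mulr_gt0.
  have /cvgrPdist_le /(_ _ me1) := cq; apply: filterS => B.
  by rewrite sub0r normrN ger0_norm ?nrm_ge0.
have n2 : \forall B \near A, nrm (hol B + Dcor (hol A)) <= r.
  have S2 : Sm 0 setT (fun B => hol B + Dcor (hol A)).
    by apply: Sm_add; [exact: openT|exact: Sm_mxlin|exact: Sm_cst].
  have c2 : (fun B => nrm (hol B + Dcor (hol A))) @ A --> nrm (hol A + Dcor (hol A)).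
    apply: (@continuous_comp _ _ _ (fun B => hol B + Dcor (hol A)) (@nrm R n n)).
      exact: (S2 A I).
    exact: nrm_continuous.
  have /cvgrPdist_le /(_ _ ltr01) := c2; apply: filterS => B.
  by rewrite /r distrC ler_norml lerBlDl => /andP[_]; rewrite addrC.
apply: filterS2 n1 n2 => B qB rB.
have HB := Hol_hol B; have [dB cB] := DcorP HB.
have SB : Sym (hol B + Dcor (hol A)).
  by apply: SymD; [exact: HB.1|exact: Sym_is_diag].
pose D := Dcor (hol B) - Dcor (hol A).
have h := expm_coercive SB rB (Sym_Dcor HB).
have DE : hol B + Dcor (hol B) - (hol B + Dcor (hol A)) = D.
  by rewrite opprD addrACA subrr add0r.
rewrite DE in h.
have E : ip (expm (hol B + Dcor (hol B)) - expm (hol B + Dcor (hol A))) D =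
    ip (dg (q B)) D.
  have c12 i := etrans (cA.2 i) (esym (cB.2 i)).
  by rewrite qE; apply: ip_diag_sub c12; exact: is_diagB.
rewrite E in h.
have D1 : m * Num.min 1 (nrm D) <= nrm (dg (q B)).
  have [D0|D0] := eqVneq (nrm D) 0.
    by rewrite D0 min_r // mulr0 nrm_ge0.
  have Dp : 0 < nrm D by rewrite lt_neqAle eq_sym D0 nrm_ge0.
  by rewrite -(ler_pM2r Dp); apply: le_trans h _; exact: CauchySchwarz.
have := le_trans D1 qB; rewrite ler_pM2l // ge_min leNgt e11 /= => De.
rewrite distrC; apply: le_trans (mx_norm_nrm _) _; exact: le_trans De e1e.
Qed.

Let off_off n (A : 'M[R]_n) : off (off A) = off A.
Proof. by apply: off_hollow => i; rewrite !mxE eqxx. Qed.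

(* Maps S + Dcor S to 1 + S for hollow symmetric S. *)
Let G n (A : 'M[R]_n) : 'M[R]_n :=
  dg (expm (symp A)) + (hol A + (A - symp A)).

Let Glin n : {linear 'M[R]_n -> 'M[R]_n} := (@hol R n \+ (idfun \- @symp R n))%FUN.

Let Sm_G k n : Sm k setT (@G n).
Proof.
apply: Sm_add; [exact: openT| |exact: (@Sm_mxlin _ _ _ _ _ _ (Glin n))].
apply: (@Sm_mxlin_comp _ _ _ _ _ _ _ (fun A => expm (symp A)) (@dg R n)); first exact: openT.
by apply: Sm_expm_comp; [exact: openT|exact: Sm_mxlin].
Qed.

Let derive_G n (A V : 'M[R]_n) :
  'D_V (@G n) A = dg (dexpm (symp A) (symp V)) + (hol V + (V - symp V)).
Proof.
have dS := @linear_differentiable _ _ _ (@symp R n) A (@mx_linear_continuous _ _ _ _ _).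
have dE := @ex_diff _ _ _ _ _ _ _ (is_diff_expm (symp A)).
have cg := @mx_linear_continuous _ _ _ _ (@dg R n).
have dc : differentiable (@expm R n \o @symp R n) A by exact: differentiable_comp.
have dgd := linear_differentiable (expm (symp A)) cg.
have dgc : differentiable (@dg R n \o (@expm R n \o @symp R n)) A by exact: differentiable_comp.
have dl := linear_differentiable A (@mx_linear_continuous _ _ _ _ (Glin n)).
have e1 : 'D_V (@G n) A = 'D_V (@dg R n \o (@expm R n \o @symp R n)) A + 'D_V (Glin n) A.
  by apply: deriveD; exact: diff_derivable.
have e2 := derive_lin_comp V cg dc.
have e3 := derive_comp V dS dE.
have e4 := derive_lin A V (@mx_linear_continuous _ _ _ _ (@symp R n)).
have e5 := derive_lin A V (@mx_linear_continuous _ _ _ _ (Glin n)).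
rewrite e1 e2 e3 e4 e5; congr (dg _ + _); exact: derive_expm.
Qed.

(** Not D(S) but the full exponent S + D(S) is obtained as an inverse: it solves G X = 1 + S, by the
    unit diagonal of exp X. *)
Lemma Sm_Dcor k n : Sm k setT (fun A : 'M[R]_n => hol A + Dcor (hol A)).
Proof.
apply: (@Sm_inverse _ _ n n setT (@G n) (fun A => 1%:M + hol A)).
- exact: openT.
- by move=> j; exact: Sm_G.
- by move=> j; apply: Sm_add; [exact: openT|exact: Sm_cst|exact: Sm_mxlin].
- move=> A _; have S1 : Sm 0 setT (@hol R n) by exact: Sm_mxlin.
  have S2 : Sm 0 setT (fun B : 'M[R]_n => Dcor (hol B)).
    by move=> B _; exact: Dcor_continuous.
  by have := Sm_add openT S1 S2; apply.
- move=> A _; have HA := Hol_hol A; have SA := Sym_Dcor HA; have [dA cA] := DcorP HA.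
  have hX : hol (hol A + Dcor (hol A)) = hol A.
    rewrite /hol (symp_id SA) linearD /= (off_diag dA) addr0; exact: off_off.
  rewrite /G (symp_id SA) subrr addr0 hX; congr (_ + _).
  by apply/matrixP => i j; rewrite dgE !mxE cA.2.
- move=> A V _; have HA := Hol_hol A; have SA := Sym_Dcor HA.
  rewrite derive_G symp_id // addrA.
  (* The vanishing derivative splits into a symmetric part B and an antisymmetric part. Hence V is
     symmetric and diagonal, and the derivative of exp along V has zero diagonal, so it is
     orthogonal to V. *)
  set B := dg _ + _ => h.
  have SB : Sym B.
    by apply: SymD; [exact/Sym_is_diag/dg_is_diag|exact: (Hol_hol V).1].
  have B0 : B = 0.
    have := congr1 (@symp R n) h; rewrite linear0 linearD /= linearB /=.
    by rewrite (symp_id (Sym_symp V)) subrr addr0 symp_id.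
  have VS : V = symp V by move: h; rewrite B0 add0r => /eqP; rewrite subr_eq0 => /eqP.
  have off0 : off (symp V) = 0.
    have := congr1 (@off R n) B0; rewrite linear0 linearD /=.
    by rewrite (off_diag (dg_is_diag _)) add0r /hol /= off_off.
  rewrite VS; apply: (dexpm_gt0 SA (Sym_symp V)); apply: ip_diag.
    apply/is_diag_mxP => i j ij; have := congr1 (fun M : 'M[R]_n => M i j) off0.
    by rewrite /off mxE [in RHS]mxE -val_eqE (negPf ij).
  move=> i; have := congr1 (fun M : 'M[R]_n => M i i) B0.
  rewrite /B /hol /= off0 addr0 dgE eqxx mulr1n => ->; exact: mxE.
Qed.

End CorrelationScaling.

(** * Flat charts *)

Section CurveCalculus.
Context {R : realType}.
Implicit Types V W : normedModType R.

Lemma differentiable_coords m n V (f : V -> 'M[R]_(m, n)) x i j :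
  differentiable f x -> differentiable (fun y => f y i j) x.
Proof.
move=> df; apply: (@differentiable_comp _ V _ _ f (coord i j)) => //.
exact: differentiable_coord.
Qed.

Lemma derive_coords m n V (f : V -> 'M[R]_(m, n)) x v i j :
  differentiable f x -> 'D_v (fun y => f y i j) x = 'D_v f x i j.
Proof.
move=> df; have cc : continuous (coord i j : 'M[R]_(m, n) -> R^o) by exact: coord_continuous.
exact: (derive_lin_comp v cc df).
Qed.

Lemma is_derive_bigsum V W (I : Type) (s : seq I) (f : I -> V -> W) (df : I -> W) x v :
  (forall i, is_derive x v (f i) (df i)) ->
  is_derive x v (fun y => \sum_(i <- s) f i y) (\sum_(i <- s) df i).
Proof.
move=> h; elim: s => [|i s IH].
  rewrite big_nil (_ : (fun y => _) = cst 0); first exact: is_derive_cst.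
  by apply/funext => y; rewrite big_nil.
rewrite big_cons (_ : (fun y => _) = f i + (fun y => \sum_(i <- s) f i y)).
  exact: is_deriveD.
by apply/funext => y; rewrite big_cons.
Qed.

Lemma is_derive_scale V W (r : V -> R) (g : V -> W) x v :
  differentiable r x -> differentiable g x ->
  is_derive x v (fun y => r y *: g y) (r x *: 'D_v g x + 'D_v r x *: g x).
Proof.
move=> dr dg; have [d e] := is_diff_scale dr dg.
apply: DeriveDef; first exact: diff_derivable.
by rewrite [LHS]deriveE // e !deriveE.
Qed.

Lemma is_derive_ip V m n (f g : V -> 'M[R]_(m, n)) x v :
  differentiable f x -> differentiable g x ->
  is_derive x v (fun y => ip (f y) (g y) : R)
    (ip (f x) ('D_v g x) + ip ('D_v f x) (g x)).
Proof.
move=> df dg.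
have -> : ip (f x) ('D_v g x) + ip ('D_v f x) (g x) =
    \sum_i \sum_j (f x i j * 'D_v g x i j + 'D_v f x i j * g x i j).
  by rewrite /ip -big_split; apply: eq_bigr => i _; rewrite -big_split.
apply: is_derive_bigsum => i; apply: is_derive_bigsum => j.
have := is_derive_scale v (differentiable_coords i j df) (differentiable_coords i j dg).
by rewrite !derive_coords.
Qed.

(** Second-order chain rule with moving base point f and moving direction a; for a curve and its
    velocity it produces the acceleration in a chart. *)
Lemma is_derive_moving V W m n (f a : V -> 'M[R]_(m, n)) (g : 'M[R]_(m, n) -> W)
    (U : set 'M[R]_(m, n)) (O : set V) x v :
  open O -> O x -> open U -> (forall y, O y -> U (f y)) ->
  differentiable f x -> differentiable a x -> Sm 2 U g ->
  is_derive x v (fun y => 'D_(a y) g (f y))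
    ('D_('D_v f x) ('D_(a x) g) (f x) + 'D_('D_v a x) g (f x)).
Proof.
move=> oO Ox oU fU df da Sg.
have dg z : U z -> differentiable g z by move=> Uz; exact: (Sm_differentiable Sg Uz).
have Dg u : Sm 1 U ('D_u g) := Sg.2 u.
have dDg u : differentiable ('D_u g) (f x) := Sm_differentiable (Dg u) (fU x Ox).
have nS : \near x, \sum_i \sum_j a x i j *: 'D_(delta_mx i j) g (f x) = 'D_(a x) g (f x).
  have := open_nbhs_nbhs (conj oO Ox); apply: filterS => y Oy.
  by rewrite -derive_sum_delta //; exact/dg/fU.
apply: (near_eq_is_derive nS).
have E1 : 'D_('D_v f x) ('D_(a x) g) (f x) =
    \sum_i \sum_j a x i j *: 'D_('D_v f x) ('D_(delta_mx i j) g) (f x).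
  have nE : \forall z \near f x,
      'D_(a x) g z = \sum_i \sum_j a x i j *: 'D_(delta_mx i j) g z.
    have := open_nbhs_nbhs (conj oU (fU x Ox)); apply: filterS => z Uz.
    by apply: derive_sum_delta; exact: dg.
  apply: etrans (near_eq_derive _ nE) _.
  suff [] : is_derive (f x) ('D_v f x) (fun z => \sum_i \sum_j a x i j *: 'D_(delta_mx i j) g z)
      (\sum_i \sum_j a x i j *: 'D_('D_v f x) ('D_(delta_mx i j) g) (f x)) by [].
  apply: is_derive_bigsum => i; apply: is_derive_bigsum => j.
  exact: (is_deriveZ _ (DeriveDef (diff_derivable (dDg _)) erefl)).
have E2 : 'D_('D_v a x) g (f x) =
    \sum_i \sum_j ('D_v a x) i j *: 'D_(delta_mx i j) g (f x).
  by apply: derive_sum_delta; exact/dg/fU.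
have -> : 'D_('D_v f x) ('D_(a x) g) (f x) + 'D_('D_v a x) g (f x) =
    \sum_i \sum_j (a x i j *: 'D_('D_v f x) ('D_(delta_mx i j) g) (f x) +
       ('D_v a x) i j *: 'D_(delta_mx i j) g (f x)).
  by rewrite E1 E2 -big_split; apply: eq_bigr => i _; rewrite -big_split.
apply: is_derive_bigsum => i; apply: is_derive_bigsum => j.
have da' := differentiable_coords i j da.
have dDf : differentiable ('D_(delta_mx i j) g \o f) x by exact: differentiable_comp.
have := is_derive_scale v da' dDf.
have -> : 'D_v (fun y => a y i j) x = ('D_v a x) i j by exact: derive_coords.
by have -> : 'D_v ('D_(delta_mx i j) g \o f) x =
  'D_('D_v f x) ('D_(delta_mx i j) g) (f x) by exact: derive_comp.
Qed.

(** In one variable derivability and Fréchet differentiability coincide, so for curves on an open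
    parameter set the two notions of smoothness do as well. *)
Lemma Cn_on_Sm m n k (I : set R) (c : R -> 'M[R]_(m, n)) : open I ->
  Cn_on (V := R^o) k I setT c -> Sm k I c.
Proof.
move=> oI; elim: k c => [|k IH] c /=.
  move=> [+ _] x Ix; rewrite continuous_open_subspace // => h.
  by apply: h; rewrite inE.
move=> [_ h]; split=> [x Ix|v]; last exact/IH/(h v Logic.I).2.
by apply/derivable1_diffP; have [d _] := h 1 Logic.I; exact: d.
Qed.

Lemma Sm_Cn_on_curve m n k (I : set R) (c : R -> 'M[R]_(m, n)) : open I ->
  Sm k I c -> Cn_on (V := R^o) k I setT c.
Proof.
move=> oI Sc; apply: (@Sm_Cn_on _ R^o _ k I setT I c c) => // x v Ix _.
have c0 : (fun h : R => h *: (v : R^o) + x) @ (0 : R) --> (0 : R) *: (v : R^o) + x.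
  by apply: cvgD; [apply: cvgZr_tmp; exact: cvg_id|exact: cvg_cst].
apply: c0; rewrite scale0r add0r; exact: open_nbhs_nbhs.
Qed.

End CurveCalculus.

(* A global chart onto the linear space T itself: [proj] is a linear projection
   onto T, and M lies in the affine space [base + T].  The maps extended along
   [proj] live on open subsets of the whole matrix space, where Frechet
   derivatives are available. *)
Record flat_chart (R : realType) n (M T : set 'M[R]_n) (phi e : 'M[R]_n -> 'M[R]_n) := FlatChart {
  proj : {linear 'M[R]_n -> 'M[R]_n};
  base : 'M[R]_n;
  projT : forall A, T (proj A);
  proj_id : forall A, T A -> proj A = A;
  proj_base : forall x, M x -> proj x + base = x;
  open_dom : open [set A | M (proj A + base)];
  Sm_phi : forall k, Sm k [set A | M (proj A + base)] (fun A => phi (proj A + base));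
  Sm_e : forall k, Sm k setT (e \o proj);
  chart_phi : forall x, M x -> T (phi x);
  chart_e : forall y, T y -> M (e y);
  chart_phiK : forall x, M x -> e (phi x) = x;
  chart_eK : forall y, T y -> phi (e y) = y;
  tangent_Sym : forall A, T A -> Sym A
}.

(** * Metric, Christoffel symbols and geodesics in a flat chart *)

Section FlatChart.
Context {R : realType} {n : nat}.
Variables (M T : set 'M[R]_n) (phi e : 'M[R]_n -> 'M[R]_n).
Variable F : flat_chart M T phi e.
Let pr := proj F.
Let U := [set A | M (proj F A + base F)].
Let G := Riemannian M T (pullback_metric phi).
Let openU : open U := @open_dom _ _ _ _ _ _ F.

Definition chart_ext (A : 'M[R]_n) : 'M[R]_n := phi (proj F A + base F).
Definition chart_inv_ext (A : 'M[R]_n) : 'M[R]_n := e (proj F A).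
Local Notation Phi := chart_ext.
Local Notation E := chart_inv_ext.

Lemma chart_extE x : M x -> Phi x = phi x.
Proof. by move=> Mx; rewrite /chart_ext proj_base. Qed.

Lemma chart_sub x : M x -> U x.
Proof. by move=> Mx; rewrite /U /= proj_base. Qed.

Lemma T0 : T 0. Proof. by rewrite -(linear0 pr); exact: projT. Qed.

Lemma T_lin a x y : T x -> T y -> T (a *: x + y).
Proof. by move=> Tx Ty; rewrite -(proj_id F Tx) -(proj_id F Ty) -linearP; exact: projT. Qed.

Lemma T_add x y : T x -> T y -> T (x + y).
Proof. by move=> Tx Ty; have := T_lin 1 Tx Ty; rewrite scale1r. Qed.

Lemma T_scale a x : T x -> T (a *: x).
Proof. by move=> Tx; have := T_lin a Tx T0; rewrite addr0. Qed.

Lemma T_sub x y : T x -> T y -> T (x - y).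
Proof. by move=> Tx Ty; rewrite -scaleN1r; apply: T_add => //; exact: T_scale. Qed.

Let cpr : continuous pr := @mx_linear_continuous _ _ _ _ pr.

(* T is closed, being the set of fixed points of proj. *)
Lemma derive_tangent (V : normedModType R) (f : V -> 'M[R]_n) x v b :
  differentiable f x -> (\forall y \near x, pr (f y) + b = f y) -> T ('D_v f x).
Proof.
move=> df nf; suff <- : pr ('D_v f x) = 'D_v f x by exact: projT.
have e1 := derive_lin_comp v cpr df.
have nf' : \forall y \near x, ((pr \o f) + cst b) y = f y by [].
have e2 := near_eq_derive v nf'.
have dp : derivable (pr \o f) x v.
  by apply: diff_derivable; apply: differentiable_comp => //; exact: linear_differentiable.
have e3 := deriveD dp (derivable_cst b x v).
rewrite derive_cst addr0 in e3.
exact: etrans (esym e1) (etrans (esym e3) e2).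
Qed.

Lemma chart_rel_open : rel_open M T.
Proof.
move=> x v Mx Tv.
have nU : \forall A \near x, U A.
  by have := open_nbhs_nbhs (conj openU (chart_sub Mx)).
have c0 : (fun h : R => h *: v + x) @ (0 : R) --> (0 : R) *: v + x.
  by apply: cvgD; [apply: cvgZr_tmp; exact: cvg_id|exact: cvg_cst].
rewrite scale0r add0r in c0.
have nM : \forall h \near (0 : R), U (h *: v + x) by exact: (c0 _ nU).
apply: filterS nM => h.
rewrite /U /= linearD linearZ /= (proj_id F Tv) -addrA.
by have -> := proj_base F Mx.
Qed.

Lemma chart_derive x v : M x -> T v -> 'D_v phi x = 'D_v Phi x.
Proof.
move=> Mx Tv; apply: (line_derive _ _).2; first by rewrite chart_extE.
by apply: filterS (chart_rel_open Mx Tv) => h Mh; rewrite chart_extE.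
Qed.

Lemma chart_ext_diff x : U x -> differentiable Phi x.
Proof. by move=> Ux; exact: (Sm_differentiable (Sm_phi F 1)). Qed.

Lemma chart_ext_tangent x v : U x -> T ('D_v Phi x).
Proof.
move=> Ux; apply: (@derive_tangent _ _ _ _ 0); first exact: chart_ext_diff.
have := open_nbhs_nbhs (conj openU Ux); apply: filterS => y Uy.
by rewrite addr0; apply: (proj_id F); exact: (chart_phi F (x := proj F y + base F) Uy).
Qed.

Lemma chart_metric x v w : M x -> T v -> T w ->
  metric G x v w = ip ('D_v Phi x) ('D_w Phi x).
Proof.
move=> Mx Tv Tw; rewrite /= /pullback_metric frobeniusE ?chart_derive //.
by apply: (tangent_Sym F); apply: chart_ext_tangent; exact: chart_sub.
Qed.

Lemma chart_inv_diff y : differentiable E y.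
Proof. exact: (Sm_differentiable (Sm_e F 1)). Qed.

Lemma chart_inv_M y : M (E y).
Proof. by apply: (chart_e F); exact: projT. Qed.

Lemma chart_invK x : M x -> E (Phi x) = x.
Proof.
move=> Mx; rewrite chart_extE // /chart_inv_ext (proj_id F (chart_phi F Mx)).
exact: (chart_phiK F Mx).
Qed.

Lemma chart_extK y : Phi (E y) = pr y.
Proof.
rewrite chart_extE; last exact: chart_inv_M.
by apply: (chart_eK F); exact: projT.
Qed.

Lemma chart_inv_derive x v : M x -> T v -> 'D_('D_v Phi x) E (Phi x) = v.
Proof.
move=> Mx Tv; have dP := chart_ext_diff (chart_sub Mx).
rewrite -(derive_comp v dP (chart_inv_diff _)).
have -> : 'D_v (E \o Phi) x = 'D_v id x.
  apply: (line_derive _ _).2; first by rewrite /= chart_invK.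
  by apply: filterS (chart_rel_open Mx Tv) => h Mh; rewrite /= chart_invK.
exact: derive_id.
Qed.

Lemma chart_ext_derive y w : 'D_('D_w E y) Phi (E y) = pr w.
Proof.
have dP := chart_ext_diff (chart_sub (chart_inv_M y)).
rewrite -(derive_comp w (chart_inv_diff y) dP).
have -> : Phi \o E = pr by apply/funext => z; exact: chart_extK.
exact: derive_lin.
Qed.

Lemma chart_inv_tangent y w : T ('D_w E y).
Proof.
apply: (@derive_tangent _ _ _ _ (base F)); first exact: chart_inv_diff.
by apply: filterE => z; apply: proj_base; exact: chart_inv_M.
Qed.

Lemma chart_derive_metric x u v w : M x -> T u -> T v -> T w ->
  'D_u (fun y => metric G y v w : R^o) x =
  ip ('D_v Phi x) ('D_u ('D_w Phi) x) + ip ('D_u ('D_v Phi) x) ('D_w Phi x).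
Proof.
move=> Mx Tu Tv Tw.
have Sv a : Sm 1 U ('D_a Phi) := (Sm_phi F 2).2 a.
have da a : differentiable ('D_a Phi) x := Sm_differentiable (Sv a) (chart_sub Mx).
have [_ e1] := is_derive_ip u (da v) (da w).
apply: etrans _ e1; apply: (line_derive _ _).2; first exact: chart_metric.
by apply: filterS (chart_rel_open Mx Tu) => h Mh; exact: chart_metric.
Qed.

Let koszul (a c p q : R) : a = p + q -> c = p + p -> 2^-1 * (a + a - c) = q.
Proof. by move=> -> ->; field. Qed.

(** The metric is the Euclidean one pulled back by Phi, and in Koszul's formula the terms with
    ['D_u ('D_w Phi)] cancel because second derivatives commute. The geodesic equation contains only
    this case of two equal arguments. *)
Lemma chart_christoffel x u w : M x -> T u -> T w ->
  christoffel G x u u w = ip ('D_u ('D_u Phi) x) ('D_w Phi x).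
Proof.
move=> Mx Tu Tw.
have e1 := chart_derive_metric Mx Tu Tu Tw.
have e2 := chart_derive_metric Mx Tw Tu Tu.
have e3 : 'D_w ('D_u Phi) x = 'D_u ('D_w Phi) x.
  exact: (Schwarz w u openU (chart_sub Mx) (Sm_phi F 2)).
rewrite e3 [ip ('D_u ('D_w Phi) x) _]ipC in e2.
exact: (koszul e1 e2).
Qed.

Section Curve.
Variables (I : set R) (c : R -> 'M[R]_n).
Hypothesis openI : open I.
Hypothesis smc : forall k, Sm k I c.
Hypothesis cM : forall t, I t -> M (c t).

Let dc t : I t -> differentiable c t.
Proof. by move=> It; exact: (Sm_differentiable (smc 1) It). Qed.

Let c1E : derive1 c = 'D_1 c.
Proof. by apply/funext => t; exact: derive1E. Qed.

Let Sc1 k : Sm k I (derive1 c).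
Proof. by rewrite c1E; exact: (smc k.+1).2. Qed.

Let dc1 t : I t -> differentiable (derive1 c) t.
Proof. by move=> It; exact: (Sm_differentiable (Sc1 1) It). Qed.

Lemma curve_tangent1 t : I t -> T (derive1 c t).
Proof.
move=> It; rewrite derive1E; apply: (@derive_tangent _ _ _ _ (base F)); first exact: dc.
have := open_nbhs_nbhs (conj openI It); apply: filterS => s Is.
exact: (proj_base F (cM Is)).
Qed.

Lemma curve_tangent2 t : I t -> T (derive1n 2 c t).
Proof.
move=> It; rewrite derive1nS derive1n1 derive1E.
apply: (@derive_tangent _ _ _ _ 0); first exact: dc1.
have := open_nbhs_nbhs (conj openI It); apply: filterS => s Is.
by rewrite addr0; exact: (proj_id F (curve_tangent1 Is)).
Qed.

Lemma chart_curve1 t : I t -> derive1 (Phi \o c) t = 'D_(derive1 c t) Phi (c t).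
Proof.
move=> It; rewrite !derive1E.
exact: (derive_comp _ (dc It) (chart_ext_diff (chart_sub (cM It)))).
Qed.

Lemma chart_curve2 t : I t -> derive1n 2 (Phi \o c) t =
  'D_(derive1 c t) ('D_(derive1 c t) Phi) (c t) + 'D_(derive1n 2 c t) Phi (c t).
Proof.
move=> It; rewrite /derive1n /= [LHS]derive1E.
have n1 : \forall s \near t, derive1 (Phi \o c) s = 'D_(derive1 c s) Phi (c s).
  have := open_nbhs_nbhs (conj openI It); apply: filterS => s Is.
  exact: chart_curve1.
apply: etrans (near_eq_derive _ n1) _.
have IU s : I s -> U (c s) by move=> /cM /chart_sub.
have [_ e1] := is_derive_moving (1 : R) openI It openU IU (dc It) (dc1 It) (Sm_phi F 2).
by rewrite !derive1E; rewrite c1E in e1 *; exact: e1.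
Qed.

Lemma chart_acceleration t w : I t -> T w ->
  metric G (c t) (derive1n 2 c t) w + christoffel G (c t) (derive1 c t) (derive1 c t) w
  = ip (derive1n 2 (Phi \o c) t) ('D_w Phi (c t)).
Proof.
move=> It Tw; have Mt := cM It; have T1 := curve_tangent1 It; have T2 := curve_tangent2 It.
rewrite chart_metric // chart_christoffel // -ipDl addrC.
by rewrite chart_curve2.
Qed.

Lemma chart_curve2_tangent t : I t -> T (derive1n 2 (Phi \o c) t).
Proof.
move=> It; rewrite chart_curve2 //; apply: T_add.
  apply: (@derive_tangent _ _ _ _ 0).
    have S1 : Sm 1 U ('D_(derive1 c t) Phi) := (Sm_phi F 2).2 _.
    exact: (Sm_differentiable S1 (chart_sub (cM It))).
  have := open_nbhs_nbhs (conj openU (chart_sub (cM It))).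
  apply: filterS => y Uy; rewrite addr0; exact: (proj_id F (chart_ext_tangent _ Uy)).
exact/chart_ext_tangent/chart_sub/cM.
Qed.

(** By [chart_acceleration] the equation says that (Phi o c)'' is orthogonal to all ['D_w Phi];
    these fill [T], to which (Phi o c)'' belongs. *)
Lemma geodesic_equation :
  (forall t w, I t -> T w ->
    metric G (c t) (derive1n 2 c t) w
      + christoffel G (c t) (derive1 c t) (derive1 c t) w = 0) <->
  (forall t, I t -> derive1n 2 (Phi \o c) t = 0).
Proof.
split=> [h t It|h t w It Tw]; last first.
  apply: etrans (chart_acceleration It Tw) _.
  by apply: etrans (congr1 (fun z => ip z _) (h t It)) _; exact: ip0l.
have Tz := chart_curve2_tangent It; have Mt := cM It.
(* The test vector w is the image of z = (Phi o c)'' under the derivative of the inverse chart, so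
   that ['D_w Phi] is z itself and the equation reads <z, z> = 0. *)
have e1 := chart_ext_derive (Phi (c t)) (derive1n 2 (Phi \o c) t).
rewrite (chart_invK Mt) in e1.
have Tw := chart_inv_tangent (Phi (c t)) (derive1n 2 (Phi \o c) t).
have e2 := etrans (esym (chart_acceleration It Tw)) (h t _ It Tw).
apply: ip_eq0; apply: etrans e2; congr (ip _ _).
exact: esym (etrans e1 (proj_id F Tz)).
Qed.

End Curve.
End FlatChart.

(** * Maps that are linear isometries in flat charts *)

Section ChartEmbedding.
Context {R : realType} {n p : nat}.
Variables (M T : set 'M[R]_n) (phi e : 'M[R]_n -> 'M[R]_n).
Variables (M' T' : set 'M[R]_p) (phi' e' : 'M[R]_p -> 'M[R]_p).
Variables (F : flat_chart M T phi e) (F' : flat_chart M' T' phi' e').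
Variables (Psi : {linear 'M[R]_n -> 'M[R]_p}) (Psi' : {linear 'M[R]_p -> 'M[R]_n}).
Variable f : 'M[R]_n -> 'M[R]_p.
Hypothesis PsiT : forall A, T A -> T' (Psi A).
Hypothesis Psi_ip : forall A B, T A -> T B -> ip (Psi A) (Psi B) = ip A B.
Hypothesis PsiK : forall A, T A -> Psi' (Psi A) = A.
Hypothesis fE : forall x, M x -> f x = e' (Psi (phi x)).

Let G := Riemannian M T (pullback_metric phi).
Let H := Riemannian M' T' (pullback_metric phi').
Let U := [set A | M (proj F A + base F)].
Let openU : open U := @open_dom _ _ _ _ _ _ F.

Let fext (x : 'M[R]_n) : 'M[R]_p := chart_inv_ext F' (Psi (chart_ext F x)).

Let fextE x : M x -> fext x = f x.
Proof.
move=> Mx; rewrite fE // /fext chart_extE // /chart_inv_ext.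
by rewrite (proj_id F' (PsiT (chart_phi F Mx))).
Qed.

Let Sm_fext k : Sm k U fext.
Proof.
have S1 : Sm k U (fun x => Psi (chart_ext F x)).
  exact: (Sm_mxlin_comp Psi openU (Sm_phi F k)).
exact: (Sm_comp openU (fun _ _ => I) S1 (Sm_e F' k)).
Qed.

Let f_points x : M x -> M' (f x).
Proof. by move=> Mx; rewrite -fextE //; exact: (chart_inv_M F' (Psi (chart_ext F x))). Qed.

Let fext_diff x : U x -> differentiable fext x.
Proof. by move=> Ux; exact: (Sm_differentiable (Sm_fext 1) Ux). Qed.

Let f_derive x v : M x -> T v -> 'D_v f x = 'D_v fext x.
Proof.
move=> Mx Tv; apply: (line_derive _ _).2; first by rewrite fextE.
by apply: filterS (chart_rel_open F Mx Tv) => h Mh; rewrite fextE.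
Qed.

Let f_tangent x v : U x -> T' ('D_v fext x).
Proof.
move=> Ux; apply: (@derive_tangent _ _ _ _ _ _ F' _ _ _ _ (base F')); first exact: fext_diff.
by apply: filterE => y; apply: (proj_base F'); exact: (chart_inv_M F' (Psi (chart_ext F y))).
Qed.

Let PsiD v x : M x -> Psi ('D_v (chart_ext F) x) = 'D_v (Psi \o chart_ext F) x.
Proof.
move=> Mx; have cP := @mx_linear_continuous _ _ _ _ Psi.
exact: (esym (derive_lin_comp v cP (chart_ext_diff (chart_sub F Mx)))).
Qed.

(** Phi' o fext = Psi o Phi holds on an open set of matrices, so both sides can be
    differentiated. *)
Let PhiPsi x v : M x -> 'D_('D_v fext x) (chart_ext F') (f x) = Psi ('D_v (chart_ext F) x).
Proof.
move=> Mx; have Ux := chart_sub F Mx.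
have d1 := fext_diff Ux.
have d2 : differentiable (chart_ext F') (fext x).
  exact: (chart_ext_diff (chart_sub F' (chart_inv_M F' (Psi (chart_ext F x))))).
rewrite -fextE //; apply: etrans (esym (derive_comp v d1 d2)) _.
apply: etrans (esym (PsiD v Mx)); apply: near_eq_derive.
have := open_nbhs_nbhs (conj openU Ux); apply: filterS => y Uy.
have E1 := chart_extK F' (Psi (chart_ext F y)).
apply: etrans E1 _; apply: (proj_id F'); apply: PsiT.
exact: (chart_phi F (x := proj F y + base F) Uy).
Qed.

Let f_isometric : isometric G H f.
Proof.
move=> x v w Mx Tv Tw; have Ux := chart_sub F Mx.
rewrite f_derive // f_derive //.
have m1 := chart_metric F' (f_points Mx) (f_tangent v Ux) (f_tangent w Ux).
apply: etrans m1 _; apply: etrans (esym (chart_metric F Mx Tv Tw)).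
apply: etrans (congr2 (@ip R p p) (PhiPsi v Mx) (PhiPsi w Mx)) _.
by apply: Psi_ip; exact: chart_ext_tangent.
Qed.

Let f_embedding : smooth_embedding G H f.
Proof.
split.
- exact: f_points.
- move=> k; apply: (@Sm_Cn_on _ _ _ k M T U f fext).
  + exact: (chart_rel_open F).
  + by move=> x; exact: (chart_sub F).
  + by move=> x Mx; rewrite fextE.
  + exact: Sm_fext.
- move=> x v Mx Tv; rewrite f_derive // => D0.
  have h := PhiPsi v Mx; rewrite D0 derive0 in h.
  have Tx := chart_ext_tangent v (chart_sub F Mx).
  have e0 : 'D_v (chart_ext F) x = 0.
    by rewrite -(PsiK Tx) -h linear0.
  have := chart_inv_derive F Mx Tv; rewrite e0 => <-; exact: derive0.
(* The continuous inverse on the image: coordinates, the left inverse Psi', then the inverse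
   chart. *)
- exists (fun y => chart_inv_ext F (Psi' (chart_ext F' y))).
    apply: continuous_in_subspaceT => y; rewrite inE => -[x Mx <-].
    have Uy := chart_sub F' (f_points Mx).
    have S1 := Sm_mxlin_comp Psi' (@open_dom _ _ _ _ _ _ F') (Sm_phi F' 0).
    have S2 := Sm_comp (@open_dom _ _ _ _ _ _ F') (fun _ _ => I) S1 (Sm_e F 0).
    exact: (S2 _ Uy).
  move=> x Mx; have Tx := chart_phi F Mx.
  rewrite -fextE // /fext chart_extK (proj_id F' (PsiT _)) chart_extE // PsiK //.
  by rewrite -[in RHS](chart_phiK F Mx) /chart_inv_ext (proj_id F Tx).
Qed.

(** The coordinates of f o c are Psi of those of c, so their second derivative is Psi applied to
    0. *)
Let f_totally_geodesic : totally_geodesic G H f.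
Proof.
move=> I c oI _ [sc cM geo].
have smc k : Sm k I c by apply: Cn_on_Sm => //; exact: sc.
have smfc k : Sm k I (fext \o c).
  by apply: (Sm_comp oI _ (smc k) (Sm_fext k)) => t It; exact: (chart_sub F (cM t It)).
have fcE t : I t -> f (c t) = fext (c t) by move=> It; rewrite fextE //; exact: cM.
have smfc' k : Sm k I (f \o c).
  by apply: Sm_eq (smfc k) => // t It /=; rewrite fcE.
have fcM t : I t -> M' ((f \o c) t) by move=> It; exact: (f_points (cM t It)).
split; first by move=> k; exact: Sm_Cn_on_curve.
  exact: fcM.
apply: ((geodesic_equation F' oI smfc' fcM).2) => t It.
have [/(_ geo) c0 _] := geodesic_equation F oI smc cM.
have E1 s : I s -> (chart_ext F' \o (f \o c)) s = (Psi \o (chart_ext F \o c)) s.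
  move=> Is /=; rewrite fcE // /fext chart_extK (proj_id F' (PsiT _)) //.
  by rewrite chart_extE; [exact: (chart_phi F (cM s Is))|exact: cM].
have near1 s : I s -> \near s, (chart_ext F' \o (f \o c)) s = (Psi \o (chart_ext F \o c)) s.
  by move=> Is; have := open_nbhs_nbhs (conj oI Is); apply: filterS => r /E1.
have cP := @mx_linear_continuous _ _ _ _ Psi.
have SPc k : Sm k I (chart_ext F \o c).
  by apply: (Sm_comp oI _ (smc k) (Sm_phi F k)) => s Is; exact: (chart_sub F (cM s Is)).
have D1 s : I s -> derive1 (chart_ext F' \o (f \o c)) s = Psi (derive1 (chart_ext F \o c) s).
  move=> Is; rewrite !derive1E; apply: etrans (near_eq_derive _ (near1 s Is)) _.
  exact: (derive_lin_comp _ cP (Sm_differentiable (SPc 1%N) Is)).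
have S1 : Sm 1 I (derive1 (chart_ext F \o c)).
  have -> : derive1 (chart_ext F \o c) = 'D_1 (chart_ext F \o c).
    by apply/funext => s; exact: derive1E.
  exact: ((SPc 2%N).2).
have near2 : \near t, derive1 (chart_ext F' \o (f \o c)) t = (Psi \o derive1 (chart_ext F \o c)) t.
  by have := open_nbhs_nbhs (conj oI It); apply: filterS => s /D1.
have D2 : derive1n 2 (chart_ext F' \o (f \o c)) t = Psi (derive1n 2 (chart_ext F \o c) t).
  rewrite /derive1n /= !derive1E; apply: etrans (near_eq_derive _ near2) _.
  exact: (derive_lin_comp _ cP (Sm_differentiable S1 It)).
by apply: etrans D2 _; apply: etrans (congr1 Psi (c0 t It)) _; exact: linear0.
Qed.

Theorem chart_embedding : totally_geodesic_isometric_embedding G H f.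
Proof. by split. Qed.

End ChartEmbedding.

(** * The geodesic distance in a flat chart *)

Section LengthLowerBound.
Context {R : realType}.
Local Notation mu := (@lebesgue_measure R).

(* For a curve c the roles are: g the speed, which C1_segment controls only in
   the open interval, h its continuous extension, and p = P' for the component P
   of c along a unit vector. *)
Lemma length_segment (g h p P : R -> R) (a b : R) : a < b ->
  {within `[a, b], continuous h} -> {within `[a, b], continuous p} ->
  {within `[a, b], continuous P} ->
  (forall t, a < t < b -> g t = h t) ->
  (forall t, p t <= h t) ->
  (forall t : R, a < t < b -> is_derive t 1 P (p t)) ->
  measurable_fun (`[a, b] : set R) g /\
  ((P b - P a)%:E <= \int[mu]_(t in `[a, b]) (g t)%:E)%E.
Proof.
move=> ab ch cp cP gh ph dP.
have mh : measurable_fun (`[a, b] : set R) h.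
  by apply: subspace_continuous_measurable_fun.
have mg : measurable_fun (`]a, b[ : set R) g.
  apply: (@eq_measurable_fun _ _ _ _ _ h); first by move=> t; rewrite inE /= in_itv /= => /gh.
  by apply: measurable_funS mh => //; exact: subset_itv_oo_cc.
split; first exact: measurable_fun_itv_cc mg.
have ih : mu.-integrable `[a, b] (EFin \o h).
  by apply: continuous_compact_integrable => //; exact: segment_compact.
have ip : mu.-integrable `[a, b] (EFin \o p).
  by apply: continuous_compact_integrable => //; exact: segment_compact.
have <- : (\int[mu]_(t in `[a, b]) (p t)%:E = (P b - P a)%:E)%E.
  rewrite EFinB; apply: continuous_FTC2 => //.
    have [_ Pa Pb] := (continuous_within_itvP _ ab).1 cP.
    split=> // t; rewrite in_itv /= => tab.
    by have [] := dP t tab.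
  by move=> t; rewrite in_itv /= => tab; rewrite derive1E; have [] := dP t tab.
(* The end points, where g and h may differ, form a null set. *)
have <- : (\int[mu]_(t in `[a, b]) (h t)%:E = \int[mu]_(t in `[a, b]) (g t)%:E)%E.
  have mho : measurable_fun (`]a, b[ : set R) h.
    by apply: measurable_funS mh => //; exact: subset_itv_oo_cc.
  have eh := @integral_itv_bndoo R a b (fun t => (h t)%:E) true false
    ((measurable_EFinP _ _).2 mho).
  have eg := @integral_itv_bndoo R a b (fun t => (g t)%:E) true false
    ((measurable_EFinP _ _).2 mg).
  apply: etrans eh _; apply: etrans (esym eg).
  by apply: eq_integral => t; rewrite inE /= in_itv /= => /gh ->.
by apply: le_integral => // t _; rewrite lee_fin.
Qed.

(** Telescoping over a subdivision. Measurability is carried along because additivity of the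
    integral requires it on the union. *)
Lemma length_path (g P : R -> R) (a : R) (s : seq R) : (forall t, 0 <= g t) ->
  path <%R a s ->
  (forall i, (i < size s)%N ->
    let x := nth a (a :: s) i in let y := nth a s i in
    measurable_fun (`[x, y] : set R) g /\
    ((P y - P x)%:E <= \int[mu]_(t in `[x, y]) (g t)%:E)%E) ->
  [/\ a <= last a s, measurable_fun (`[a, last a s] : set R) g &
    ((P (last a s) - P a)%:E <= \int[mu]_(t in `[a, last a s]) (g t)%:E)%E].
Proof.
move=> g0; elim: s a => [|b s IH] a /=.
  move=> _ _; split=> //; first by rewrite set_itv1; exact: measurable_fun_set1.
  by rewrite subrr; apply: integral_ge0 => t _; rewrite lee_fin.
move=> /andP[ab bs] h.
have hs i : (i < size s)%N ->
    let x := nth b (b :: s) i in let y := nth b s i in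
    measurable_fun (`[x, y] : set R) g /\
    ((P y - P x)%:E <= \int[mu]_(t in `[x, y]) (g t)%:E)%E.
  move=> si; rewrite /= (set_nth_default a b (s := s)) //.
  by rewrite (set_nth_default a b (s := b :: s)) ?ltnS ?(ltnW si) //; exact: (h i.+1 si).
have [bl ml il] := IH b bs hs.
have [mab iab] := h 0%N isT; rewrite /= in mab iab.
(* A half-open first piece makes the union disjoint; its integral equals that over the closed
   piece. *)
have E : `[a, last b s]%classic = `[a, b[ `|` `[b, last b s] :> set R.
  by apply: itv_bndbnd_setU; rewrite bnd_simp // ltW.
have mab' : measurable_fun (`[a, b[ : set R) g.
  by apply: measurable_funS mab => //; exact: subset_itv_co_cc.
have mU : measurable_fun (`[a, b[ `|` `[b, last b s] : set R) g.
  by apply/measurable_funU.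
split; [exact: le_trans (ltW ab) bl|by rewrite E|].
rewrite E ge0_integral_setU //; last 3 first.
- exact/measurable_EFinP.
- by move=> t _; rewrite lee_fin.
- apply/disj_setPLR => t /=; rewrite !in_itv /= => /andP[_ tb]; apply/negP.
  by rewrite negb_and -ltNge tb.
rewrite integral_itv_bndo_bndc; last exact/measurable_EFinP.
have -> : ((P (last b s) - P a)%:E = (P b - P a)%:E + (P (last b s) - P b)%:E)%E.
  by rewrite -EFinD; congr (_%:E); ring.
exact: leeD.
Qed.

End LengthLowerBound.

Section ChartDistance.
Context {R : realType} {n : nat}.
Variables (M T : set 'M[R]_n) (phi e : 'M[R]_n -> 'M[R]_n).
Variable F : flat_chart M T phi e.
Let G := Riemannian M T (pullback_metric phi).
Let U := [set A | M (proj F A + base F)].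
Let openU : open U := @open_dom _ _ _ _ _ _ F.
Local Notation Phi := (chart_ext F).
Local Notation E := (chart_inv_ext F).

Let cvg_bigsum (X I : Type) (Fl : set_system X) (FF : Filter Fl) (W : normedModType R)
    (s : seq I) (f : I -> X -> W) (a : I -> W) :
  (forall i, f i @ Fl --> a i) ->
  (fun x => \sum_(i <- s) f i x) @ Fl --> \sum_(i <- s) a i.
Proof.
move=> h; elim: s => [|i s IH].
  rewrite big_nil (_ : (fun x => _) = fun=> 0); first exact: cvg_cst.
  by apply/funext => x; rewrite big_nil.
rewrite big_cons (_ : (fun x => _) = fun x => f i x + \sum_(i <- s) f i x).
  by apply: cvgD.
by apply/funext => x; rewrite big_cons.
Qed.

(** Joint continuity of ['D_v Phi x] in the direction and the point, for velocities that are merely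
    continuous. *)
Let cvg_derive (X : Type) (Fl : set_system X) (FF : Filter Fl)
    (f v : X -> 'M[R]_n) (a w : 'M[R]_n) :
  f @ Fl --> a -> v @ Fl --> w -> U a -> (\forall x \near Fl, U (f x)) ->
  (fun x => 'D_(v x) Phi (f x)) @ Fl --> 'D_w Phi a.
Proof.
move=> fa vw Ua Uf.
rewrite (derive_sum_delta w (chart_ext_diff Ua)).
have near : \forall x \near Fl,
    \sum_i \sum_j v x i j *: 'D_(delta_mx i j) Phi (f x) = 'D_(v x) Phi (f x).
  by apply: filterS Uf => x Ux; rewrite -derive_sum_delta //; exact: chart_ext_diff.
apply: cvg_trans (near_eq_cvg near) _.
apply: cvg_bigsum => i; apply: cvg_bigsum => j; apply: cvgZ.
  exact: (@continuous_cvg _ _ _ Fl FF v (fun A : 'M[R]_n => A i j) w (@coord_continuous _ _ _ i j w) vw).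
have Sd : Sm 0 U ('D_(delta_mx i j) Phi) := (Sm_phi F 1).2 _.
exact: (@continuous_cvg _ _ _ Fl FF f ('D_(delta_mx i j) Phi) a (Sd a Ua) fa).
Qed.

Section Curve.
Variables (c : R -> 'M[R]_n) (u : 'M[R]_n).
Hypothesis cM : forall t, 0 <= t <= 1 -> M (c t).
Hypothesis u1 : nrm u = 1.

Let g t := Num.sqrt (metric G (c t) (derive1 c t) (derive1 c t)).
Let P t := ip (Phi (c t)) u.

Let segment (a b : R) : a < b -> 0 <= a -> b <= 1 ->
  {within `[a, b], continuous c} -> C1_segment c a b ->
  measurable_fun (`[a, b] : set R) g /\
  ((P b - P a)%:E <= \int[@lebesgue_measure R]_(t in `[a, b]) (g t)%:E)%E.
Proof.
move=> ab a0 b1 cc [dc cdc dcE].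
have inM t : a <= t <= b -> M (c t).
  by move=> /andP[t1 t2]; apply: cM; rewrite (le_trans a0 t1) (le_trans t2 b1).
(* The velocity of Phi o c, with the continuous extension [dc] in place of c', which is uncontrolled
   at the ends of the segment. *)
pose q t := 'D_(dc t) Phi (c t).
have cq (K : 'M[R]_n -> R) : continuous K -> {within `[a, b], continuous (K \o q)}.
  move=> cK; apply/subspace_continuousP => t tab.
  apply: (@continuous_cvg _ _ _ _ _ _ K); first exact: cK.
  apply: cvg_derive.
  - exact: ((subspace_continuousP _ _).1 cc).
  - exact: ((subspace_continuousP _ _).1 cdc).
  - by move: tab; rewrite /= in_itv /= => tab; exact: (chart_sub F (inM t tab)).
  - apply: filterS (withinT `[a, b]%classic (nbhs_filter t)) => s.
    by rewrite /= in_itv /= => sab; exact: (chart_sub F (inM s sab)).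
have oab (t : R) : a < t < b -> \forall s \near t, a < s < b.
  move=> tab; have : `]a, b[%classic t by rewrite /= in_itv.
  move=> ti; have := open_nbhs_nbhs (conj (@interval_open R (BRight a) (BLeft b) isT isT) ti).
  by apply: filterS => s; rewrite /= in_itv.
have diffc t : a < t < b -> differentiable c t.
  by move=> tab; apply/derivable1_diffP; have [d _] := dcE t tab.
have oc (t : R) : a < t < b -> a <= t <= b by move=> /andP[/ltW -> /ltW ->].
have dcE' t : a < t < b -> derive1 c t = dc t.
  by move=> tab; rewrite derive1E; have [_ ->] := dcE t tab.
have Tdc t : a < t < b -> T (dc t).
  move=> tab; rewrite -dcE' // derive1E.
  apply: (@derive_tangent _ _ _ _ _ _ F _ _ _ _ (base F)); first exact: diffc.
  by apply: filterS (oab t tab) => s sab; apply: (proj_base F); apply: inM; exact: oc.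
apply: (@length_segment _ g (@nrm R n n \o q) (fun t => ip (q t) u) P a b ab).
- by apply: cq; exact: nrm_continuous.
- apply: (cq (fun A => ip A u)) => A.
  exact: (Sm_ip openT (@Sm_id _ _ 0 setT) (@Sm_cst _ _ _ 0 setT u) A Logic.I).
- apply/subspace_continuousP => t tab.
  have Mt : M (c t) by apply: inM; move: tab; rewrite /= in_itv.
  apply: (@continuous_cvg _ _ _ _ _ _ (fun A => ip (Phi A) u)); last first.
    exact: ((subspace_continuousP _ _).1 cc).
  exact: (Sm_ip openU (Sm_phi F 0) (@Sm_cst _ _ _ 0 U u) _ (chart_sub F Mt)).
- move=> t tab; rewrite /g dcE' //.
  by rewrite (chart_metric F (inM t (oc t tab)) (Tdc t tab) (Tdc t tab)).
- by move=> t; apply: le_trans (CauchySchwarz _ _) _; rewrite u1 mulr1.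
- move=> t tab; have dct := diffc t tab.
  have dP := chart_ext_diff (chart_sub F (inM t (oc t tab))).
  have dPc : differentiable (Phi \o c) t by exact: differentiable_comp.
  have := is_derive_ip (1 : R) dPc (differentiable_cst u t).
  rewrite derive_cst ipC ip0l add0r.
  have e1 : derive1 (Phi \o c) t = 'D_(derive1 c t) Phi (c t).
    by rewrite !derive1E; exact: (derive_comp _ dct dP).
  have e2 : 'D_(1 : R) (Phi \o c) t = q t.
    exact: etrans (esym (derive1E _ t)) (etrans e1 (congr1 (fun v => 'D_v Phi (c t)) (dcE' t tab))).
  by move=> h; exact: (eq_ind _ (fun z => is_derive t 1 P (ip z u)) h _ e2).
Qed.

Lemma length_ge : piecewise_C1 c 0 1 ->
  ((P 1 - P 0)%:E <= curve_length G c 0 1)%E.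
Proof.
move=> [cc [s [ps ls hs]]].
have lp := @length_path _ g P 0 s (fun t => sqrtr_ge0 _) ps.
rewrite ls in lp.
have ss : sorted <%R (0 :: s) := ps.
have mono i j : (i <= j)%N -> (j <= size s)%N -> nth 0 (0%R :: s) i <= nth 0 (0%R :: s) j.
  rewrite leq_eqVlt => /orP[/eqP -> //|ij] js; apply/ltW.
  apply: (sorted_ltn_nth lt_trans 0 ss _ _ _ _ ij); rewrite inE /= ltnS //.
  exact: leq_trans (ltnW ij) js.
suff h k : (k < size s)%N -> let x := nth 0 (0%R :: s) k in let y := nth 0 s k in
    measurable_fun (`[x, y] : set R) g /\
    ((P y - P x)%:E <= \int[@lebesgue_measure R]_(t in `[x, y]) (g t)%:E)%E.
  by have [_ _] := lp h.
move=> sk x y.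
have xy : x < y by apply: (sorted_ltn_nth lt_trans 0 ss _ _ _ _ (ltnSn k)); rewrite inE /= ltnS ?(ltnW sk).
have x0 : 0 <= x by apply: (mono 0%N k) => //=; exact: ltnW.
have y1 : y <= 1.
  rewrite -ls (last_nth 0); apply: (mono k.+1 (size s)) => //=.
apply: segment => //; last exact: (hs k sk).
apply: continuous_subspaceW cc => t /=; rewrite !in_itv /= => /andP[t1 t2].
by rewrite (le_trans x0 t1) (le_trans t2 y1).
Qed.

End Curve.

(** Lower bound: the component of Phi o c along the unit vector of the displacement D grows by |D|.
    Upper bound: the segment between the coordinates stays in the linear space [T], and its preimage
    has constant speed |D|. *)
Lemma chart_dist x y : M x -> M y ->
  geodesic_dist G x y = (nrm (phi x - phi y))%:E.
Proof.
move=> Mx My; rewrite nrmBC.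
set D := phi y - phi x.
have TD : T D by apply: (T_sub F); exact: (chart_phi F).
apply/eqP; rewrite eq_le; apply/andP; split; last first.
  apply: le_ereal_inf_tmp => _ [c [pc cM c0 c1 ->]].
  (* D = 0 defines no direction; there it suffices that lengths are nonnegative. *)
  have [D0|D0] := eqVneq (nrm D) 0.
    by rewrite D0; apply: integral_ge0 => t _; rewrite lee_fin sqrtr_ge0.
  have u1 : nrm ((nrm D)^-1 *: D) = 1.
    by rewrite nrmZ ger0_norm ?invr_ge0 ?nrm_ge0 // mulVf.
  apply: le_trans (length_ge cM u1 pc); rewrite lee_fin c0 c1.
  rewrite -ipBl !ipZr !chart_extE // -/D -nrm_sqr expr2 mulKf //.
apply: ereal_inf_lbound.
pose l t : 'M[R]_n := phi x + t *: D.
pose c t := E (l t).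
have Tl t : T (l t) by apply: (T_add F); [exact: (chart_phi F)|exact: (T_scale F)].
have Sl k : Sm k setT l.
  apply: Sm_add; first exact: openT.
    exact: Sm_cst.
  by apply: (Sm_scale openT); [exact: Sm_id|exact: Sm_cst].
have Sc k : Sm k setT c by exact: (Sm_comp openT (fun _ _ => Logic.I) (Sl k) (Sm_e F k)).
have dl t : is_derive (t : R) (1 : R) l D.
  have := is_deriveD (is_derive_cst (phi x) t (1 : R))
    (is_derive_scale (1 : R) (Sm_differentiable (@Sm_id _ _ 1 setT) (I : setT t)) (differentiable_cst D t)).
  by rewrite derive_cst derive_id scaler0 scale1r !add0r.
have diffl t : differentiable l t by exact: (Sm_differentiable (Sl 1)).
have c'E t : derive1 c t = 'D_D E (l t).
  rewrite derive1E; apply: etrans (derive_comp _ (diffl t) (chart_inv_diff F _)) _.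
  by have [_ ->] := dl t.
exists c; split.
- split; first by apply: continuous_subspaceT => t; exact: (Sc 0%N).
  exists [:: 1]; split=> [||[|//] _]; first by rewrite /= ltr01.
    by [].
  exists (fun t => 'D_D E (l t)).
    apply: continuous_subspaceT => t.
    exact: (Sm_comp openT (fun _ _ => Logic.I) (Sl 0%N) ((Sm_e F 1).2 D) _ Logic.I).
  move=> t _; have dc : differentiable c t := Sm_differentiable (Sc 1%N) I.
  apply: DeriveDef; first exact: diff_derivable.
  by rewrite -derive1E c'E.
- by move=> t _; exact: chart_inv_M.
- by rewrite /c /l scale0r addr0 /chart_inv_ext (proj_id F (chart_phi F Mx)) (chart_phiK F Mx).
- by rewrite /c /l scale1r addrC subrK /chart_inv_ext (proj_id F (chart_phi F My)) (chart_phiK F My).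
have mE t : metric G (c t) (derive1 c t) (derive1 c t) = ip D D.
  rewrite c'E; apply: etrans (chart_metric F (chart_inv_M F _)
    (chart_inv_tangent F _ _) (chart_inv_tangent F _ _)) _.
  by rewrite chart_ext_derive (proj_id F TD).
rewrite /curve_length (eq_integral (fun=> (nrm D)%:E)); last by move=> t _; rewrite mE.
rewrite integral_cst //= lebesgue_measure_itv /= lte_fin ltr01.
by rewrite -EFinD subr0 mule1.
Qed.

End ChartDistance.

(** * The charts log and Log *)

Section Charts.
Context {R : realType}.

Let proj0 n (M : set 'M[R]_n) (pr : {linear 'M[R]_n -> 'M[R]_n}) :
  [set A | M (pr A + 0)] = [set A | M (pr A)].
Proof. by apply/seteqP; split => A /=; rewrite addr0. Qed.

Definition chart_LE n : flat_chart (@SPD R n) (@Sym R n) (@logm R n) (@expm R n).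
Proof.
apply: (@FlatChart _ _ _ _ _ _ (@symp R n : {linear 'M[R]_n -> 'M[R]_n}) 0).
- exact: Sym_symp.
- exact: symp_id.
- by move=> x [Sx _]; rewrite addr0; exact: symp_id.
- by rewrite proj0; exact: open_USPD.
- move=> k; rewrite proj0.
  apply: (Sm_eq (@open_USPD R n) _ (@Sm_logm R k n)) => A _.
  by rewrite addr0.
- by move=> k; apply: (Sm_comp openT (fun _ _ => I) _ (@Sm_expm R k n)); exact: Sm_mxlin.
- exact: Sym_logm.
- exact: SPD_expm.
- exact: logmK.
- exact: expmK.
- by [].
Defined.

Lemma Cor_hol n (A : 'M[R]_n) : Cor (hol A + 1%:M) <-> SPD (hol A + 1%:M).
Proof. by split=> [[]//|h]; split=> // i; rewrite !mxE eqxx add0r. Qed.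

Let Sym_hol1 n (A : 'M[R]_n) : Sym (hol A + 1%:M).
Proof. by apply: SymD; [exact: (Hol_hol A).1|apply/SymP; exact: trmx1]. Qed.

Let hol_Cor n (x : 'M[R]_n) : Cor x -> hol x + 1%:M = x.
Proof.
move=> [[Sx _] x1]; rewrite /hol symp_id //; apply/matrixP => i j; rewrite !mxE.
by case: eqP => [->|_]; rewrite ?x1 ?add0r ?addr0.
Qed.

Let Cor_holE n : [set A : 'M[R]_n | Cor (hol A + 1%:M)] = [set A | SPD (hol A + 1%:M)].
Proof. by apply/seteqP; split => A /= /Cor_hol. Qed.

Let open_Cor n : open [set A : 'M[R]_n | SPD (hol A + 1%:M)].
Proof. by apply: (@open_SPD _ _ (@hol R n)) => A; exact: Sym_hol1. Qed.

Lemma Sm_Log k n :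
  Sm k [set A : 'M[R]_n | SPD (hol A + 1%:M)] (fun A => Log (hol A + 1%:M)).
Proof.
have S1 : Sm k [set A : 'M[R]_n | SPD (hol A + 1%:M)] (fun A : 'M[R]_n => hol A + 1%:M).
  have Sh : Sm k [set A : 'M[R]_n | SPD (hol A + 1%:M)] (@hol R n) by exact: Sm_mxlin.
  exact: (Sm_add (@open_Cor n) Sh (@Sm_cst R _ _ k _ (1%:M : 'M[R]_n))).
have S2 : Sm k [set A : 'M[R]_n | SPD (hol A + 1%:M)]
    ((@logm R n \o @symp R n) \o (fun A : 'M[R]_n => hol A + 1%:M)).
  apply: (Sm_comp (@open_Cor n) _ S1 (@Sm_logm R k n)) => A /= hA.
  by rewrite /USPD /= symp_id //; exact: hA.1.
apply: (Sm_eq (@open_Cor n) _ (Sm_mxlin_comp (@off R n) (@open_Cor n) S2)) => A hA /=.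
by rewrite (symp_id hA.1).
Qed.

Definition chart_OL n : flat_chart (@Cor R n) (@Hol R n) (@Log R n) (@ExpOL R n).
Proof.
apply: (@FlatChart _ _ _ _ _ _ (@hol R n : {linear 'M[R]_n -> 'M[R]_n}) 1%:M).
- exact: Hol_hol.
- exact: hol_id.
- exact: hol_Cor.
- by rewrite Cor_holE; exact: open_Cor.
- by move=> k; rewrite Cor_holE; exact: Sm_Log.
- by move=> k; apply: (Sm_expm_comp openT); exact: Sm_Dcor.
- exact: Hol_Log.
- exact: Cor_ExpOL.
- exact: LogK.
- exact: ExpOLK.
- by move=> A [].
Defined.

End Charts.

(** * The nested embeddings *)

Section Psi.
Context {R : realType}.
Local Notation r2 := (Num.sqrt (2 : R)).

Lemma ip_block m1 m2 n1 n2 (A A' : 'M[R]_(m1, n1)) (B B' : 'M[R]_(m1, n2))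
    (C C' : 'M[R]_(m2, n1)) (D D' : 'M[R]_(m2, n2)) :
  ip (block_mx A B C D) (block_mx A' B' C' D') =
  ip A A' + ip B B' + (ip C C' + ip D D').
Proof.
rewrite /ip big_split_ord /=; congr (_ + _); rewrite -big_split; apply: eq_bigr => i _ /=.
  rewrite big_split_ord /=; congr (_ + _); apply: eq_bigr => j _.
    by rewrite !block_mxEul.
  by rewrite !block_mxEur.
rewrite big_split_ord /=; congr (_ + _); apply: eq_bigr => j _.
  by rewrite !block_mxEdl.
by rewrite !block_mxEdr.
Qed.

Let block_lin m1 m2 n1 n2 a (A A' : 'M[R]_(m1, n1)) (B B' : 'M[R]_(m1, n2))
    (C C' : 'M[R]_(m2, n1)) (D D' : 'M[R]_(m2, n2)) :
  a *: block_mx A B C D + block_mx A' B' C' D' =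
  block_mx (a *: A + A') (a *: B + B') (a *: C + C') (a *: D + D').
Proof. by rewrite scale_block_mx add_block_mx. Qed.

Lemma psiOL_linear k : linear (@psiOL R k).
Proof.
move=> a A B.
have dE : diagcol (a *: A + B) = a *: diagcol A + diagcol B.
  by apply/matrixP => i j; rewrite !mxE.
have h := block_lin a (0 : 'M[R]_1) 0 (r2^-1 *: (diagcol A)^T) (r2^-1 *: (diagcol B)^T)
  (r2^-1 *: diagcol A) (r2^-1 *: diagcol B) (off A) (off B).
(* [k.+1] and [1 + k] agree only by conversion; block lemmas are stated with [1 + k] and applied
   through [etrans], here and below. *)
apply: (etrans _ (esym h)).
rewrite /psiOL dE linearP (linearP (@off R k)) !scalerDr.
by rewrite !scalerA ![a * _]mulrC scaler0 addr0.
Qed.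
HB.instance Definition _ k := GRing.isLinear.Build R 'M[R]_k 'M[R]_k.+1 _
  (@psiOL R k) (@psiOL_linear k).

Lemma Hol_psiOL k (S : 'M[R]_k) : Sym S -> Hol (psiOL S).
Proof.
move=> SS; split.
  have h := tr_block_mx (0 : 'M[R]_1) (r2^-1 *: (diagcol S)^T) (r2^-1 *: diagcol S) (off S).
  apply/SymP; apply: (etrans h).
  by rewrite trmx0 !linearZ /= trmxK (SymP _).1 //; exact: Sym_off.
move=> i; rewrite /psiOL.
have [j ->|j ->] := @split_ordP 1 k i.
  by apply: etrans (block_mxEul _ _ _ _ _ _) _; rewrite mxE.
by apply: etrans (block_mxEdr _ _ _ _ _ _) _; rewrite mxE eqxx.
Qed.

Let r2_neq0 : r2 != 0. Proof. by rewrite gt_eqF // sqrtr_gt0 ltr0n. Qed.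

(** Each diagonal entry of S occurs twice in [psiOL S], in the first row and in the first column,
    with total weight 1/2 + 1/2 in the inner product. *)
Let r2_half : r2^-1 * r2^-1 + r2^-1 * r2^-1 = 1.
Proof.
have h : r2 ^+ 2 = 2 by rewrite sqr_sqrtr // ler0n.
have -> : r2^-1 * r2^-1 = 2^-1 by rewrite -invfM -expr2 h.
by field.
Qed.

Lemma ip_diagcol k (A B : 'M[R]_k) : ip (diagcol A) (diagcol B) + ip (off A) (off B) = ip A B.
Proof.
rewrite /ip -big_split; apply: eq_bigr => i _ /=.
rewrite big_ord1 !mxE (bigD1 i) //= !mxE eqxx mul0r add0r [RHS](bigD1 i) //=.
by congr (_ + _); apply: eq_bigr => j ji; rewrite !mxE eq_sym (negPf ji).
Qed.

Lemma ip_tr m n (A B : 'M[R]_(m, n)) : ip A^T B^T = ip A B.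
Proof.
rewrite /ip exchange_big; apply: eq_bigr => i _; apply: eq_bigr => j _.
by rewrite !mxE.
Qed.

Lemma psiOL_ip k (A B : 'M[R]_k) : ip (psiOL A) (psiOL B) = ip A B.
Proof.
have h := ip_block (0 : 'M[R]_1) 0 (r2^-1 *: (diagcol A)^T) (r2^-1 *: (diagcol B)^T)
  (r2^-1 *: diagcol A) (r2^-1 *: diagcol B) (off A) (off B).
apply: (etrans h).
rewrite ip0l add0r !ipZl !ipZr ip_tr !mulrA addrA -mulrDl r2_half mul1r.
exact: ip_diagcol.
Qed.

(** The diagonal is recovered from the first column, rescaled by the square root of 2. The map is
    linear on all matrices and a two-sided inverse between [Hol] and [Sym]. *)
Definition psiOL_inv k (B : 'M[R]_k.+1) : 'M[R]_k :=
  off (@drsubmx R 1 k 1 k B) + r2 *: diag_mx (@dlsubmx R 1 k 1 k B)^T.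

Lemma psiOL_inv_linear k : linear (@psiOL_inv k).
Proof.
move=> a A B; rewrite /psiOL_inv.
by apply/matrixP => i j; rewrite !mxE; case: eqP => _ /=; rewrite ?mulr0n ?mulr1n; ring.
Qed.
HB.instance Definition _ k := GRing.isLinear.Build R 'M[R]_k.+1 'M[R]_k _
  (@psiOL_inv k) (@psiOL_inv_linear k).

Lemma psiOLK k (S : 'M[R]_k) : psiOL_inv (psiOL S) = S.
Proof.
have e1 : @drsubmx R 1 k 1 k (psiOL S) = off S by exact: block_mxKdr.
have e2 : @dlsubmx R 1 k 1 k (psiOL S) = r2^-1 *: diagcol S by exact: block_mxKdl.
rewrite /psiOL_inv e1 e2; apply/matrixP => i j; rewrite !mxE.
case: eqP => [->|_]; last by rewrite mulr0n mulr0 addr0.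
by rewrite mulr1n add0r mulrA divff // mul1r.
Qed.

Lemma Sym_psiOL_inv k (H : 'M[R]_k.+1) : Hol H -> Sym (psiOL_inv H).
Proof.
move=> [SH _]; apply: SymD; last by apply: SymZ; exact: Sym_diag.
apply/Sym_off/SymP/matrixP => i j; rewrite !mxE.
exact: SymE.
Qed.

Lemma psiOL_invK k (H : 'M[R]_k.+1) : Hol H -> psiOL (psiOL_inv H) = H.
Proof.
move=> [SH H0]; rewrite /psiOL.
apply: etrans (submxK (H : 'M[R]_(1 + k, 1 + k))).
have dE : r2^-1 *: diagcol (psiOL_inv H) = @dlsubmx R 1 k 1 k H.
  apply/matrixP => i j; rewrite ord1 !mxE eqxx add0r mulr1n mulrA mulVf // mul1r.
  by congr (H _ _); exact/val_inj.
congr block_mx.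
- by apply/matrixP => i j; rewrite !ord1 !mxE H0.
- rewrite -linearZ /= dE; apply/matrixP => i j; rewrite !mxE; exact: SymE.
- exact: dE.
apply/matrixP => i j; rewrite !mxE; case: eqP => [->|/eqP ij]; first by rewrite H0.
by rewrite mulr0n mulr0 addr0.
Qed.

Lemma PhiOLE k (X : 'M[R]_k) : PhiOL X = ExpOL (psiOL (logm X)).
Proof. by rewrite /PhiOL /ExpOL addrC. Qed.

Lemma Log_PhiOL k (X : 'M[R]_k) : SPD X -> Log (PhiOL X) = psiOL (logm X).
Proof. by move=> sX; rewrite PhiOLE; exact/ExpOLK/Hol_psiOL/Sym_logm. Qed.

(** Injectivity is what makes the partial inverse in [PhiOLinv] a genuine one on the image. *)
Lemma PhiOL_inj k : {in @SPD R k &, injective (@PhiOL R k)}.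
Proof.
move=> X Y; rewrite !inE => sX sY h.
have e (Z : 'M[R]_k) : SPD Z -> psiOL_inv (Log (PhiOL Z)) = logm Z.
  by move=> sZ; exact: etrans (congr1 (@psiOL_inv k) (Log_PhiOL sZ)) (psiOLK _).
have e1 : logm X = logm Y.
  exact: etrans (esym (e X sX)) (etrans (congr1 (fun C => psiOL_inv (Log C)) h) (e Y sY)).
exact: etrans (esym (logmK sX)) (etrans (congr1 (@expm R k) e1) (logmK sY)).
Qed.

Let psi_congr k (A B : 'M[R]_k) : A = B -> ExpOL (psiOL A) = ExpOL (psiOL B).
Proof. by move=> ->. Qed.

(* As psiOL is onto Hol, E_n is psiOL itself in the coordinates Log. *)
Lemma EstepE k (C : 'M[R]_k.+1) : Cor C -> Estep C = ExpOL (psiOL (Log C)).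
Proof.
move=> cC; have HC := Hol_Log cC; have SC := Sym_psiOL_inv HC.
have e1 : logm (expm (psiOL_inv (Log C))) = psiOL_inv (Log C) := expmK SC.
have e2 : psiOL (psiOL_inv (Log C)) = Log C := psiOL_invK HC.
have CE : PhiOL (expm (psiOL_inv (Log C))) = C.
  apply: etrans (PhiOLE _) _.
  exact: etrans (congr1 (fun S => ExpOL (psiOL S)) e1) (etrans (congr1 (@ExpOL R _) e2) (LogK cC)).
have e3 : PhiOLinv C = expm (psiOL_inv (Log C)).
  apply: etrans (esym (congr1 (@PhiOLinv R k) CE)) _; apply: (pinvKV _ (@PhiOL_inj k)).
  by rewrite inE; exact: SPD_expm.
(* The round trip cancels: [PhiOLinv] applies [psiOL_inv] in logarithmic coordinates and [Fstep]
   applies [psiOL] again, so the intermediate matrix has logarithm [Log C]. *)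
have e4 : logm (Fstep (PhiOLinv C)) = Log C.
  apply: etrans (congr1 (fun X => logm (Fstep X)) e3) _.
  apply: etrans (congr1 (fun S => logm (expm (psiOL S))) e1) _.
  apply: etrans (congr1 (fun S => logm (expm S)) e2) _.
  exact: (expmK HC.1).
have e5 := PhiOLE (Fstep (PhiOLinv C)).
have e6 : ExpOL (psiOL (logm (Fstep (PhiOLinv C)))) = ExpOL (psiOL (Log C)).
  exact: (psi_congr e4).
exact: (etrans e5 e6).
Qed.

End Psi.

(** * Iterated embeddings and the distance across sizes *)

Section Towers.
Context {R : realType}.

Lemma tower_id (step : forall k, 'M[R]_k -> 'M[R]_k.+1) n (X : 'M[R]_n) :
  tower step n X = X.
Proof. by case: n X => [|n] X; rewrite /= ?eqxx conform_mx_id. Qed.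

Lemma tower_S (step : forall k, 'M[R]_k -> 'M[R]_k.+1) m n (X : 'M[R]_m) :
  (m <= n)%N -> tower step n.+1 X = step n (tower step n X).
Proof. by move=> mn; rewrite /= ltn_eqF. Qed.

Lemma tower_tower (step : forall k, 'M[R]_k -> 'M[R]_k.+1) m p n (X : 'M[R]_m) :
  (m <= p)%N -> (p <= n)%N -> tower step n (tower step p X) = tower step n X.
Proof.
move=> mp; elim: n => [|n IH].
  by rewrite leqn0 => /eqP p0; subst p; rewrite tower_id.
rewrite leq_eqVlt => /orP[/eqP pn|]; first by subst p; rewrite tower_id.
by rewrite ltnS => pn; rewrite tower_S // IH // tower_S // (leq_trans mp).
Qed.

Variables (M T : forall n, set 'M[R]_n) (phi e : forall n, 'M[R]_n -> 'M[R]_n).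
Variable F : forall n, flat_chart (@M n) (@T n) (@phi n) (@e n).
Let G n := Riemannian (@M n) (@T n) (pullback_metric (@phi n)).

(** This form is closed under composition, since the inner charts cancel; the linear left inverse
    Psi' provides the immersion and the continuous inverse of an embedding. *)
Definition chart_isometry m n (f : 'M[R]_m -> 'M[R]_n) : Prop :=
  exists (Psi : {linear 'M[R]_m -> 'M[R]_n}) (Psi' : {linear 'M[R]_n -> 'M[R]_m}),
  [/\ forall A, T A -> T (Psi A),
      forall A B, T A -> T B -> ip (Psi A) (Psi B) = ip A B,
      forall A, T A -> Psi' (Psi A) = A &
      forall x, M x -> f x = e (Psi (phi x))].

Lemma chart_isometry_comp m n p (f : 'M[R]_m -> 'M[R]_n) (g : 'M[R]_n -> 'M[R]_p) :
  chart_isometry f -> chart_isometry g -> chart_isometry (g \o f).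
Proof.
move=> [A [A' [AT Ai AK fE]]] [B [B' [BT Bi BK gE]]].
exists (B \o A : {linear _ -> _}), (A' \o B' : {linear _ -> _}); split=> /=.
- by move=> X TX; exact/BT/AT.
- by move=> X Y TX TY; rewrite Bi ?Ai //; exact: AT.
- by move=> X TX; rewrite BK ?AK //; exact: AT.
move=> x Mx; have Tx := AT _ (chart_phi (F m) Mx).
rewrite fE // gE; last exact: (chart_e (F n) Tx).
by rewrite (chart_eK (F n) Tx).
Qed.

Variables (step : forall k, 'M[R]_k -> 'M[R]_k.+1) (k0 : nat).
Hypothesis stepP : forall k, (k0 <= k)%N -> chart_isometry (step (k := k)).
Local Notation tw := (tower step).

Lemma tower_isometry m n : (k0 <= m)%N -> (m <= n)%N ->
  chart_isometry (@tower R step m n).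
Proof.
move=> km; elim: n => [|n IH].
  rewrite leqn0 => /eqP m0; subst m.
  exists (idfun : {linear _ -> _}), (idfun : {linear _ -> _}); split=> // x Mx.
  by rewrite tower_id (chart_phiK (F 0) Mx).
rewrite leq_eqVlt => /orP[/eqP mn|].
  subst m; exists (idfun : {linear _ -> _}), (idfun : {linear _ -> _}); split=> // x Mx.
  by rewrite tower_id (chart_phiK (F _) Mx).
rewrite ltnS => mn.
have -> : @tower R step m n.+1 = step (k := n) \o @tower R step m n.
  by apply/funext => X; rewrite tower_S.
by apply: chart_isometry_comp; [exact: IH|apply: stepP; exact: leq_trans km mn].
Qed.

Lemma tower_embedding m n : (k0 <= m)%N -> (m <= n)%N ->
  totally_geodesic_isometric_embedding (G m) (G n) (@tower R step m n).
Proof.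
move=> km mn; have [Psi [Psi' [PT Pi PK fE]]] := tower_isometry km mn.
exact: (chart_embedding (F m) (F n) PT Pi PK fE).
Qed.

Lemma tower_M m n (X : 'M[R]_m) : (k0 <= m)%N -> (m <= n)%N -> M X -> M (tw n X).
Proof.
move=> km mn MX; have [Psi [Psi' [PT Pi PK fE]]] := tower_isometry km mn.
by rewrite fE //; apply: (chart_e (F n)); apply/PT/(chart_phi (F m)).
Qed.

Lemma tower_dist m n (X Y : 'M[R]_m) : (k0 <= m)%N -> (m <= n)%N -> M X -> M Y ->
  geodesic_dist (G n) (tw n X) (tw n Y) = geodesic_dist (G m) X Y.
Proof.
move=> km mn MX MY; have [Psi [Psi' [PT Pi PK fE]]] := tower_isometry km mn.
have [TX TY] := (chart_phi (F m) MX, chart_phi (F m) MY).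
apply: etrans (chart_dist (F n) (tower_M km mn MX) (tower_M km mn MY)) _.
apply: etrans (esym (chart_dist (F m) MX MY)); congr (_%:E).
have e1 := chart_eK (F n) (PT _ TX); have e2 := chart_eK (F n) (PT _ TY).
have TXY := T_sub (F m) TX TY.
by rewrite !fE // e1 e2 -linearB /nrm Pi.
Qed.

Definition delta m n (X : 'M[R]_m) (Y : 'M[R]_n) : \bar R :=
  geodesic_dist (G (maxn m n)) (tw (maxn m n) X) (tw (maxn m n) Y).

(** Both towers to size N factor through size max(m, n), and the common upper part preserves
    distances. *)
Lemma delta_stable m n N (X : 'M[R]_m) (Y : 'M[R]_n) :
  (k0 <= m)%N -> (k0 <= n)%N -> (maxn m n <= N)%N -> M X -> M Y ->
  geodesic_dist (G N) (tw N X) (tw N Y) = delta X Y.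
Proof.
move=> km kn mnN MX MY; have [mp np] := (leq_maxl m n, leq_maxr m n).
rewrite -(tower_tower step X mp mnN) -(tower_tower step Y np mnN).
by apply: tower_dist => //; [exact: leq_trans km mp|exact: tower_M..].
Qed.

Lemma delta_le m n (X : 'M[R]_m) (Y : 'M[R]_n) : (m <= n)%N ->
  delta X Y = geodesic_dist (G n) (tw n X) Y.
Proof. by move=> mn; rewrite /delta; move: (maxn_idPr mn) => ->; rewrite tower_id. Qed.

(** Any sufficiently large N realizes the distance in one Euclidean space, so the axioms reduce to
    those of a norm once all matrices sit in a common size. *)
Lemma delta_nrm m n N (X : 'M[R]_m) (Y : 'M[R]_n) :
  (k0 <= m)%N -> (k0 <= n)%N -> (maxn m n <= N)%N -> M X -> M Y ->
  delta X Y = (nrm (phi (tw N X) - phi (tw N Y)))%:E.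
Proof.
move=> km kn mnN MX MY; rewrite -(delta_stable km kn mnN) //.
move: mnN; rewrite geq_max => /andP[mN nN].
by rewrite (chart_dist (F N)) //; exact: tower_M.
Qed.

Lemma delta_distance_up_to :
  distance_up_to [set u : anymx | (k0 <= tag u)%N /\ M (tagged u)]
    (fun u v => tw (maxn (tag u) (tag v)) (tagged u) = tw (maxn (tag u) (tag v)) (tagged v))
    (fun u v => delta (tagged u) (tagged v)).
Proof.
split=> [[m X] [n Y] /= [km MX] [kn MY]|[m X] [n Y] /= [km MX] [kn MY]|
  [m X] [n Y] [p Z] /= [km MX] [kn MY] [kp MZ]|[m X] [n Y] /= [km MX] [kn MY]].
- by rewrite (delta_nrm km kn (leqnn _)) // lee_fin nrm_ge0 ltry.
- rewrite (delta_nrm km kn (leqnn _)) // (delta_nrm (N := maxn m n) kn km) // 1?maxnC //.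
  by rewrite nrmBC.
- pose N := maxn (maxn m n) p.
  have mN : (m <= N)%N by rewrite !leq_max leqnn.
  have nN : (n <= N)%N by rewrite !leq_max leqnn orbT.
  have pN : (p <= N)%N by rewrite leq_max leqnn orbT.
  rewrite (delta_nrm (N := N) km kn) ?geq_max ?mN //.
  rewrite (delta_nrm (N := N) kn kp) ?geq_max ?nN //.
  rewrite (delta_nrm (N := N) km kp) ?geq_max ?mN //.
  by rewrite -EFinD lee_fin; exact: nrm_dist.
rewrite (delta_nrm km kn (leqnn _)) //.
have MX' := tower_M km (leq_maxl m n) MX; have MY' := tower_M kn (leq_maxr m n) MY.
split=> [[/nrm_eq0 /eqP]|->]; last by rewrite subrr nrm0.
rewrite subr_eq0 => /eqP h.
by rewrite -(chart_phiK (F _) MX') -(chart_phiK (F _) MY') h.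
Qed.

End Towers.

Section Steps.
Context {R : realType}.

Lemma Fstep_isometry k : chart_isometry (@SPD R) (@Sym R) (@logm R) (@expm R) (@Fstep R k).
Proof.
exists (@psiOL R k : {linear _ -> _}), (@psiOL_inv R k : {linear _ -> _}); split.
- by move=> A SA; exact: (Hol_psiOL SA).1.
- by move=> A B _ _; exact: psiOL_ip.
- by move=> A _; exact: psiOLK.
- by [].
Qed.

Lemma Estep_isometry k : (2 <= k)%N ->
  chart_isometry (@Cor R) (@Hol R) (@Log R) (@ExpOL R) (@Estep R k).
Proof.
case: k => [//|k] _.
exists (@psiOL R k.+1 : {linear _ -> _}), (@psiOL_inv R k.+1 : {linear _ -> _}); split.
- by move=> A HA; exact: (Hol_psiOL HA.1).
- by move=> A B _ _; exact: psiOL_ip.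
- by move=> A _; exact: psiOLK.
- by move=> x; exact: EstepE.
Qed.

End Steps.

Theorem corollary4p36 (R : realType) :
  (forall m n : nat, (1 <= m)%N -> (m <= n)%N ->
     totally_geodesic_isometric_embedding
       (@gLE R m) (@gLE R n) (@Fmap R m n)) /\
  (forall m n : nat, (2 <= m)%N -> (m <= n)%N ->
     totally_geodesic_isometric_embedding
       (@gOL R m) (@gOL R n) (@Emap R m n)) /\
  (forall (m n : nat) (X : 'M[R]_m) (Y : 'M[R]_n),
     (1 <= m)%N -> (1 <= n)%N -> SPD X -> SPD Y ->
     (forall N : nat, (maxn m n <= N)%N ->
        dLE (Fmap N X) (Fmap N Y) = deltaLE X Y) /\
     ((m <= n)%N -> deltaLE X Y = dLE (Fmap n X) Y)) /\
  (forall (m n : nat) (C : 'M[R]_m) (D : 'M[R]_n),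
     (2 <= m)%N -> (2 <= n)%N -> Cor C -> Cor D ->
     (forall N : nat, (maxn m n <= N)%N ->
        dOL (Emap N C) (Emap N D) = deltaOL C D) /\
     ((m <= n)%N -> deltaOL C D = dOL (Emap n C) D)) /\
  distance_up_to (@SPDs R) Fsim
    (fun u v => deltaLE (tagged u) (tagged v)) /\
  distance_up_to (@Cors R) Esim
    (fun u v => deltaOL (tagged u) (tagged v)).
Proof.
have FP k (_ : (1 <= k)%N) := @Fstep_isometry R k.
have EP := @Estep_isometry R.
split; first exact: (tower_embedding (@chart_LE R) FP).
split; first exact: (tower_embedding (@chart_OL R) EP).
split=> [m n X Y m1 n1 sX sY|].
  split=> [N mnN|]; first exact: (delta_stable (@chart_LE R) FP m1 n1 mnN sX sY).
  exact: (delta_le (@SPD R) (@Sym R) (@logm R) (@Fstep R) X Y).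
split=> [m n C D m2 n2 cC cD|].
  split=> [N mnN|]; first exact: (delta_stable (@chart_OL R) EP m2 n2 mnN cC cD).
  exact: (delta_le (@Cor R) (@Hol R) (@Log R) (@Estep R) C D).
split; first exact: (delta_distance_up_to (@chart_LE R) FP).
exact: (delta_distance_up_to (@chart_OL R) EP).
Qed.
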